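(* Let $n,m$ be any non-negative integers such that the inequality $(m-1)(n-1)\geq 2$ holds. Then there exists a proper algebraic subset $\Sigma\subset \mathbb{CP}^{2n+1}\times\mathbb{CP}^{2m+1}$ such that for any pair of rational functions $$P(z)=\frac{a_nz^n+a_{n-1}z^{n-1}+\dots+a_0}{b_nz^n+b_{n-1}z^{n-1}+\dots+b_0},\qquad Q(z)=\frac{c_mz^m+c_{m-1}z^{m-1}+\dots+c_0}{d_mz^m+d_{m-1}z^{m-1}+\dots+d_0}$$ with complex coefficients satisfying $(a_n,\dots,a_0,b_n,\dots,b_0,c_m,\dots,c_0,d_m,\dots,d_0)\notin\Sigma$, the equation $P(f)=Q(g)$ has no non-constant solutions $f,g$ meromorphic on $\mathbb C$.
   Context: The tuple $(a_n,\dots,a_0,b_n,\dots,b_0,c_m,\dots,c_0,d_m,\dots,d_0)$ is identified with the point $([a_n:\dots:a_0:b_n:\dots:b_0],[c_m:\dots:c_0:d_m:\dots:d_0])$ of $\mathbb{CP}^{2n+1}\times\mathbb{CP}^{2m+1}$. A proper algebraic subset is a Zariski closed subset different from the whole space. A solution of $P(f)=Q(g)$ is a pair of meromorphic functions $f,g$ on $\mathbb C$ with $P\circ f=Q\circ g$. *)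

(* Defs.v *)
From HB Require Import structures.
From mathcomp Require Import all_boot all_order all_algebra.
From mathcomp Require Import all_classical all_reals all_analysis.
From mathcomp Require Import complex.
From mathcomp Require mpoly.
(* The notations of mpoly clash with those of MathComp-Analysis; the canonical
   structures and coercions do not. *)
Import -(notations) mpoly.

Set Implicit Arguments.
Unset Strict Implicit.
Unset Printing Implicit Defensive.

Import Order.TTheory GRing.Theory Num.Theory.
Import numFieldNormedType.Exports.

Local Open Scope classical_set_scope.
Local Open Scope ring_scope.

(* Typed as a numClosedFieldType, R[i] gets the topology and the
   normed module structure given by its modulus. *)
Definition Cplx (R : realType) : numClosedFieldType := R[i].

Section Projective.
Variable F : fieldType.

(* The points of the projective space of dimension k are the lines of F^(k+1). *)
Definition projective_space (k : nat) : Type :=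
  {L : {vspace 'rV[F]_k.+1} | \dim L == 1%N}.

(* p is the point [v_0 : ... : v_k]; this forces v != 0. *)
Definition homogeneous_coord (k : nat) (p : projective_space k)
  (v : 'rV[F]_k.+1) : Prop := sval p = <[v]>%VS.

Definition bihomogeneous (k l : nat) (G : mpoly (k.+1 + l.+1) F) : Prop :=
  exists d e : nat, forall mon, mon \in msupp G ->
    (\sum_(i < k.+1) mon (lshift l.+1 i))%N = d /\
    (\sum_(j < l.+1) mon (rshift k.+1 j))%N = e.

Definition vanishes_at (k l : nat) (G : mpoly (k.+1 + l.+1) F)
  (x : projective_space k * projective_space l) : Prop :=
  forall v w, homogeneous_coord x.1 v -> homogeneous_coord x.2 w ->
    meval (row_mx v w 0) G = 0.

(* The Zariski topology of the product variety, not the product topology. *)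
Definition zariski_closed (k l : nat)
  (S : set (projective_space k * projective_space l)) : Prop :=
  exists I : set (mpoly (k.+1 + l.+1) F),
    (forall G, I G -> bihomogeneous G) /\
    S = [set x | forall G, I G -> vanishes_at G x].

Definition proper_algebraic_subset (k l : nat)
  (S : set (projective_space k * projective_space l)) : Prop :=
  zariski_closed S /\ S <> setT.

(* (a_n, ..., a_0, b_n, ..., b_0), where a_i and b_i are the coefficients of
   z^i in A and B. *)
Definition coef_vector (n : nat) (A B : {poly F}) : 'rV[F]_(2 * n + 1).+1 :=
  \row_(i < (2 * n + 1).+1)
    if (i <= n)%N then A`_(n - i) else B`_(2 * n + 1 - i).

(* The fraction A / B, of two polynomials of degree at most n, as a self-map
   of the projective line; None is the point at infinity. A and B may have a
   common factor, which has to be removed before evaluating. At infinity,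
   p / q has the value p_d / q_d with d = max (deg p) (deg q). *)
Definition ratfun (A B : {poly F}) (w : option F) : option F :=
  let p := A %/ gcdp A B in
  let q := B %/ gcdp A B in
  let quotient (s t : F) := if t == 0 then None else Some (s / t) in
  match w with
  | Some z => quotient p.[z] q.[z]
  | None => let d := (maxn (size p) (size q)).-1 in quotient p`_d q`_d
  end.

End Projective.

Section Meromorphic.
Variable C : numClosedFieldType.
Implicit Types (f : C -> option C) (z : C).

(* The value 0 at the poles is a dummy: fin_part is only used where f <> None. *)
Definition fin_part f : C -> C := fun z => odflt 0 (f z).

Definition complex_diff_at f z : Prop :=
  f z <> None /\ derivable (fin_part f) z 1.

Definition holomorphic_at f z : Prop :=
  \forall w \near z, complex_diff_at f w.

Definition pole_at f z : Prop :=
  [/\ f z = None, \forall w \near z^', complex_diff_at f w &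
      `|fin_part f w| @[w --> z^'] --> +oo].

Definition meromorphic f : Prop :=
  forall z, holomorphic_at f z \/ pole_at f z.

Definition nonconstant f : Prop := ~ exists c, forall z, f z = c.

End Meromorphic.

(* Main.v *)
(** For generic a / b and c / d the curve F(x, y) = a(x) d(y) - b(x) c(y) = 0 is smooth in
    P^1 x P^1: the two maps have no common critical value. This is the nonvanishing of an
    explicit bihomogeneous determinant, which is invertible for x^n and
    (y^m - 1) / (y^m + 1).

    A meromorphic solution (f, g) pulls the holomorphic forms x^i y^j dx / F_y, for
    i <= n - 2 and j <= m - 2, back to entire functions, which are not all zero. Rescaling
    at points chosen as in Brody's lemma makes them bounded by 2 on discs of radius tending
    to infinity, with modulus bounded below at 0, so that by Cauchy's estimate they become
    constant. If n > 2 then x is a quotient of two such forms, so x becomes constant;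
    the Hamiltonian system x' = phi F_y, y' = - phi F_x then forces F to vanish on a whole
    vertical line, which is impossible. *)
Require Import Defs.
From mathcomp Require Import all_boot all_order all_algebra.
From mathcomp Require Import all_classical all_reals all_analysis.
From mathcomp Require Import complex mxtens perm zify ring lra.
From mathcomp Require mpoly.
Import -(notations) mpoly.

Set Implicit Arguments.
Unset Strict Implicit.
Unset Printing Implicit Defensive.

Import Order.TTheory GRing.Theory Num.Theory.
Import numFieldNormedType.Exports.

Local Open Scope classical_set_scope.
Local Open Scope ring_scope.

(** * Complex-valued functions of a real variable *)

(** A smooth curve of bidegree (n, m) has genus (n - 1)(m - 1), so the hypothesis says that the
    genus is at least 2; then n or m exceeds 2, and exchanging x and y one may take n > 2.
    Hyperbolicity would usually come from the universal cover of the curve. Here the sum of the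
    moduli of the pulled back forms replaces the hyperbolic metric: at a point whose two coordinates
    have modulus at most 1 it is comparable to a single form, which controls both x' and y'. No
    limit function is extracted from the rescaled solutions. Only germs at 0 are followed, along an
    ultrafilter: the bounded ones are closed under sums and products, the small ones absorb bounded
    factors, both are stable under differentiation, and one may divide by a germ bounded away from 0
    at the centre. Limits are taken of the values at 0 alone. The tensor product in the determinant
    eliminates the common critical value without computing any critical value, which keeps the
    condition polynomial in the coefficients. *)

Section ComplexAnalysis.
Variable R : realType.
Local Notation C := (Cplx R).

(* The modulus with values in R; `|z| is an element of C. *)
Definition nm (z : C) : R := Normc.normc z.
Definition rc (x : R) : C := (x%:C)%C.
Definition ii : C := 'i%C.
Local Arguments nm : simpl never.

Lemma nm0 : nm 0 = 0. Proof. exact: Normc.normc0. Qed.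
Lemma nm1 : nm 1 = 1. Proof. exact: Normc.normc1. Qed.
Lemma nmM z w : nm (z * w) = nm z * nm w. Proof. exact: Normc.normcM. Qed.
Lemma nmV z : nm z^-1 = (nm z)^-1. Proof. exact: Normc.normcV. Qed.
Lemma nmN z : nm (- z) = nm z. Proof. exact: normcN. Qed.
Lemma nmD z w : nm (z + w) <= nm z + nm w. Proof. exact: le_normcD. Qed.
Lemma nm_ge0 z : 0 <= nm z.
Proof. by case: z => a b; rewrite /nm /= sqrtr_ge0. Qed.
Lemma nm_eq0 z : nm z = 0 -> z = 0. Proof. exact: Normc.eq0_normc. Qed.
Lemma nm_gt0 z : (0 < nm z) = (z != 0).
Proof.
rewrite lt_def nm_ge0 andbT; congr (~~ _); apply/eqP/eqP; first exact: nm_eq0.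
by move=> ->; rewrite nm0.
Qed.
Lemma nmB z w : nm (z - w) = nm (w - z). Proof. by rewrite -nmN opprB. Qed.
Lemma nmX z k : nm (z ^+ k) = nm z ^+ k.
Proof. by elim: k => [|k IH]; rewrite ?expr0 ?nm1 // !exprS nmM IH. Qed.
Lemma nm_rc x : nm (rc x) = `|x|.
Proof. by rewrite /nm /rc /= expr0n /= addr0 sqrtr_sqr. Qed.
Lemma nm_ii : nm ii = 1.
Proof. by rewrite /nm /ii /= expr0n /= add0r expr1n sqrtr1. Qed.
Lemma iiM : ii * ii = -1. Proof. by rewrite -expr2; exact: sqr_i. Qed.
Lemma normrE (z : C) : `|z| = rc (nm z).
Proof. by case: z => a b. Qed.
Lemma rcD x y : rc (x + y) = rc x + rc y. Proof. exact: (rmorphD (real_complex R)). Qed.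
Lemma rcB x y : rc (x - y) = rc x - rc y. Proof. exact: (rmorphB (real_complex R)). Qed.
Lemma rcM x y : rc (x * y) = rc x * rc y. Proof. exact: (rmorphM (real_complex R)). Qed.
Lemma rc0 : rc 0 = 0. Proof. by []. Qed.
Lemma rc1 : rc 1 = 1. Proof. by []. Qed.
Lemma rc_eq0 x : (rc x == 0) = (x == 0). Proof. exact: (fmorph_eq0 (real_complex R)). Qed.
Lemma rc_ltE x y : (rc x < rc y) = (x < y). Proof. exact: ltcR. Qed.
Lemma rc_leE x y : (rc x <= rc y) = (x <= y). Proof. exact: lecR. Qed.

Lemma nm_re (z : C) : `|complex.Re z| <= nm z.
Proof.
case: z => a b; rewrite /nm /= -sqrtr_sqr ler_wsqrtr //.
by rewrite lerDl sqr_ge0.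
Qed.
Lemma nm_im (z : C) : `|complex.Im z| <= nm z.
Proof.
case: z => a b; rewrite /nm /= -sqrtr_sqr ler_wsqrtr //.
by rewrite lerDr sqr_ge0.
Qed.
Lemma ReImE (z : C) : z = rc (complex.Re z) + ii * rc (complex.Im z).
Proof. exact: complexE. Qed.
(** The infimum of the counterexamples can neither be a counterexample nor be followed closely by
    one. This drives the continuation arguments along segments. *)
Lemma real_ind (a b : R) (P : R -> Prop) : P a ->
  (forall t, a <= t < b -> (forall u, a <= u <= t -> P u) ->
     exists2 d, 0 < d & forall u, t < u < t + d -> u <= b -> P u) ->
  (forall t, a < t <= b -> (forall u, a <= u < t -> P u) -> P t) ->
  forall t, a <= t <= b -> P t.
Proof.
move=> Pa Pstep Plim t1 t1ab; apply: contrapT => NPt1.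
pose B := [set t | a <= t <= b /\ ~ P t].
have hB : has_inf B.
  by split; [exists t1 | exists a => x [/andP[]]].
pose m := inf B.
have am : a <= m by apply: lb_le_inf; [exists t1 | move=> x [/andP[]]].
have mt1 : m <= t1 by apply: ge_inf => //; case: hB.
have Plt u : a <= u < m -> P u.
  move=> /andP[au um]; apply: contrapT => NPu.
  suff : m <= u by rewrite leNgt um.
  apply: ge_inf; first by case: hB.
  split=> //; rewrite au /=; case/andP: t1ab => _; lra.
have Pm : P m.
  move: am; rewrite le_eqVlt => /orP[/eqP <- //|am].
  by apply: Plim => //; rewrite am /=; case/andP: t1ab; lra.
have mb : m < b.
  rewrite lt_neqAle; apply/andP; split; last by case/andP: t1ab; lra.
  apply/eqP => mb; apply: NPt1; suff -> : t1 = m by [].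
  by apply/eqP; rewrite eq_le mt1 andbT mb; case/andP: t1ab.
case: (Pstep m); first by rewrite am.
  move=> u /andP[au]; rewrite le_eqVlt => /orP[/eqP -> //|um].
  by apply: Plt; rewrite au.
move=> d d0 Pd.
have [t [/andP[at_ tb] NPt] td] := inf_adherent d0 hB.
have mt : m <= t.
  by apply: ge_inf; [case: hB | split => //; rewrite at_ tb].
apply: NPt.
move: mt; rewrite le_eqVlt => /orP[/eqP <- //|mt].
by apply: Pd => //; rewrite mt.
Qed.

Definition rder (H : R -> C) (t : R) (l : C) : Prop :=
  forall e, 0 < e -> exists2 d, 0 < d &
    forall u, `|u| < d -> nm (H (t + u) - H t - rc u * l) <= e * `|u|.

Definition rcont (h : R -> C) (t : R) : Prop :=
  forall e, 0 < e -> exists2 d, 0 < d &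
    forall u, `|u| < d -> nm (h (t + u) - h t) <= e.

Lemma pos_min (d1 d2 : R) : 0 < d1 -> 0 < d2 ->
  exists d, [/\ 0 < d, d <= d1 & d <= d2].
Proof.
move=> d10 d20; exists (Num.min d1 d2).
by rewrite lt_min d10 d20 !ge_min !lexx orbT.
Qed.

Lemma rder_cont H t l : rder H t l -> rcont H t.
Proof.
move=> /(_ 1 ltr01) [d d0 hd] e e0.
pose K := 1 + nm l; have K0 : 0 < K by rewrite /K; have := nm_ge0 l; lra.
exists (Num.min d (e / K)); first by rewrite lt_min d0 divr_gt0.
move=> u; rewrite lt_min => /andP[ud uK].
have -> : H (t + u) - H t = (H (t + u) - H t - rc u * l) + rc u * l by ring.
apply: le_trans (nmD _ _) _; rewrite nmM nm_rc.
apply: le_trans (lerD (hd _ ud) (lexx _)) _.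
rewrite ltr_pdivlMr // in uK; apply: le_trans (ltW uK).
by rewrite /K mulrDr mul1r mulr1.
Qed.

Lemma rder_ext H1 H2 t l : (forall u, H1 u = H2 u) -> rder H1 t l -> rder H2 t l.
Proof. by move=> E h e /h [d d0 hd]; exists d => // u; rewrite -!E; exact: hd. Qed.

Lemma rderD H1 H2 t l1 l2 : rder H1 t l1 -> rder H2 t l2 ->
  rder (fun u => H1 u + H2 u) t (l1 + l2).
Proof.
move=> h1 h2 e e0.
have e2 : 0 < e / 2 by lra.
have [d1 d10 k1] := h1 _ e2; have [d2 d20 k2] := h2 _ e2.
exists (Num.min d1 d2); first by rewrite lt_min d10.
move=> u; rewrite lt_min => /andP[u1 u2].
have -> : H1 (t + u) + H2 (t + u) - (H1 t + H2 t) - rc u * (l1 + l2)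
  = (H1 (t + u) - H1 t - rc u * l1) + (H2 (t + u) - H2 t - rc u * l2) by ring.
apply: le_trans (nmD _ _) _; have := k1 _ u1; have := k2 _ u2; lra.
Qed.

Lemma rderZ H t l c : rder H t l -> rder (fun u => c * H u) t (c * l).
Proof.
move=> h e e0; pose K := 1 + nm c.
have K0 : 0 < K by rewrite /K; have := nm_ge0 c; lra.
have [d d0 k] := h _ (divr_gt0 e0 K0); exists d => // u ud.
have -> : c * H (t + u) - c * H t - rc u * (c * l) = c * (H (t + u) - H t - rc u * l) by ring.
rewrite nmM; apply: le_trans (ler_wpM2l (nm_ge0 c) (k _ ud)) _.
rewrite mulrA ler_wpM2r // mulrCA ler_piMr ?(ltW e0) // ler_pdivrMr // mul1r /K; lra.
Qed.

Lemma rder_cst c t : rder (fun=> c) t 0.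
Proof.
move=> e e0; exists 1 => // u _.
by rewrite subrr mulr0 subrr nm0 mulr_ge0 // ltW.
Qed.

Lemma rder_id t : rder rc t 1.
Proof.
move=> e e0; exists 1 => // u _.
have -> : rc (t + u) - rc t - rc u * 1 = 0 by rewrite rcD; ring.
by rewrite nm0 mulr_ge0 // ltW.
Qed.

(** No point need realize the mean slope of a complex-valued function, so the bound is propagated
    from [a] by real induction with slope [M + e]. The slack [e] pays for the first-order error of
    each step and is removed at the end. *)
Lemma mvi H H' a b M : a <= b ->
  (forall t, a <= t <= b -> rder H t (H' t)) ->
  (forall t, a <= t <= b -> nm (H' t) <= M) -> nm (H b - H a) <= M * (b - a).
Proof.
move=> ab hH hM.
have hb : a <= b <= b by rewrite ab lexx.
suff key e : 0 < e -> nm (H b - H a) <= (M + e) * (b - a).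
  have [->|nab] := eqVneq a b; first by rewrite !subrr nm0 mulr0.
  have ba0 : 0 < b - a by rewrite subr_gt0 lt_neqAle nab.
  apply/ler_addgt0Pr => e e0.
  have := key _ (divr_gt0 e0 ba0); rewrite mulrDl divfK //; exact: lt0r_neq0.
move=> e0; apply: (@real_ind a b (fun t => nm (H t - H a) <= (M + e) * (t - a))) => //.
- by rewrite !subrr nm0 mulr0.
- move=> t /andP[at_ tb] /(_ t) ht.
  have tab : a <= t <= b by rewrite at_ ltW.
  have [d d0 hd] := hH _ tab _ e0.
  exists d => // u /andP[tu ud] ub.
  have ut : `|u - t| < d by rewrite gtr0_norm; lra.
  have := hd _ ut; rewrite (addrC t) subrK gtr0_norm ?subr_gt0 // => k1.
  have k2 : nm (H t - H a) <= (M + e) * (t - a) by apply: ht; rewrite at_ lexx.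
  have -> : H u - H a = (H u - H t - rc (u - t) * H' t) + rc (u - t) * H' t
     + (H t - H a) by ring.
  apply: le_trans (nmD _ _) _; apply: le_trans (lerD (nmD _ _) (lexx _)) _.
  rewrite nmM nm_rc gtr0_norm ?subr_gt0 //.
  have : (u - t) * nm (H' t) <= (u - t) * M.
    by rewrite ler_wpM2l ?hM // subr_ge0 ltW.
  nra.
- move=> t /andP[at_ tb] ht.
  have tab : a <= t <= b by rewrite ltW.
  apply/ler_addgt0Pr => e1 e10.
  have [d d0 hd] := rder_cont (hH _ tab) e10.
  pose u := Num.max a (t - d / 2).
  have ua : a <= u by rewrite le_max lexx.
  have ut : u < t by rewrite gt_max at_ /=; lra.
  have ud : t - d / 2 <= u by rewrite le_max lexx orbT.
  have utd : `|u - t| < d by rewrite ltr0_norm; lra.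
  have k1 := hd _ utd; rewrite (addrC t) subrK in k1.
  have k2 : nm (H u - H a) <= (M + e) * (u - a) by apply: ht; rewrite ua.
  have -> : H t - H a = (H t - H u) + (H u - H a) by ring.
  apply: le_trans (nmD _ _) _; rewrite nmB.
  have M0 : 0 <= M by apply: le_trans (hM _ tab); exact: nm_ge0.
  nra.
Qed.

Lemma rder0_cst H a b : a <= b -> (forall t, a <= t <= b -> rder H t 0) -> H b = H a.
Proof.
move=> ab h; apply/eqP; rewrite -subr_eq0; apply/eqP/nm_eq0.
apply/eqP; rewrite eq_le nm_ge0 andbT.
have := @mvi H (fun=> 0) a b 0 ab h; rewrite mul0r; apply => t _.
by rewrite nm0.
Qed.

End ComplexAnalysis.

Arguments nm {R} z : simpl never.
Arguments rc {R} x : simpl never.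
Arguments ii R : simpl never.

(** * Antiderivatives and integrals over real segments *)

Lemma is_derive_eps (K : numFieldType) (f : K -> K) (x l : K) : is_derive x 1 f l ->
  forall e, 0 < e -> exists2 d, 0 < d &
    forall u, `|u| < d -> `|f (x + u) - f x - u * l| <= e * `|u|.
Proof.
move=> [df dl] e e0.
have : (fun h => h^-1 *: ((f \o shift x) (h *: 1) - f x)) @ 0^' --> l.
  by rewrite -dl; exact: df.
move=> /cvgrPdist_le /(_ _ e0) /nbhs_ballP [d /= d0 hd].
exists d => // u ud.
have [->|u0] := eqVneq u 0; first by rewrite addr0 subrr mul0r subrr normr0 mulr0.
have := hd u; rewrite /ball /= sub0r normrN => /(_ ud u0).
rewrite /GRing.scale /= mulr1 [u + x]addrC => k.
rewrite -ler_pdivrMr ?normr_gt0 // -normf_div.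
rewrite distrC in k.
suff -> : (f (x + u) - f x - u * l) / u = u^-1 * (f (x + u) - f x) - l by [].
by field.
Qed.

Section Prim.
Variable R : realType.
Local Notation C := (Cplx R).
Local Notation mu := (@lebesgue_measure R).

Lemma real_prim (h : R -> R) (L : R) : continuous h -> 
  exists H : R -> R, forall t : R, `|t| < L -> is_derive t 1 H (h t).
Proof.
move=> ch.
exists (fun x => \int[mu]_(t in [set` `[- L, x]]) (h t))%R => t.
rewrite ltr_norml => /andP[t1 t2].
have ih : mu.-integrable `[- L, L] (EFin \o h).
  apply: continuous_compact_integrable; first exact: segment_compact.
  exact: continuous_subspaceT.
have [k1 k2] := continuous_FTC1_closed t2 ih t1 (ch t).
split; first exact: k1.
by rewrite -derive1E; exact: k2.
Qed.

Lemma prim_ex (h : R -> C) (a b : R) : a <= b ->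
  (forall t, a <= t <= b -> rcont h t) ->
  exists H, forall t, a <= t <= b -> rder H t (h t).
Proof.
move=> ab ch.
(* Retraction of the line onto [[a, b]]. Being 1-Lipschitz it makes [h \o cl] continuous everywhere,
   so antiderivatives exist on both sides of the end points. *)
pose cl (t : R) := if t < a then a else if b < t then b else t.
have clE t : a <= t <= b -> cl t = t.
  by move=> /andP[at_ tb]; rewrite /cl !ltNge at_ tb.
have clab t : a <= cl t <= b.
  by rewrite /cl; case: ltP => k1; rewrite ?lexx ?ab //; case: ltP => k2; rewrite ?lexx ?ab // k1.
have cl_lip t u : `|cl (t + u) - cl t| <= `|u|.
  rewrite /cl; case: (ltP (t + u) a) => ?; case: (ltP b (t + u)) => ?;
  case: (ltP t a) => ?; case: (ltP b t) => ?; rewrite ler_norml;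
  case: (ger0P u) => u0; apply/andP; split; lra.
have hc (t e : R) : 0 < e -> exists2 d : R, 0 < d & forall u, `|u| < d ->
    nm (h (cl (t + u)) - h (cl t)) <= e.
  move=> e0; have [d d0 hd] := ch _ (clab t) _ e0; exists d => // u ud.
  have := hd (cl (t + u) - cl t); rewrite (addrC (cl t)) subrK; apply.
  exact: le_lt_trans (cl_lip _ _) ud.
have cont (g : C -> R) : (forall z, `|g z| <= nm z) ->
     (forall z w, g (z - w) = g z - g w) -> continuous (g \o h \o cl).
  move=> gn gB t; apply/cvgrPdist_le => e e0.
  have [d d0 hd] := hc t _ e0.
  apply/nbhs_ballP; exists d => //= u; rewrite /ball /= distrC => ud.
  rewrite distrC -gB; apply: le_trans (gn _) _.
  by have := hd _ ud; rewrite (addrC t) subrK.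
have ReB z w : complex.Re (z - w : C) = complex.Re z - complex.Re w by case: z w => ? ? [].
have ImB z w : complex.Im (z - w : C) = complex.Im z - complex.Im w by case: z w => ? ? [].
pose L : R := `|a| + `|b| + 1.
have [H1 k1] := real_prim L (cont _ (@nm_re R) ReB).
have [H2 k2] := real_prim L (cont _ (@nm_im R) ImB).
have rr (H : R -> R) (t l : R) : is_derive t 1 H l -> rder (fun u => rc (H u)) t (rc l).
  move=> /is_derive_eps hH e /hH [d d0 hd]; exists d => // u ud.
  by rewrite -!rcB -rcM -rcB nm_rc; exact: hd.
exists (fun t => rc (H1 t) + ii R * rc (H2 t)) => t tab.
rewrite [h t]ReImE.
have tL : `|t| < L.
  rewrite /L; case/andP: tab => ? ?; rewrite ltr_norml; apply/andP; split.
    have := ler_norm (- a); rewrite normrN; have := normr_ge0 b; lra.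
  have := ler_norm b; have := normr_ge0 a; lra.
by apply: rderD; [|apply: rderZ]; apply: rr; [have := k1 _ tL | have := k2 _ tL]; rewrite /= clE.
Qed.

(* The integral of h over [a, b], as the increment of an antiderivative. *)
Definition cint (a b : R) (h : R -> C) : C :=
  let H := xget (fun=> 0) [set H | forall t, a <= t <= b -> rder H t (h t)] in
  H b - H a.

(** Two antiderivatives differ by a function of zero derivative, so each of them has the same
    increment as the one chosen by [xget]. *)
Lemma cintE a b h H : a <= b -> (forall t, a <= t <= b -> rder H t (h t)) ->
  cint a b h = H b - H a.
Proof.
move=> ab hH; rewrite /cint.
set K := xget _ _.
have hK : forall t, a <= t <= b -> rder K t (h t).
  by apply: (@xgetPex _ (fun=> 0) [set H | forall t, a <= t <= b -> rder H t (h t)]); exists H.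
have : (fun t => K t + -1 * H t) b = (fun t => K t + -1 * H t) a.
  apply: (@rder0_cst _ (fun t => K t + -1 * H t) a b ab) => t tab.
  have -> : 0 = h t + -1 * h t by ring.
  by apply: rderD; [exact: hK | apply: rderZ; exact: hH].
move=> /= E; apply/eqP; rewrite -subr_eq0; apply/eqP.
by transitivity ((K b + -1 * H b) - (K a + -1 * H a)); [ring | rewrite E subrr].
Qed.

Definition conton (a b : R) (h : R -> C) := forall t, a <= t <= b -> rcont h t.

Lemma rcont_ext (h1 h2 : R -> C) t : h1 =1 h2 -> rcont h1 t -> rcont h2 t.
Proof. by move=> E h e /h [d d0 k]; exists d => // u; rewrite -!E; exact: k. Qed.

Lemma cint_bound a b h M : a <= b -> conton a b h ->
  (forall t, a <= t <= b -> nm (h t) <= M) -> nm (cint a b h) <= M * (b - a).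
Proof.
move=> ab /(prim_ex ab) [H hH] hM; rewrite (cintE ab hH); exact: mvi hM.
Qed.

Lemma cint_cat a b c (h : R -> C) : a <= b -> b <= c -> conton a c h ->
  cint a c h = cint a b h + cint b c h.
Proof.
move=> ab bc /(prim_ex (le_trans ab bc)) [H hH].
rewrite (cintE _ hH) ?(le_trans ab bc) //.
rewrite (@cintE a b _ H) // ?(@cintE b c _ H) //; first by ring.
- by move=> t /andP[bt tc]; apply: hH; rewrite (le_trans ab bt).
- by move=> t /andP[bt tc]; apply: hH; rewrite (le_trans tc bc) andbT.
Qed.

Lemma cintD a b h1 h2 : a <= b -> conton a b h1 -> conton a b h2 ->
  cint a b (fun t => h1 t + h2 t) = cint a b h1 + cint a b h2.
Proof.
move=> ab /(prim_ex ab) [H1 k1] /(prim_ex ab) [H2 k2].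
rewrite (cintE ab k1) (cintE ab k2) (@cintE _ _ _ (fun t => H1 t + H2 t)) //; first by ring.
by move=> t tab; apply: rderD; [exact: k1|exact: k2].
Qed.

Lemma cintZ a b c h : a <= b -> conton a b h ->
  cint a b (fun t => c * h t) = c * cint a b h.
Proof.
move=> ab /(prim_ex ab) [H1 k1].
rewrite (cintE ab k1) (@cintE _ _ _ (fun t => c * H1 t)) //; first by ring.
by move=> t tab; apply: rderZ; exact: k1.
Qed.

Lemma cint_ext a b h1 h2 : a <= b -> h1 =1 h2 -> cint a b h1 = cint a b h2.
Proof. by move=> ab /funext ->. Qed.

Lemma cint_cst a b c : a <= b -> cint a b (fun=> c) = rc (b - a) * c.
Proof.
move=> ab; rewrite (@cintE _ _ _ (fun t => c * rc t)) //; first by rewrite rcB; ring.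
by move=> t _; rewrite -[X in rder _ _ X]mulr1; apply: rderZ; exact: rder_id.
Qed.
End Prim.

(** * Cauchy's theorem and its consequences *)

Section Goursat.
Variable R : realType.
Local Notation C := (Cplx R).

(** This is one coordinate of a sequence of dyadic rectangles. Every left end lies below every right
    end, so the supremum of the left ends is in all the intervals. *)
Lemma nested_point (u : nat -> R) (L : R) : 0 <= L ->
  (forall k, u k.+1 = u k \/ u k.+1 = u k + L / 2 ^+ k.+1) ->
  exists x, forall k, u k <= x <= u k + L / 2 ^+ k.
Proof.
move=> L0 hu.
have p2 k : 0 < (2 : R) ^+ k by rewrite exprn_gt0.
have half k : L / 2 ^+ k = L / 2 ^+ k.+1 + L / 2 ^+ k.+1.
  by rewrite exprS; field; rewrite lt0r_neq0.
have Lk k : 0 <= L / 2 ^+ k by rewrite divr_ge0 // ltW.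
have hS k : u k <= u k.+1 /\ u k.+1 + L / 2 ^+ k.+1 <= u k + L / 2 ^+ k.
  by have := Lk k.+1; have := half k; case: (hu k) => ->; lra.
have mono j k : u k <= u (k + j)%N /\ u (k + j)%N + L / 2 ^+ (k + j) <= u k + L / 2 ^+ k.
  elim: j => [|j [IH1 IH2]]; first by rewrite addn0.
  by rewrite addnS; have [] := hS (k + j)%N; lra.
have uv j k : u j <= u k + L / 2 ^+ k.
  have [jk|/ltnW kj] := leqP j k.
    by have := (mono (k - j)%N j).1; rewrite subnKC //; have := Lk k; lra.
  by have := (mono (j - k)%N k).2; rewrite subnKC //; have := Lk j; lra.
have hs : has_sup (range u).
  by split; [exists (u 0%N); exists 0%N | exists (u 0%N + L / 2 ^+ 0) => _ [j _ <-]].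
exists (sup (range u)) => k; apply/andP; split.
  by apply: ub_le_sup; [case: hs | exists k].
by apply: ge_sup; [case: hs | move=> _ [j _ <-]].
Qed.

(** If P failed, it would fail on a quarter, then on a quarter of that, and so on; these rectangles
    shrink to a point, where the local hypothesis contradicts the failure. This is the compactness
    part of Goursat's argument, for a property of a corner, a width and a height. *)
Lemma bisect2 (P : R -> R -> R -> R -> Prop) (a c W H : R) : 0 <= W -> 0 <= H ->
  (forall x y w h, 0 <= w -> 0 <= h -> P x y (w / 2) (h / 2) ->
     P (x + w / 2) y (w / 2) (h / 2) -> P x (y + h / 2) (w / 2) (h / 2) ->
     P (x + w / 2) (y + h / 2) (w / 2) (h / 2) -> P x y w h) ->
  (forall x y, a <= x <= a + W -> c <= y <= c + H -> exists2 d, 0 < d &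
     forall x' y' k, W / 2 ^+ k + H / 2 ^+ k < d ->
       x' <= x <= x' + W / 2 ^+ k -> y' <= y <= y' + H / 2 ^+ k ->
       P x' y' (W / 2 ^+ k) (H / 2 ^+ k)) ->
  P a c W H.
Proof.
move=> W0 H0 Pstep Ploc; apply: contrapT => NP.
have p2 k : 0 < (2 : R) ^+ k by rewrite exprn_gt0.
have half L k : L / 2 ^+ k.+1 = L / 2 ^+ k / 2 :> R.
  by rewrite exprS; field; rewrite lt0r_neq0.
(* The failure of P is carried as an implication, so that a quarter exists for every index and
   corner and [choice] applies. *)
have step (kp : nat * (R * R)) : exists p' : R * R,
   [/\ p'.1 = kp.2.1 \/ p'.1 = kp.2.1 + W / 2 ^+ kp.1.+1,
       p'.2 = kp.2.2 \/ p'.2 = kp.2.2 + H / 2 ^+ kp.1.+1 &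
       ~ P kp.2.1 kp.2.2 (W / 2 ^+ kp.1) (H / 2 ^+ kp.1) ->
       ~ P p'.1 p'.2 (W / 2 ^+ kp.1.+1) (H / 2 ^+ kp.1.+1)].
  case: kp => k [x y] /=; apply: contrapT => /forallNP N.
  have Q p' : p'.1 = x \/ p'.1 = x + W / 2 ^+ k.+1 ->
       p'.2 = y \/ p'.2 = y + H / 2 ^+ k.+1 ->
       P p'.1 p'.2 (W / 2 ^+ k.+1) (H / 2 ^+ k.+1).
    by move=> h1 h2; apply: contrapT => h3; apply: (N p').
  have NPxy : ~ P x y (W / 2 ^+ k) (H / 2 ^+ k).
    move=> h; apply: (N (x, y)); split; [by left | by left |].
    by move=> /= hN; case: (hN h).
  have Wk : 0 <= W / 2 ^+ k by rewrite divr_ge0 // ltW.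
  have Hk : 0 <= H / 2 ^+ k by rewrite divr_ge0 // ltW.
  apply: NPxy; apply: Pstep => //; rewrite -!half.
  - by apply: (Q (x, y)); left.
  - by apply: (Q (_, y)); [right | left].
  - by apply: (Q (x, _)); [left | right].
  - by apply: (Q (_, _)); right.
have [f hf] := choice step.
pose q := fix q k := if k is k'.+1 then f (k', q k') else (a, c).
have qN k : ~ P (q k).1 (q k).2 (W / 2 ^+ k) (H / 2 ^+ k).
  elim: k => [|k IH]; first by rewrite /= expr0 !divr1.
  by have [_ _] := hf (k, q k); apply.
have [x hx] : exists x, forall k, (q k).1 <= x <= (q k).1 + W / 2 ^+ k.
  by apply: (@nested_point (fun k => (q k).1)) => // k; have [] := hf (k, q k).
have [y hy] : exists x, forall k, (q k).2 <= x <= (q k).2 + H / 2 ^+ k.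
  by apply: (@nested_point (fun k => (q k).2)) => // k; have [] := hf (k, q k).
have := hx 0%N; have := hy 0%N; rewrite /= expr0 !divr1 => hy0 hx0.
have [d d0 hd] := Ploc _ _ hx0 hy0.
have [k hk] : exists k, (W + H) / 2 ^+ k < d.
  exists (Num.truncn ((W + H) / d)).+1.
  rewrite ltr_pdivrMr // mulrC -ltr_pdivrMr //.
  apply: lt_le_trans (truncnS_gt _) _.
  by rewrite -natrX ler_nat ltnW // ltn_expl.
by apply: (qN k); apply: hd => //; rewrite -mulrDl.
Qed.

(** The integral of h dz along the boundary, counterclockwise; the terms are the bottom, top, right
    and left sides. *)
Definition rect_int (h : R -> R -> C) (x y w l : R) : C :=
  cint x (x + w) (fun s => h s y) - cint x (x + w) (fun s => h s (y + l))
  + ii R * (cint y (y + l) (fun t => h (x + w) t) - cint y (y + l) (h x)).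

(* h x y is differentiable as a function of x + i y. *)
Definition hder (h : R -> R -> C) (x y : R) (l : C) : Prop :=
  forall e, 0 < e -> exists2 d, 0 < d & forall u v, `|u| < d -> `|v| < d ->
    nm (h (x + u) (y + v) - h x y - (rc u + ii R * rc v) * l) <= e * (`|u| + `|v|).

Lemma hder_rder1 h x y l : hder h x y l -> rder (fun s => h s y) x l.
Proof.
move=> hh e /hh [d d0 hd]; exists d => // u ud.
have := hd u 0 ud; rewrite normr0 => /(_ d0).
by rewrite rc0 mulr0 !addr0.
Qed.

Lemma hder_rder2 h x y l : hder h x y l -> rder (h x) y (ii R * l).
Proof.
move=> hh e /hh [d d0 hd]; exists d => // v vd.
have -> : rc v * (ii R * l) = (rc 0 + ii R * rc v) * l by rewrite rc0; ring.
by have := hd 0 v; rewrite normr0 (addr0 x) (add0r `|v|) => /(_ d0 vd).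
Qed.

Lemma contonB (a b : R) (h g : R -> C) :
  conton a b h -> conton a b g -> conton a b (fun t => h t - g t).
Proof.
move=> ch cg t tab e e0.
have e2 : 0 < e / 2 by lra.
have [d1 d10 k1] := ch _ tab _ e2; have [d2 d20 k2] := cg _ tab _ e2.
exists (Num.min d1 d2); first by rewrite lt_min d10.
move=> u; rewrite lt_min => /andP[u1 u2].
rewrite [X in nm X](_ : _ = (h (t + u) - h t) - (g (t + u) - g t)); last by ring.
apply: le_trans (nmD _ _) _; rewrite nmN; have := k1 _ u1; have := k2 _ u2; lra.
Qed.

Section Rect.
Variables (h : R -> R -> C) (x0 y0 W L : R).
Hypotheses (W0 : 0 <= W) (L0 : 0 <= L).
Hypothesis hol : forall x y, x0 <= x <= x0 + W -> y0 <= y <= y0 + L ->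
  exists l, hder h x y l.

Let cont1 y a b : x0 <= a -> b <= x0 + W -> y0 <= y <= y0 + L ->
  conton a b (fun s => h s y).
Proof.
move=> xa bx yy t /andP[at_ tb].
have [|l hl] := @hol t y _ yy; first by rewrite (le_trans xa at_) (le_trans tb bx).
exact: rder_cont (hder_rder1 hl).
Qed.

Let cont2 x a b : x0 <= x <= x0 + W -> y0 <= a -> b <= y0 + L ->
  conton a b (h x).
Proof.
move=> xx ya by_ t /andP[at_ tb].
have [|l hl] := @hol x t xx; first by rewrite (le_trans ya at_) (le_trans tb by_).
exact: rder_cont (hder_rder2 hl).
Qed.

Lemma rect_split x y w l : 0 <= w -> 0 <= l -> 
  x0 <= x -> x + w <= x0 + W -> y0 <= y -> y + l <= y0 + L ->
  rect_int h x y w l = rect_int h x y (w / 2) (l / 2) +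
    rect_int h (x + w / 2) y (w / 2) (l / 2) +
    rect_int h x (y + l / 2) (w / 2) (l / 2) +
    rect_int h (x + w / 2) (y + l / 2) (w / 2) (l / 2).
Proof.
move=> w0 l0 xx xw yy yl; rewrite /rect_int.
have -> : x + w / 2 + w / 2 = x + w by lra.
have -> : y + l / 2 + l / 2 = y + l by lra.
have e1 t : y <= t <= y + l -> cint x (x + w) (h ^~ t) =
   cint x (x + w / 2) (h ^~ t) + cint (x + w / 2) (x + w) (h ^~ t).
  move=> /andP[t1 t2].
  by apply: cint_cat; rewrite ?lerD2l; try lra; apply: cont1 => //; lra.
have e2 s : x <= s <= x + w -> cint y (y + l) (h s) =
   cint y (y + l / 2) (h s) + cint (y + l / 2) (y + l) (h s).
  move=> /andP[t1 t2].
  by apply: cint_cat; rewrite ?lerD2l; try lra; apply: cont2 => //; lra.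
rewrite !e1 ?e2; try (by apply/andP; split; lra).
ring.
Qed.

(** Near (x, y) the function is affine in x + i y, with vanishing boundary integral, up to an error
    of at most [e * (w + l)] on a boundary of length [2 * (w + l)]. *)
Lemma rect_local x y (e : R) : 0 < e ->
  x0 <= x <= x0 + W -> y0 <= y <= y0 + L -> exists2 d : R, 0 < d &
  forall x' y' w l, 0 <= w -> 0 <= l -> w + l < d -> x' <= x <= x' + w -> y' <= y <= y' + l ->
    x0 <= x' -> x' + w <= x0 + W -> y0 <= y' -> y' + l <= y0 + L ->
    nm (rect_int h x' y' w l) <= 2 * e * (w + l) * (w + l).
Proof.
move=> e0 xx yy; have [D hD] := hol xx yy.
have [d d0 hd] := hD _ e0; exists d => // x' y' w l w0 l0 wl /andP[x1 x2] /andP[y1 y2] x3 x4 y3 y4.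
pose g s t : C := h x y + (rc (s - x) + ii R * rc (t - y)) * D.
pose k s t := h s t - g s t.
have hk s t : x' <= s <= x' + w -> y' <= t <= y' + l -> nm (k s t) <= e * (w + l).
  move=> /andP[s1 s2] /andP[t1 t2].
  have sx : `|s - x| <= w by rewrite ler_norml; apply/andP; split; lra.
  have ty : `|t - y| <= l by rewrite ler_norml; apply/andP; split; lra.
  have := hd (s - x) (t - y); rewrite !(addrC _ (_ - _)) !subrK /k /g opprD addrA => hh.
  apply: le_trans (hh _ _) _; try lra.
  by rewrite ler_pM2l //; lra.
(* Quadratic antiderivatives of the affine part along horizontal and, below, vertical lines; with
   them its boundary integral cancels by algebra. *)
have gp1 t s : rder (fun u => (h x y + ii R * rc (t - y) * D - rc x * D) * rc u + 
     (D / 2) * (rc u * rc u)) s (g s t).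
  have -> : g s t = (h x y + ii R * rc (t - y) * D - rc x * D) * 1 + (D / 2) * (2 * rc s).
    by rewrite /g rcB; field.
  apply: rderD; first by apply: rderZ; exact: rder_id.
  apply: rderZ => e' e'0; exists e' => // u ue.
  rewrite rcD [X in nm X](_ : _ = rc (u * u)) ?rcM; last by ring.
  by rewrite -rcM nm_rc normrM ler_wpM2r // ltW.
have gp2 s t : rder (fun u => (h x y + rc (s - x) * D - ii R * rc y * D) * rc u + 
     (ii R * D / 2) * (rc u * rc u)) t (g s t).
  have -> : g s t = (h x y + rc (s - x) * D - ii R * rc y * D) * 1 + (ii R * D / 2) * (2 * rc t).
    by rewrite /g (rcB t); field.
  apply: rderD; first by apply: rderZ; exact: rder_id.
  apply: rderZ => e' e'0; exists e' => // u ue.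
  rewrite rcD [X in nm X](_ : _ = rc (u * u)) ?rcM; last by ring.
  by rewrite -rcM nm_rc normrM ler_wpM2r // ltW.
have xw : x' <= x' + w by lra.
have yl : y' <= y' + l by lra.
have intg : rect_int g x' y' w l = 0.
  rewrite /rect_int (cintE xw (fun s _ => gp1 y' s)) (cintE xw (fun s _ => gp1 (y' + l) s)).
  rewrite (cintE yl (fun s _ => gp2 (x' + w) s)) (cintE yl (fun s _ => gp2 x' s)).
  rewrite !rcB !rcD.
  by field.
have cg1 t a b : conton a b (g ^~ t).
  move=> s _ e' e'0; pose K := 1 + nm D.
  have K0 : 0 < K by rewrite /K; have := nm_ge0 D; lra.
  exists (e' / K); first by rewrite divr_gt0.
  move=> u uK; rewrite [X in nm X](_ : _ = rc u * D); last first.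
    by rewrite /g !rcB rcD; ring.
  rewrite nmM nm_rc; rewrite ltr_pdivlMr // in uK.
  apply: le_trans (ltW uK); rewrite /K mulrDr mulr1 lerDr //.
have cg2 s a b : conton a b (g s).
  move=> t _ e' e'0; pose K := 1 + nm D.
  have K0 : 0 < K by rewrite /K; have := nm_ge0 D; lra.
  exists (e' / K); first by rewrite divr_gt0.
  move=> u uK; rewrite [X in nm X](_ : _ = ii R * (rc u * D)); last first.
    by rewrite /g !rcB rcD; ring.
  rewrite nmM nm_ii mul1r nmM nm_rc; rewrite ltr_pdivlMr // in uK.
  apply: le_trans (ltW uK); rewrite /K mulrDr mulr1 lerDr //.
have contk1 t a b : x0 <= a -> b <= x0 + W -> y0 <= t <= y0 + L -> conton a b (k ^~ t).
  by move=> xa bx yt; apply: contonB; [exact: cont1 | exact: cg1].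
have contk2 s a b : x0 <= s <= x0 + W -> y0 <= a -> b <= y0 + L -> conton a b (k s).
  by move=> xs ya by_; apply: contonB; [exact: cont2 | exact: cg2].
have yy' t : y' <= t <= y' + l -> y0 <= t <= y0 + L by move=> /andP[? ?]; lra.
have xx' t : x' <= t <= x' + w -> x0 <= t <= x0 + W by move=> /andP[? ?]; lra.
have s1 t : y' <= t <= y' + l ->
   cint x' (x' + w) (h ^~ t) = cint x' (x' + w) (g ^~ t) + cint x' (x' + w) (k ^~ t).
  move=> ty; rewrite -cintD //; first by apply: cint_ext => // s; rewrite /k addrC subrK.
  by apply: contk1 => //; exact: yy'.
have s2 t : x' <= t <= x' + w ->
   cint y' (y' + l) (h t) = cint y' (y' + l) (g t) + cint y' (y' + l) (k t).
  move=> ty; rewrite -cintD //; first by apply: cint_ext => // s; rewrite /k addrC subrK.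
  by apply: contk2 => //; exact: xx'.
have -> : rect_int h x' y' w l = rect_int g x' y' w l + rect_int k x' y' w l.
  by rewrite /rect_int !s1 ?s2 ?lexx ?xw ?yl //; ring.
rewrite intg add0r /rect_int.
have b1 t : y' <= t <= y' + l -> nm (cint x' (x' + w) (k ^~ t)) <= e * (w + l) * w.
  move=> ty; apply: le_trans (cint_bound xw (contk1 _ _ _ x3 x4 (yy' _ ty)) _) _.
    by move=> s sx; exact: hk.
  have -> : x' + w - x' = w by ring.
  exact: lexx.
have b2 t : x' <= t <= x' + w -> nm (cint y' (y' + l) (k t)) <= e * (w + l) * l.
  move=> ty; apply: le_trans (cint_bound yl (contk2 _ _ _ (xx' _ ty) y3 y4) _) _.
    by move=> s sx; exact: hk.
  have -> : y' + l - y' = l by ring.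
  exact: lexx.
apply: le_trans (nmD _ _) _; rewrite nmM nm_ii mul1r.
apply: le_trans (lerD (nmD _ _) (nmD _ _)) _; rewrite !nmN.
have c1 := b1 y'; have c2 := b1 (y' + l); have c3 := b2 x'; have c4 := b2 (x' + w).
rewrite !lexx ?xw ?yl /= in c1 c2 c3 c4.
have := c1 isT; have := c2 isT; have := c3 isT; have := c4 isT; lra.
Qed.

(** The bound [2 * e' * (w + l) * (w + l)] is quadratic in the sides: the bounds of the four
    quarters add up to that of the rectangle, so it is inherited under bisection. *)
Theorem goursat : rect_int h x0 y0 W L = 0.
Proof.
apply: nm_eq0; apply/eqP; rewrite eq_le nm_ge0 andbT; apply/ler_addgt0Pr => e e0.
rewrite add0r.
(* The summand 1 keeps the denominator positive when both sides are 0. *)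
pose e' := e / (2 * (W + L) ^+ 2 + 1).
have K0 : 0 < 2 * (W + L) ^+ 2 + 1 by have := sqr_ge0 (W + L); lra.
have e'0 : 0 < e' by rewrite divr_gt0.
suff : nm (rect_int h x0 y0 W L) <= 2 * e' * (W + L) * (W + L).
  move=> /le_trans; apply.
  have : e' * (2 * (W + L) ^+ 2 + 1) = e by rewrite /e' divfK // lt0r_neq0.
  by nra.
pose P x y w l := x0 <= x -> x + w <= x0 + W -> y0 <= y -> y + l <= y0 + L ->
  nm (rect_int h x y w l) <= 2 * e' * (w + l) * (w + l).
suff : P x0 y0 W L by apply.
apply: bisect2 => //.
- move=> x y w l w0 l0 h1 h2 h3 h4 a1 a2 a3 a4; rewrite rect_split //.
  have b1 : x0 <= x + w / 2 by lra.
  have b2 : x + w / 2 <= x0 + W by lra.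
  have b3 : y0 <= y + l / 2 by lra.
  have b4 : y + l / 2 <= y0 + L by lra.
  have b5 : x + w / 2 + w / 2 <= x0 + W by lra.
  have b6 : y + l / 2 + l / 2 <= y0 + L by lra.
  apply: le_trans (nmD _ _) _; apply: le_trans (lerD (nmD _ _) (lexx _)) _.
  apply: le_trans (lerD (lerD (nmD _ _) (lexx _)) (lexx _)) _.
  apply: le_trans (lerD (lerD (lerD (h1 a1 b2 a3 b4) (h2 b1 b5 a3 b4)) (h3 a1 b2 b3 b6))
    (h4 b1 b5 b3 b6)) _.
  have -> : 2 * e' * (w / 2 + l / 2) * (w / 2 + l / 2) = 2 * e' * (w + l) * (w + l) / 4 by field.
  by move: (2 * e' * (w + l) * (w + l)) => z; lra.
- move=> x y xx yy; have [d d0 hd] := rect_local e'0 xx yy.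
  exists d => // x' y' k kd xk yk a1 a2 a3 a4.
  by apply: hd => //; rewrite divr_ge0 // exprn_ge0.
Qed.
End Rect.
End Goursat.

(** * Complex differentiability *)

Section Holomorphic.
Variable R : realType.
Local Notation C := (Cplx R).

(* The value at 0 is not excluded: clim q l forces q 0 = l. *)
Definition clim (q : C -> C) (l : C) : Prop :=
  forall e, 0 < e -> exists2 d, 0 < d & forall h, nm h < d -> nm (q h - l) <= e.

Definition ccont (f : C -> C) (z : C) : Prop := clim (fun h => f (z + h)) (f z).

(** Caratheodory's form of the derivative: with the difference quotient [q] a total function, sums,
    products and compositions are handled by algebra on the quotients. *)
Definition cder (f : C -> C) (z l : C) : Prop :=
  exists2 q, (forall h, f (z + h) = f z + h * q h) & clim q l.

Lemma clim_cst c : clim (fun=> c) c.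
Proof. by move=> e e0; exists 1 => // h _; rewrite subrr nm0 ltW. Qed.

Lemma clim_id : clim id 0.
Proof. by move=> e e0; exists e => // h /ltW; rewrite subr0. Qed.

Lemma climD q1 q2 l1 l2 : clim q1 l1 -> clim q2 l2 ->
  clim (fun h => q1 h + q2 h) (l1 + l2).
Proof.
move=> h1 h2 e e0; have e2 : 0 < e / 2 by lra.
have [d1 d10 k1] := h1 _ e2; have [d2 d20 k2] := h2 _ e2.
exists (Num.min d1 d2); first by rewrite lt_min d10.
move=> h; rewrite lt_min => /andP[u1 u2].
rewrite opprD addrACA; apply: le_trans (nmD _ _) _.
have := k1 _ u1; have := k2 _ u2; lra.
Qed.

Lemma climM q1 q2 l1 l2 : clim q1 l1 -> clim q2 l2 ->
  clim (fun h => q1 h * q2 h) (l1 * l2).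
Proof.
move=> h1 h2 e e0.
pose K := 1 + nm l1 + nm l2.
have n1 := nm_ge0 l1; have n2 := nm_ge0 l2.
have K0 : 0 < K by rewrite /K; lra.
pose e1 := Num.min 1 (e / K).
have e10 : 0 < e1 by rewrite lt_min ltr01 divr_gt0.
have e11 : e1 <= 1 by rewrite ge_min lexx.
have e1K : e1 * K <= e by rewrite -ler_pdivlMr // ge_min lexx orbT.
have [d1 d10 k1] := h1 _ e10; have [d2 d20 k2] := h2 _ e10.
exists (Num.min d1 d2); first by rewrite lt_min d10.
move=> h; rewrite lt_min => /andP[/k1 u1 /k2 u2].
have -> : q1 h * q2 h - l1 * l2 = (q1 h - l1) * (q2 h - l2) + (q1 h - l1) * l2 + l1 * (q2 h - l2) by ring.
apply: le_trans (nmD _ _) _; apply: le_trans (lerD (nmD _ _) (lexx _)) _.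
rewrite !nmM; apply: le_trans e1K; rewrite /K.
have m1 := nm_ge0 (q1 h - l1); have m2 := nm_ge0 (q2 h - l2).
have : nm (q1 h - l1) * nm (q2 h - l2) <= e1 * 1.
  by apply: ler_pM => //; apply: le_trans e11.
have : nm (q1 h - l1) * nm l2 <= e1 * nm l2 by rewrite ler_wpM2r.
have : nm l1 * nm (q2 h - l2) <= nm l1 * e1 by rewrite ler_wpM2l.
nra.
Qed.

Lemma clim_comp k q l : clim k 0 -> clim q l -> clim (fun h => q (k h)) l.
Proof.
move=> hk hq e /hq [d d0 hd].
have d2 : 0 < d / 2 by lra.
have [d' d'0 hd'] := hk _ d2; exists d' => // h /hd'; rewrite subr0 => kh.
by apply: hd; lra.
Qed.

Lemma climV q l : l != 0 -> clim q l -> clim (fun h => (q h)^-1) l^-1.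
Proof.
move=> l0 hq e e0.
have nl : 0 < nm l by rewrite nm_gt0.
pose e1 := Num.min (nm l / 2) (e * (nm l * nm l) / 2).
have e10 : 0 < e1 by rewrite lt_min !(divr_gt0, mulr_gt0).
have [d d0 hd] := hq _ e10; exists d => // h /hd.
rewrite le_min => /andP[h1 h2].
have qh : nm l / 2 <= nm (q h).
  have : nm l <= nm (q h) + nm (q h - l).
    rewrite [nm (_ - _)]nmB; apply: le_trans (nmD _ _).
    by rewrite [q h + _]addrC subrK.
  lra.
have q0 : q h != 0 by rewrite -nm_gt0; lra.
have -> : (q h)^-1 - l^-1 = (l - q h) / (q h * l) by field; rewrite l0 q0.
rewrite nmM nmV nmM nmB.
have p : 0 < nm (q h) * nm l by rewrite mulr_gt0 // nm_gt0.
rewrite ler_pdivrMr //; apply: le_trans h2 _.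
have : nm l / 2 * nm l <= nm (q h) * nm l by rewrite ler_wpM2r // ltW.
nra.
Qed.

Lemma cder_cont f z l : cder f z l -> ccont f z.
Proof.
move=> [q hq lq]; rewrite /ccont.
have -> : (fun h => f (z + h)) = (fun h => f z + h * q h) by apply/funext.
rewrite -[X in clim _ X]addr0 -[X in clim _ (_ + X)](mul0r l).
by apply: climD; [exact: clim_cst | apply: climM => //; exact: clim_id].
Qed.

Lemma ccontP f z : ccont f z <-> forall e, 0 < e -> exists2 d, 0 < d &
  forall w, nm (w - z) < d -> nm (f w - f z) <= e.
Proof.
split=> h e /h [d d0 hd]; exists d => // w wd; last by apply: hd; rewrite addrC addKr.
by have := hd (w - z) wd; rewrite [z + _]addrC subrK.
Qed.

Lemma cderP f z l : cder f z l <-> forall e, 0 < e -> exists2 d, 0 < d &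
    forall h, nm h < d -> nm (f (z + h) - f z - h * l) <= e * nm h.
Proof.
split=> [[q hq lq] e /lq [d d0 hd]|hf].
  exists d => // h /hd k; rewrite hq.
  have -> : f z + h * q h - f z - h * l = h * (q h - l) by ring.
  by rewrite nmM mulrC ler_wpM2r // nm_ge0.
exists (fun h => if h == 0 then l else (f (z + h) - f z) / h).
  move=> h; case: eqVneq => [->|h0]; first by rewrite addr0 mul0r addr0.
  by rewrite mulrC divfK // [f z + _]addrC subrK.
move=> e e0; have [d d0 hd] := hf _ e0; exists d => // h.
case: eqVneq => [->|h0] /hd; first by rewrite subrr nm0 => _; exact: ltW.
have -> : (f (z + h) - f z) / h - l = (f (z + h) - f z - h * l) / h by field.
by rewrite nmM nmV ler_pdivrMr // nm_gt0.
Qed.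

Lemma cder_uniq f z l1 l2 : cder f z l1 -> cder f z l2 -> l1 = l2.
Proof.
move=> /cderP h1 /cderP h2; apply/eqP; rewrite -subr_eq0; apply/eqP/nm_eq0/eqP.
rewrite eq_le nm_ge0 andbT; apply/ler_addgt0Pr => e e0; rewrite add0r.
have e2 : 0 < e / 2 by lra.
have [d1 d10 k1] := h1 _ e2; have [d2 d20 k2] := h2 _ e2.
pose h := rc (Num.min d1 d2 / 2).
have m0 : 0 < Num.min d1 d2 by rewrite lt_min d10.
have nh : nm h = Num.min d1 d2 / 2 by rewrite nm_rc gtr0_norm // divr_gt0.
have hd1 : nm h < d1.
  have : Num.min d1 d2 <= d1 by rewrite ge_min lexx.
  by rewrite nh; lra.
have hd2 : nm h < d2.
  have : Num.min d1 d2 <= d2 by rewrite ge_min lexx orbT.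
  by rewrite nh; lra.
have h0 : 0 < nm h by rewrite nh; lra.
have := nmD (f (z + h) - f z - h * l2) (- (f (z + h) - f z - h * l1)).
rewrite [X in nm X <= _](_ : _ = h * (l1 - l2)); last by ring.
rewrite nmN nmM => k.
rewrite -(ler_pM2l h0); apply: le_trans k _.
have := k1 _ hd1; have := k2 _ hd2; lra.
Qed.

Lemma cder_ext f g z l d : 0 < d -> (forall w, nm (w - z) < d -> f w = g w) ->
  cder f z l -> cder g z l.
Proof.
move=> d0 E /cderP hf; apply/cderP => e /hf [d' d'0 hd'].
exists (Num.min d d'); first by rewrite lt_min d0.
move=> h; rewrite lt_min => /andP[h1 h2].
by rewrite -!E ?subrr ?nm0 //; [exact: hd' | rewrite addrC addKr].
Qed.

Lemma cder_cst c z : cder (fun=> c) z 0.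
Proof. by exists (fun=> 0); [move=> h; rewrite mulr0 addr0 | exact: clim_cst]. Qed.

Lemma cder_id z : cder id z 1.
Proof. by exists (fun=> 1); [move=> h; rewrite mulr1 | exact: clim_cst]. Qed.

Lemma cderD f g z l k : cder f z l -> cder g z k -> cder (fun w => f w + g w) z (l + k).
Proof.
move=> [q hq lq] [p hp lp]; exists (fun h => q h + p h); last exact: climD.
by move=> h; rewrite hq hp; ring.
Qed.

Lemma cderM f g z l k : cder f z l -> cder g z k ->
  cder (fun w => f w * g w) z (l * g z + f z * k).
Proof.
move=> hf hg; have cg := cder_cont hg.
case: hf hg => [q hq lq] [p hp lp].
exists (fun h => q h * g (z + h) + f z * p h).
  by move=> h; rewrite hq hp; ring.
by apply: climD; apply: climM => //; exact: clim_cst.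
Qed.

Lemma cderZ c f z l : cder f z l -> cder (fun w => c * f w) z (c * l).
Proof. by move=> h; have := cderM (cder_cst c z) h; rewrite mul0r add0r. Qed.

Lemma cderN f z l : cder f z l -> cder (fun w => - f w) z (- l).
Proof.
move=> h; have := cderZ (-1) h; rewrite mulN1r; apply: cder_ext ltr01 _.
by move=> w _; rewrite mulN1r.
Qed.

Lemma cderB f g z l k : cder f z l -> cder g z k -> cder (fun w => f w - g w) z (l - k).
Proof. by move=> hf hg; apply: cderD => //; exact: cderN. Qed.

Lemma cder_comp F f z l k : cder F (f z) k -> cder f z l ->
  cder (fun w => F (f w)) z (k * l).
Proof.
move=> [Q hQ lQ] hf; have cf := cder_cont hf; case: hf => [q hq lq].
exists (fun h => Q (h * q h) * q h); first by move=> h; rewrite hq hQ; ring.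
apply: climM => //; apply: clim_comp lQ.
by rewrite -(mul0r l); apply: climM => //; exact: clim_id.
Qed.

Lemma cderV f z l : f z != 0 -> cder f z l -> cder (fun w => (f w)^-1) z (- l / (f z) ^+ 2).
Proof.
move=> f0 hf; have cf := cder_cont hf; case: hf => [q hq lq].
(* The factorization used below fails where [f (z + h) = 0], so the local criterion replaces a
   quotient defined for all h. *)
apply/cderP => e e0.
have lim : clim (fun h => - q h * (f z)^-1 * (f (z + h))^-1) (- l * (f z)^-1 * (f z)^-1).
  apply: climM; last exact: climV.
  apply: climM; last exact: clim_cst.
  have := climM (clim_cst (-1)) lq; rewrite mulN1r.
  by under eq_fun do rewrite mulN1r.
have nz : 0 < nm (f z) / 2 by rewrite divr_gt0 // nm_gt0.
have [d1 d10 k1] := cf _ nz; have [d2 d20 k2] := lim _ e0.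
exists (Num.min d1 d2); first by rewrite lt_min d10.
move=> h; rewrite lt_min => /andP[h1 h2].
have fh : f (z + h) != 0.
  have := k1 _ h1; rewrite -nm_gt0 => k.
  have : nm (f z) <= nm (f (z + h)) + nm (f (z + h) - f z).
    rewrite [nm (_ - _)]nmB; apply: le_trans (nmD _ _).
    by rewrite [f (z + h) + _]addrC subrK.
  lra.
have -> : (f (z + h))^-1 - (f z)^-1 - h * (- l / f z ^+ 2) =
   h * (- q h * (f z)^-1 * (f (z + h))^-1 - - l * (f z)^-1 * (f z)^-1).
  rewrite hq in fh *; move: (q h) (f z) fh f0 => Q a fh a0.
  by field; rewrite a0 fh.
by rewrite nmM mulrC ler_wpM2r ?nm_ge0 // k2.
Qed.

Lemma cder_poly (p : {poly C}) f z l : cder f z l ->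
  cder (fun w => p.[f w]) z (p^`().[f z] * l).
Proof.
move=> hf; elim/poly_ind: p => [|p c IH].
  rewrite deriv0 horner0 mul0r; apply: cder_ext ltr01 _ (cder_cst 0 z).
  by move=> w _; rewrite horner0.
have := cderD (cderM IH hf) (cder_cst c z).
rewrite derivMXaddC hornerD hornerM hornerX addr0 => h.
have -> : (p.[f z] + p^`().[f z] * f z) * l = p^`().[f z] * l * f z + p.[f z] * l by ring.
by apply: cder_ext ltr01 _ h => w _; rewrite hornerMXaddC.
Qed.

Definition chol f z := exists l, cder f z l.
Definition cderiv (f : C -> C) (z : C) : C := xget 0 [set l | cder f z l].

Lemma cderivP f z : chol f z -> cder f z (cderiv f z).
Proof. by move=> [l hl]; apply: (@xgetPex _ 0 [set l | cder f z l]); exists l. Qed.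

Lemma cderivE f z l : cder f z l -> cderiv f z = l.
Proof. by move=> h; exact: cder_uniq (cderivP (ex_intro _ l h)) h. Qed.

Lemma cder_rder g (gam : R -> C) t l k : cder g (gam t) l -> rder gam t k ->
  rder (fun u => g (gam u)) t (l * k).
Proof.
move=> /cderP hg hgam e e0.
pose K := 1 + nm k + nm l.
have n1 := nm_ge0 k; have n2 := nm_ge0 l.
have K0 : 0 < K by rewrite /K; lra.
pose e1 := Num.min 1 (e / K).
have e10 : 0 < e1 by rewrite lt_min ltr01 divr_gt0.
have e11 : e1 <= 1 by rewrite ge_min lexx.
have e1K : e1 * K <= e by rewrite -ler_pdivlMr // ge_min lexx orbT.
have [d1 d10 k1] := hg _ e10; have [d2 d20 k2] := hgam _ e10.
have d12 : 0 < d1 / 2 by lra.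
have [d3 d30 k3] := rder_cont hgam d12.
exists (Num.min d2 d3); first by rewrite lt_min d20.
move=> u; rewrite lt_min => /andP[/k2 u2 /k3 u3].
have ud : nm (gam (t + u) - gam t) < d1 by lra.
have := k1 _ ud; rewrite [gam t + _]addrC subrK => k4.
have -> : g (gam (t + u)) - g (gam t) - rc u * (l * k) =
  (g (gam (t + u)) - g (gam t) - (gam (t + u) - gam t) * l) +
  l * (gam (t + u) - gam t - rc u * k) by ring.
apply: le_trans (nmD _ _) _; rewrite nmM.
have k5 : nm (gam (t + u) - gam t) <= e1 * `|u| + `|u| * nm k.
  have -> : gam (t + u) - gam t = (gam (t + u) - gam t - rc u * k) + rc u * k by ring.
  by apply: le_trans (nmD _ _) _; rewrite nmM nm_rc lerD2r.
have k6 : nm l * nm (gam (t + u) - gam t - rc u * k) <= nm l * (e1 * `|u|).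
  by rewrite ler_wpM2l.
have k7 : e1 * nm (gam (t + u) - gam t) <= e1 * (e1 * `|u| + `|u| * nm k).
  by rewrite ler_pM2l.
have u0 := normr_ge0 u.
have k8 : e1 * (e1 * `|u|) <= e1 * `|u| by rewrite ler_pM2l // ler_piMl.
have k9 : e1 * K * `|u| <= e * `|u| by rewrite ler_wpM2r.
rewrite /K in k9; lra.
Qed.

Lemma segment_bound g (a b : C) (M : R) : 
  (forall t : R, 0 <= t <= 1 -> exists2 l, cder g (a + rc t * (b - a)) l & nm l <= M) ->
  nm (g b - g a) <= M * nm (b - a).
Proof.
move=> hg.
pose gam t := a + rc t * (b - a).
have hgam t : rder gam t (b - a).
  have := rderD (rder_cst a t) (rderZ (b - a) (rder_id t)).
  by rewrite mulr1 add0r; apply: rder_ext => u; rewrite /gam [rc u * _]mulrC.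
pose L t := cderiv g (gam t).
have hL t : 0 <= t <= 1 -> cder g (gam t) (L t) /\ nm (L t) <= M.
  by move=> /hg [l hl lM]; rewrite /L (cderivE hl).
have := @mvi R (fun t => g (gam t)) (fun t => L t * (b - a)) 0 1 (M * nm (b - a)) ler01.
rewrite subr0 mulr1 /gam rc0 rc1 mul0r mul1r addr0 [a + _]addrC subrK; apply.
- by move=> t /hL[k _]; exact: (cder_rder k (hgam t)).
- by move=> t /hL[_ k]; rewrite nmM ler_wpM2r // nm_ge0.
Qed.

Lemma segment_in (a b z : C) (r t : R) : 0 <= t <= 1 -> nm (a - z) < r -> nm (b - z) < r ->
  nm (a + rc t * (b - a) - z) < r.
Proof.
move=> /andP[t0 t1] ha hb.
have -> : a + rc t * (b - a) - z = rc (1 - t) * (a - z) + rc t * (b - z).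
  by rewrite rcB rc1; ring.
apply: le_lt_trans (nmD _ _) _; rewrite !nmM !nm_rc !ger0_norm ?subr_ge0 //.
have [->|t0'] := eqVneq t 0; first by lra.
have tp : 0 < t by rewrite lt0r t0'.
have : t * nm (b - z) < t * r by rewrite ltr_pM2l.
have : (1 - t) * nm (a - z) <= (1 - t) * r by rewrite ler_wpM2l ?subr_ge0 // ltW.
lra.
Qed.

End Holomorphic.

(** * The exponential and mean values over circles *)

Section Cauchy.
Variable R : realType.
Local Notation C := (Cplx R).

Definition cexp (s t : R) : C := rc (expR s) * (rc (cos t) + ii R * rc (sin t)).

Lemma cexpD s t u v : cexp (s + u) (t + v) = cexp s t * cexp u v.
Proof.
rewrite /cexp expRD cosD sinD rcM rcB rcD !rcM.
have := iiM R; set i := ii R => ii1.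
rewrite -[- (_ * _)]mulN1r -ii1.
by ring.
Qed.

Lemma nm_cexp s t : nm (cexp s t) = expR s.
Proof.
rewrite nmM nm_rc gtr0_norm ?expR_gt0 //.
suff -> : nm (rc (cos t) + ii R * rc (sin t)) = 1 by rewrite mulr1.
have -> : rc (cos t) + ii R * rc (sin t) = Complex (cos t) (sin t).
  by rewrite [RHS]ReImE.
by rewrite /nm /= cos2Dsin2 sqrtr1.
Qed.

(** By the addition theorem [cexpD], the expansion at 0 yields the derivative everywhere. *)
Lemma cexp_hder0 (e : R) : 0 < e -> exists2 d : R, 0 < d & forall u v, `|u| < d -> `|v| < d ->
  nm (cexp u v - 1 - (rc u + ii R * rc v)) <= e * (`|u| + `|v|).
Proof.
move=> e0; have e8 : 0 < e / 8 by lra.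
have [e1 [e10 e11 e18]] := pos_min ltr01 e8.
have [d1 d10 k1] := is_derive_eps (is_derive_expR (0 : R)) e10.
have [d2 d20 k2] := is_derive_eps (is_derive_cos (0 : R)) e10.
have [d3 d30 k3] := is_derive_eps (is_derive_sin (0 : R)) e10.
exists (Num.min (Num.min d1 e1) (Num.min d2 d3)); first by rewrite !lt_min d10 e10 d20 d30.
move=> u v; rewrite !lt_min => /andP[/andP[/k1 u1 ue] _] /andP[_ /andP[/k2 v2 /k3 v3]].
move: u1 v2 v3; rewrite !add0r expR0 cos0 sin0 oppr0 mulr1 mulr0 !subr0 mulr1 ?oppr0 ?addr0 => u1 v2 v3.
rewrite /cexp.
have := iiM R; set i := ii R => ii1.
have -> : rc (expR u) * (rc (cos v) + i * rc (sin v)) - 1 - (rc u + i * rc v) =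
  rc (expR u - 1 - u) * (rc (cos v) + i * rc (sin v)) +
  (1 + rc u) * (rc (cos v - 1) + i * rc (sin v - v)) + i * rc (u * v).
  by rewrite !rcB rcM rc1; ring.
have n1 : nm (rc (cos v) + i * rc (sin v)) = 1.
  by have := nm_cexp 0 v; rewrite /cexp expR0 rc1 mul1r.
apply: le_trans (nmD _ _) _; apply: le_trans (lerD (nmD _ _) (lexx _)) _.
rewrite !nmM n1 nm_ii !nm_rc mulr1 mul1r normrM.
have n2 : nm (1 + rc u) <= 2.
  by apply: le_trans (nmD _ _) _; rewrite nm1 nm_rc; lra.
have n3 : nm (rc (cos v - 1) + i * rc (sin v - v)) <= e1 * `|v| + e1 * `|v|.
  apply: le_trans (nmD _ _) _; rewrite nmM nm_ii mul1r !nm_rc.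
  exact: lerD.
have u0 := normr_ge0 u; have v0 := normr_ge0 v.
have p1 : nm (1 + rc u) * nm (rc (cos v - 1) + i * rc (sin v - v)) <= 2 * (e1 * `|v| + e1 * `|v|).
  by apply: ler_pM => //; exact: nm_ge0.
have p2 : `|u| * `|v| <= e1 * `|v| by rewrite ler_wpM2r // ltW.
have p3 : e1 * `|u| <= e / 8 * `|u| by rewrite ler_wpM2r.
have p4 : e1 * `|v| <= e / 8 * `|v| by rewrite ler_wpM2r.
have p5 : 0 <= e1 * `|v| by rewrite mulr_ge0 // ltW.
have p6 : 0 <= e * `|v| by rewrite mulr_ge0 // ltW.
have p7 : 0 <= e * `|u| by rewrite mulr_ge0 // ltW.
lra.
Qed.

Lemma hder_cexp g (z0 l : C) (s t : R) : cder g (z0 + cexp s t) l ->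
  hder (fun s t => g (z0 + cexp s t)) s t (l * cexp s t).
Proof.
move=> /cderP hg e e0.
pose K := expR s; have K0 : 0 < K by rewrite expR_gt0.
have n1 := nm_ge0 l.
pose M := K * (3 + nm l); have M0 : 0 < M by rewrite mulr_gt0 //; lra.
have [e1 [e10 e11 e1M]] := pos_min ltr01 (divr_gt0 e0 M0).
rewrite ler_pdivlMr // in e1M.
have [d1 d10 k1] := hg _ e10; have [d2 d20 k2] := cexp_hder0 e10.
have d3 : 0 < d1 / (6 * K) by rewrite divr_gt0 // mulr_gt0.
have [d [d0 dd2 dd1]] := pos_min d20 d3.
exists d => // u v ud vd.
have := k2 u v (lt_le_trans ud dd2) (lt_le_trans vd dd2).
rewrite cexpD; set c := cexp u v; set w := rc u + ii R * rc v => k3.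
have u0 := normr_ge0 u; have v0 := normr_ge0 v.
have nw : nm w <= `|u| + `|v|.
  by apply: le_trans (nmD _ _) _; rewrite nmM nm_ii mul1r !nm_rc.
have nc1 : nm (c - 1) <= 2 * (`|u| + `|v|).
  have -> : c - 1 = (c - 1 - w) + w by ring.
  apply: le_trans (nmD _ _) _.
  have : e1 * (`|u| + `|v|) <= 1 * (`|u| + `|v|) by rewrite ler_wpM2r // addr_ge0.
  lra.
pose k := cexp s t * (c - 1).
have nk : nm k <= K * (2 * (`|u| + `|v|)) by rewrite nmM nm_cexp ler_pM2l.
have kd : nm k < d1.
  apply: le_lt_trans nk _.
  have : `|u| + `|v| < 2 * d by lra.
  have : d * (6 * K) <= d1 by rewrite -ler_pdivlMr // mulr_gt0.
  nra.
have := k1 _ kd.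
have -> : z0 + cexp s t + k = z0 + cexp s t * c by rewrite /k; ring.
move=> k4.
have -> : g (z0 + cexp s t * c) - g (z0 + cexp s t) - w * (l * cexp s t) =
  (g (z0 + cexp s t * c) - g (z0 + cexp s t) - k * l) + cexp s t * (l * (c - 1 - w)).
  by rewrite /k; ring.
apply: le_trans (nmD _ _) _; rewrite [nm (cexp s t * _)]nmM nm_cexp [nm (l * _)]nmM -/K.
have q1 : nm l * nm (c - 1 - w) <= nm l * (e1 * (`|u| + `|v|)) by rewrite ler_wpM2l.
have q2 : K * (nm l * nm (c - 1 - w)) <= K * (nm l * (e1 * (`|u| + `|v|))) by rewrite ler_pM2l.
have q3 : e1 * nm k <= e1 * (K * (2 * (`|u| + `|v|))) by rewrite ler_pM2l.
have q4 : e1 * M * (`|u| + `|v|) <= e * (`|u| + `|v|) by rewrite ler_wpM2r // addr_ge0.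
have q5 : 0 <= e1 * (K * (`|u| + `|v|)).
  by apply: mulr_ge0; [exact: ltW | apply: mulr_ge0; [exact: ltW | exact: addr_ge0]].
rewrite /M in q4; lra.
Qed.

Definition circ (t : R) : C := cexp 0 t.

Lemma nm_circ t : nm (circ t) = 1. Proof. by rewrite nm_cexp expR0. Qed.

Lemma cexp_circ s t : cexp s t = rc (expR s) * circ t.
Proof. by rewrite /circ /cexp expR0 rc1 mul1r. Qed.

Lemma cexp_2pi s : cexp s (0 + pi *+ 2) = cexp s 0.
Proof. by rewrite /cexp add0r cos2pi sin2pi cos0 sin0. Qed.

Definition cavg (k : R -> C) : C := (rc (pi *+ 2))^-1 * cint 0 (pi *+ 2) k.

Lemma pi2_gt0 : 0 < (pi *+ 2 : R). Proof. by rewrite pmulrn_rgt0 // pi_gt0. Qed.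

Lemma rcpi2_neq0 : rc (pi *+ 2 : R) != 0.
Proof. by rewrite rc_eq0 lt0r_neq0 // pi2_gt0. Qed.

Lemma nm_cavg k M : conton 0 (pi *+ 2) k -> (forall t, nm (k t) <= M) -> nm (cavg k) <= M.
Proof.
move=> ck kM; rewrite nmM nmV nm_rc gtr0_norm ?pi2_gt0 // mulrC ler_pdivrMr ?pi2_gt0 //.
have := cint_bound (ltW pi2_gt0) ck (M := M); rewrite subr0; apply => t _; exact: kM.
Qed.

Lemma cavg_cst c : cavg (fun=> c) = c.
Proof.
by rewrite /cavg cint_cst ?(ltW pi2_gt0) // subr0 mulrA mulVf ?rcpi2_neq0 // mul1r.
Qed.

Lemma cavgB k1 k2 : conton 0 (pi *+ 2) k1 -> conton 0 (pi *+ 2) k2 ->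
  cavg k1 - cavg k2 = cavg (fun t => k1 t - k2 t).
Proof.
move=> c1 c2; rewrite /cavg -mulrBr; congr (_ * _).
have E : k1 = (fun t => (k1 t - k2 t) + k2 t) by apply/funext => t; rewrite subrK.
rewrite {1}E cintD ?(ltW pi2_gt0) //; last exact: contonB.
by rewrite addrK.
Qed.

Lemma cavgZ c k : conton 0 (pi *+ 2) k -> cavg (fun t => c * k t) = c * cavg k.
Proof. by move=> ck; rewrite /cavg cintZ ?(ltW pi2_gt0) // mulrCA. Qed.

(* In the coordinate s + i t with z = z0 + exp (s + i t), Goursat's theorem on a rectangle of
   height 2 pi says that the mean of g over the circle of radius exp s does not depend on s.
   Differentiability at the centre is not needed. *)
Lemma mean_value g (z0 : C) (r r0 : R) : 0 < r -> r < r0 -> ccont g z0 ->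
  (forall z, 0 < nm (z - z0) -> nm (z - z0) < r0 -> chol g z) ->
  conton 0 (pi *+ 2) (fun t => g (z0 + rc r * circ t)) /\
  cavg (fun t => g (z0 + rc r * circ t)) = g z0.
Proof.
move=> r_gt0 rr0 cg hg.
pose h s t := g (z0 + cexp s t).
have lnr : expR (ln r) = r by rewrite lnK.
have hh s t : s <= ln r -> exists l, hder h s t l.
  move=> sr; have [||l hl] := hg (z0 + cexp s t).
  - by rewrite addrC addKr nm_cexp expR_gt0.
  - by rewrite addrC addKr nm_cexp; apply: le_lt_trans rr0; rewrite -lnr ler_expR.
  by exists (l * cexp s t); exact: hder_cexp.
have ch s a b : s <= ln r -> conton a b (h s).
  by move=> sr t _; have [l /hder_rder2/rder_cont] := hh s t sr.
have E : (fun t => g (z0 + rc r * circ t)) = h (ln r).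
  by apply/funext => t; rewrite /h cexp_circ lnr.
rewrite E; split; first exact: ch.
have same s : s <= ln r -> cavg (h (ln r)) = cavg (h s).
  move=> sr; rewrite /cavg; congr (_ * _).
  have := @goursat R h s 0 (ln r - s) (pi *+ 2) _ (ltW pi2_gt0).
  rewrite subr_ge0 sr => /(_ isT) G.
  have {}G : rect_int h s 0 (ln r - s) (pi *+ 2) = 0.
    apply: G => x y /andP[_ xs] _; apply: hh; move: xs; by rewrite addrC subrK.
  move: G; rewrite /rect_int.
  (* By periodicity the bottom and top sides carry the same values, so the two vertical sides have
     equal integrals. *)
  have -> : (fun s0 : R => h s0 (0 + pi *+ 2)) = (fun s0 => h s0 0).
    by apply/funext => x; rewrite /h cexp_2pi.
  rewrite subrr add0r [s + _]addrC subrK add0r => /eqP.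
  have ii0 : ii R != 0 by rewrite -nm_gt0 nm_ii.
  rewrite mulf_eq0 (negbTE ii0) /=.
  by rewrite subr_eq0 => /eqP.
(* The radius now tends to 0: continuity at the centre makes the common mean arbitrarily close to
   [g z0]. *)
apply/eqP; rewrite -subr_eq0; apply/eqP/nm_eq0/eqP.
rewrite eq_le nm_ge0 andbT; apply/ler_addgt0Pr => e e0; rewrite add0r.
have [d d0 hd] := cg _ e0.
have [d' [d'0 d'r d'd]] := pos_min r_gt0 d0.
have d'2 : 0 < d' / 2 by lra.
have sr : ln (d' / 2) <= ln r by rewrite ler_ln ?posrE //; lra.
rewrite (same _ sr) -[X in _ - X](cavg_cst (g z0)) cavgB; first last.
- by move=> t _ e' e'0; exists 1 => // u _; rewrite subrr nm0 ltW.
- exact: ch.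
apply: nm_cavg.
  apply: contonB; first exact: ch.
  by move=> t _ e' e'0; exists 1 => // u _; rewrite subrr nm0 ltW.
by move=> t; apply: hd; rewrite nm_cexp lnK ?posrE //; lra.
Qed.

End Cauchy.

(** * Cauchy's estimate, derivatives of holomorphic functions, removable singularities *)

Section CauchyConsequences.
Variable R : realType.
Local Notation C := (Cplx R).

Lemma neq_of_near (z0 z w : C) : nm (w - z) < nm (z - z0) -> w != z0.
Proof. by move=> h; apply/eqP => E; move: h; rewrite E nmB ltxx. Qed.

(** The difference quotient at z0, completed by [l], is continuous at z0 and differentiable
    elsewhere, so its mean over the circle is its value at the centre. *)
Lemma cauchy_repr (g : C -> C) (z0 l : C) (r r0 : R) : 0 < r -> r < r0 -> cder g z0 l ->
  (forall z, nm (z - z0) < r0 -> chol g z) ->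
  conton 0 (pi *+ 2) (fun t => (g (z0 + rc r * circ t) - g z0) * (rc r * circ t)^-1) /\
  cavg (fun t => (g (z0 + rc r * circ t) - g z0) * (rc r * circ t)^-1) = l.
Proof.
move=> r_gt0 rr0 gl hg.
pose q z := if z == z0 then l else (g z - g z0) * (z - z0)^-1.
have cq : ccont q z0.
  apply/ccontP => e e0; have /cderP/(_ _ e0)[d d0 hd] := gl.
  exists d => // w wd; rewrite /q eqxx; case: eqVneq => [_|wz]; first by rewrite subrr nm0 ltW.
  have := hd _ wd; rewrite [z0 + _]addrC subrK => k.
  have wz0 : w - z0 != 0 by rewrite subr_eq0.
  have -> : (g w - g z0) / (w - z0) - l = (g w - g z0 - (w - z0) * l) / (w - z0) by field.
  by rewrite nmM nmV ler_pdivrMr // nm_gt0.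
have hq z : 0 < nm (z - z0) -> nm (z - z0) < r0 -> chol q z.
  move=> z1 /hg [k hk]; have z2 : z - z0 != 0 by rewrite -nm_gt0.
  have h1 := cderB hk (cder_cst (g z0) z).
  have h2 := @cderV R (fun w => w - z0) z _ z2 (cderB (cder_id z) (cder_cst z0 z)).
  eexists; apply: cder_ext z1 _ (cderM h1 h2) => w /neq_of_near wz.
  by rewrite /q (negbTE wz).
have [c1 c2] := mean_value r_gt0 rr0 cq hq.
have E : (fun t => q (z0 + rc r * circ t)) =
   (fun t => (g (z0 + rc r * circ t) - g z0) * (rc r * circ t)^-1).
  apply/funext => t; rewrite /q addrAC subrr add0r ifF //.
  apply/negbTE; rewrite -subr_eq0 addrAC subrr add0r -nm_gt0.
  by rewrite nmM nm_circ nm_rc mulr1 gtr0_norm.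
by rewrite -E c2 /q eqxx.
Qed.

(** The factor 2 comes from subtracting [g z0] in the difference quotients of [cauchy_repr]. *)
Lemma cauchy_est (g : C -> C) (z0 l : C) (r r0 M : R) : 0 < r -> r < r0 -> cder g z0 l ->
  (forall z, nm (z - z0) < r0 -> chol g z /\ nm (g z) <= M) ->
  nm l <= 2 * M / r.
Proof.
move=> r_gt0 rr0 gl hg.
have [c1 <-] := cauchy_repr r_gt0 rr0 gl (fun z zr => (hg z zr).1).
apply: nm_cavg c1 _ => t.
rewrite nmM nmV [nm (rc r * _)]nmM nm_circ nm_rc mulr1 gtr0_norm // ler_pM2r ?invr_gt0 //.
apply: le_trans (nmD _ _) _; rewrite nmN.
have [_ k1] : chol g (z0 + rc r * circ t) /\ nm (g (z0 + rc r * circ t)) <= M.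
  by apply: hg; rewrite addrAC subrr add0r nmM nm_circ nm_rc mulr1 gtr0_norm.
have [_ k2] : chol g z0 /\ nm (g z0) <= M by apply: hg; rewrite subrr nm0; lra.
lra.
Qed.

Lemma rcont_comp (k : C -> C) (gam : R -> C) t : ccont k (gam t) -> rcont gam t ->
  rcont (fun u => k (gam u)) t.
Proof.
move=> /ccontP ck cgam e /ck [d d0 hd].
have d2 : 0 < d / 2 by lra.
have [d' d'0 hd'] := cgam _ d2; exists d' => // u /hd' k1.
by apply: hd; lra.
Qed.

Lemma rcontM (k g : R -> C) t : rcont k t -> rcont g t -> rcont (fun u => k u * g u) t.
Proof.
move=> h1 h2 e e0.
pose K := 1 + nm (k t) + nm (g t).
have n1 := nm_ge0 (k t); have n2 := nm_ge0 (g t).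
have K0 : 0 < K by rewrite /K; lra.
have [e1 [e10 e11]] := pos_min ltr01 (divr_gt0 e0 K0).
rewrite ler_pdivlMr // => e1K.
have [d1 d10 k1] := h1 _ e10; have [d2 d20 k2] := h2 _ e10.
exists (Num.min d1 d2); first by rewrite lt_min d10.
move=> h; rewrite lt_min => /andP[/k1 u1 /k2 u2].
have -> : k (t + h) * g (t + h) - k t * g t = (k (t + h) - k t) * (g (t + h) - g t) +
   (k (t + h) - k t) * g t + k t * (g (t + h) - g t) by ring.
apply: le_trans (nmD _ _) _; apply: le_trans (lerD (nmD _ _) (lexx _)) _.
rewrite !nmM; apply: le_trans e1K; rewrite /K.
have m1 := nm_ge0 (k (t + h) - k t); have m2 := nm_ge0 (g (t + h) - g t).
have : nm (k (t + h) - k t) * nm (g (t + h) - g t) <= e1 * 1.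
  by apply: ler_pM => //; apply: le_trans e11.
have : nm (k (t + h) - k t) * nm (g t) <= e1 * nm (g t) by rewrite ler_wpM2r.
have : nm (k t) * nm (g (t + h) - g t) <= nm (k t) * e1 by rewrite ler_wpM2l.
nra.
Qed.

Lemma rcont_circ t : rcont (@circ R) t.
Proof.
have := rder_cont (@hder_rder2 R _ 0 t _ (@hder_cexp R id 0 1 0 t (cder_id _))).
by apply: rcont_ext => u; rewrite add0r.
Qed.

Lemma rcont_quot (k : C -> C) (z c : C) (r t : R) : 0 < r -> ccont k (z + rc r * circ t) ->
  rcont (fun t => (k (z + rc r * circ t) - c) * (rc r * circ t)^-1) t.
Proof.
move=> r0 ck.
have rcc : rc r * circ t != 0.
  by rewrite -nm_gt0 nmM nm_circ nm_rc mulr1 gtr0_norm.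
have h1 : rcont (fun t => z + rc r * circ t) t.
  apply: (@rcont_comp (fun w => z + rc r * w)); last exact: rcont_circ.
  exact: cder_cont (cderD (cder_cst z _) (cderZ (rc r) (cder_id _))).
have h2 := @rcont_comp (fun w => w - c) _ _ (cder_cont (cderB (cder_id _) (cder_cst c _)))
  (rcont_comp ck h1).
apply: (rcontM h2).
apply: (@rcont_comp (fun w => (rc r * w)^-1)); last exact: rcont_circ.
exact: cder_cont (@cderV R (fun w => rc r * w) _ _ rcc (cderZ (rc r) (cder_id _))).
Qed.

Lemma in_disc (z0 z w : C) (r1 r2 r : R) : nm (z - z0) < r1 -> nm (w - z) < r2 ->
  r1 + r2 <= r -> nm (w - z0) < r.
Proof.
move=> h1 h2 h3; have -> : w - z0 = (w - z) + (z - z0) by ring.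
by apply: le_lt_trans (nmD _ _) _; lra.
Qed.

(** [cauchy_repr] writes the derivative D as a mean of difference quotients of g over a circle that
    moves with the point. This makes D Lipschitz, so that g has a second-order error bound uniform
    in the point; under the mean it becomes a first-order expansion of D. *)
Lemma hol_deriv (g : C -> C) (z0 : C) (r0 : R) : 0 < r0 ->
  (forall z, nm (z - z0) < r0 -> chol g z) -> chol (cderiv g) z0.
Proof.
move=> r00 hg0.
have z00 : nm (z0 - z0) < r0 by rewrite subrr nm0.
have [l0 hl0] := hg0 _ z00.
have /ccontP/(_ _ ltr01)[d d0 hd] := cder_cont hl0.
have [s [s0 sr sd]] := pos_min r00 d0.
pose M := nm (g z0) + 1.
have M0 : 0 < M by rewrite /M; have := nm_ge0 (g z0); lra.
have hg z : nm (z - z0) < s -> chol g z /\ nm (g z) <= M.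
  move=> zs; split; first by apply: hg0; lra.
  have := hd z ltac:(lra) => k.
  have -> : g z = (g z - g z0) + g z0 by ring.
  by apply: le_trans (nmD _ _) _; rewrite /M; lra.
(* This leaves room for nested discs of radii 2r (expansion of g), 4r (Lipschitz bound on D) and 6r
   (bound on D). *)
pose r := s / 8; have r_gt0 : 0 < r by rewrite /r; lra.
have sE : s = 8 * r by rewrite /r; field.
pose D := cderiv g.
have hD z : nm (z - z0) < s -> cder g z (D z) by move=> /hg[k _]; exact: cderivP.
pose M1 := 2 * M / r.
have M10 : 0 <= M1 by apply: divr_ge0; [apply: mulr_ge0 => //|]; exact: ltW.
have bD z : nm (z - z0) < 6 * r -> nm (D z) <= M1.
  move=> zr; apply: (@cauchy_est g z (D z) r (2 * r)); try lra.
    by apply: hD; lra.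
  by move=> w wz; apply: hg; apply: in_disc zr wz _; lra.
have lip z w : nm (z - z0) < 6 * r -> nm (w - z0) < 6 * r -> nm (g z - g w) <= M1 * nm (z - w).
  move=> zr wr; apply: segment_bound => t t01; exists (D (w + rc t * (z - w))).
    by apply: hD; have := segment_in t01 wr zr; lra.
  by apply: bD; exact: segment_in.
have repr z : nm (z - z0) < 4 * r ->
  conton 0 (pi *+ 2) (fun t => (g (z + rc r * circ t) - g z) * (rc r * circ t)^-1) /\
  cavg (fun t => (g (z + rc r * circ t) - g z) * (rc r * circ t)^-1) = D z.
  move=> zr; apply: (@cauchy_repr g z (D z) r (2 * r)); try lra.
    by apply: hD; lra.
  by move=> w wz; apply: hg0; apply: in_disc zr wz _; lra.
have ncr (t : R) : nm (rc r * circ t) = r.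
  by rewrite nmM nm_circ nm_rc mulr1 gtr0_norm.
have near_circ (z : C) (t : R) : nm (z - z0) < 4 * r -> nm (z + rc r * circ t - z0) < 6 * r.
  move=> zr; apply: (@in_disc z0 z _ (4 * r) (2 * r)) => //; last by lra.
  by rewrite addrAC subrr add0r ncr; lra.
pose M2 := 2 * M1 / r.
have M20 : 0 <= M2 by apply: divr_ge0; [apply: mulr_ge0 => // | exact: ltW].
have lipD z w : nm (z - z0) < 4 * r -> nm (w - z0) < 4 * r -> nm (D z - D w) <= M2 * nm (z - w).
  move=> zr wr; have [cz <-] := repr _ zr; have [cw <-] := repr _ wr.
  rewrite cavgB //; apply: nm_cavg; first exact: contonB.
  move=> t; rewrite -mulrBl nmM nmV ncr /M2 mulrAC ler_pM2r ?invr_gt0 //.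
  rewrite opprB addrACA.
  have -> : g (z + rc r * circ t) + g w + (- g z - g (w + rc r * circ t)) =
     (g (z + rc r * circ t) - g (w + rc r * circ t)) - (g z - g w) by ring.
  apply: le_trans (nmD _ _) _; rewrite nmN.
  have k1 := lip _ _ (near_circ z t zr) (near_circ w t wr).
  have k2 : nm (g z - g w) <= M1 * nm (z - w) by apply: lip; lra.
  have E : z + rc r * circ t - (w + rc r * circ t) = z - w by ring.
  rewrite E in k1; lra.
have taylor z h : nm (z - z0) < 2 * r -> nm h < r ->
    nm (g (z + h) - g z - h * D z) <= M2 * (nm h * nm h).
  move=> zr hr.
  pose G w := g w - (w - z) * D z.
  have zh : nm (z + h - z0) < 4 * r.
    by apply: (@in_disc z0 z _ (2 * r) r) => //; [rewrite addrAC subrr add0r | lra].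
  have := @segment_bound R G z (z + h) (M2 * nm h).
  rewrite /G subrr mul0r subr0 addrAC subrr add0r.
  rewrite -mulrA.
  have -> : g (z + h) - h * D z - g z = g (z + h) - g z - h * D z by ring.
  apply=> t t01; exists (D (z + rc t * h) - D z).
    have zt : nm (z + rc t * h - z0) < 4 * r.
      have := @segment_in R z (z + h) z0 (4 * r) t t01 ltac:(lra) zh.
      by rewrite [z + h - z]addrAC subrr add0r.
    have := cderB (hD (z + rc t * h) ltac:(lra))
      (cderM (cderB (cder_id (z + rc t * h)) (cder_cst z _)) (cder_cst (D z) _)).
    by rewrite mulr0 addr0 subr0 mul1r.
  have zt : nm (z + rc t * h - z0) < 4 * r.
    have := @segment_in R z (z + h) z0 (4 * r) t t01 ltac:(lra) zh.
    by rewrite [z + h - z]addrAC subrr add0r.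
  apply: le_trans (lipD _ _ zt _) _; first by lra.
  rewrite ler_wpM2l // addrAC subrr add0r nmM nm_rc.
  case/andP: t01 => t0 t1; rewrite ger0_norm //.
  by have := nm_ge0 h; nra.
have cD z : nm (z - z0) < 4 * r -> ccont D z.
  move=> zr; apply/ccontP => e e0.
  have M2p : 0 < M2 + 1 by lra.
  have r4 : 0 < 4 * r - nm (z - z0) by lra.
  have [d' [d'0 d'r d'e]] := pos_min r4 (divr_gt0 e0 M2p).
  exists d' => // w wd.
  have wr : nm (w - z0) < 4 * r.
    have -> : w - z0 = (w - z) + (z - z0) by ring.
    by apply: le_lt_trans (nmD _ _) _; lra.
  apply: le_trans (lipD _ _ wr zr) _.
  rewrite ler_pdivlMr // in d'e.
  have := nm_ge0 (w - z); nra.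
(* The derivative of D will be the mean of its own difference quotients, the same formula one order
   higher. *)
pose F2 t := (D (z0 + rc r * circ t) - D z0) * (rc r * circ t)^-1.
have z04 : nm (z0 - z0) < 4 * r by rewrite subrr nm0; lra.
have circ4 (t : R) : nm (z0 + rc r * circ t - z0) < 2 * r.
  by rewrite addrAC subrr add0r ncr; lra.
have cF2 : conton 0 (pi *+ 2) F2.
  by move=> t _; apply: rcont_quot => //; apply: cD; have := circ4 t; lra.
exists (cavg F2); apply/cderP => e e0.
have M2p : 0 < 2 * M2 + 1 by lra.
have er : 0 < e * r / (2 * M2 + 1) by rewrite divr_gt0 // mulr_gt0.
have [d' [d'0 d'r d'e]] := pos_min r_gt0 er.
rewrite ler_pdivlMr // in d'e.
exists d' => // h hd'.
have hr : nm h < r by lra.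
have zh : nm (z0 + h - z0) < 4 * r by rewrite addrAC subrr add0r; lra.
rewrite -/(D _) -/(D _).
have [c1 <-] := repr _ zh; have [c2 <-] := repr _ z04.
have cZ : conton 0 (pi *+ 2) (fun t => h * F2 t).
  move=> t tt; apply: rcontM; last exact: cF2.
  by move=> e' e'0; exists 1 => // u _; rewrite subrr nm0 ltW.
rewrite cavgB // -cavgZ // cavgB //; last exact: contonB.
have hp : 0 <= nm h := nm_ge0 h.
suff : 2 * M2 * (nm h * nm h) / r <= e * nm h.
  apply: le_trans; apply: nm_cavg; first by apply: contonB => //; exact: contonB.
  move=> t; rewrite /F2.
  have -> : (g (z0 + h + rc r * circ t) - g (z0 + h)) / (rc r * circ t) -
     (g (z0 + rc r * circ t) - g z0) / (rc r * circ t) -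
     h * ((D (z0 + rc r * circ t) - D z0) / (rc r * circ t)) =
    ((g (z0 + rc r * circ t + h) - g (z0 + rc r * circ t) - h * D (z0 + rc r * circ t)) -
     (g (z0 + h) - g z0 - h * D z0)) / (rc r * circ t).
    rewrite [z0 + h + _]addrAC; ring.
  rewrite nmM nmV ncr ler_pM2r ?invr_gt0 //.
  apply: le_trans (nmD _ _) _; rewrite nmN.
  have := taylor _ _ (circ4 t) hr.
  have : nm (g (z0 + h) - g z0 - h * D z0) <= M2 * (nm h * nm h).
    by apply: taylor => //; rewrite subrr nm0; lra.
  lra.
have k1 : 2 * M2 * nm h <= 2 * M2 * d' by apply: ler_wpM2l; [exact: mulr_ge0 | exact: ltW].
have k2 : 2 * M2 * nm h <= e * r by lra.
have := ler_wpM2r hp k2; rewrite ler_pdivrMr //; lra.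
Qed.

(* U w = (w - z0) u w is differentiable at z0 too, and its second order expansion there is
   the first order expansion of u. *)
Lemma removable (u : C -> C) (z0 : C) (r0 : R) : 0 < r0 -> ccont u z0 ->
  (forall z, 0 < nm (z - z0) -> nm (z - z0) < r0 -> chol u z) -> chol u z0.
Proof.
move=> r00 cu hu.
pose U w := (w - z0) * u w.
have U0 : cder U z0 (u z0).
  exists (fun h => u (z0 + h)) => // h.
  by rewrite /U subrr mul0r add0r addrAC subrr add0r.
have hU z : nm (z - z0) < r0 -> chol U z.
  have [->|zz] := eqVneq z z0; first by exists (u z0).
  move=> zr; have [|l hl] := hu z _ zr; first by rewrite nm_gt0 subr_eq0.
  by eexists; exact: cderM (cderB (cder_id z) (cder_cst z0 z)) hl.
have [c2 hc2] := hol_deriv r00 hU.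
exists (c2 / 2); apply/cderP => e e0.
have /cderP/(_ _ e0)[d d0 hd] := hc2.
have [s [s0 sr sd]] := pos_min r00 d0.
exists s => // h hs.
have [->|h0] := eqVneq h 0; first by rewrite addr0 mul0r !subrr nm0 mulr0.
have nh : 0 < nm h by rewrite nm_gt0.
(* V is U minus its Taylor polynomial of order 2 at z0, and V' is the error in the first-order
   expansion of [cderiv U]. Dividing V by h leaves the first-order error of u. *)
pose V w := U w - (w - z0) * u z0 - (w - z0) * (w - z0) * (c2 / 2).
have := @segment_bound R V z0 (z0 + h) (e * nm h).
rewrite [z0 + h - z0]addrAC subrr add0r => seg.
rewrite -(ler_pM2l nh) -nmM.
have -> : h * (u (z0 + h) - u z0 - h * (c2 / 2)) = V (z0 + h) - V z0.
  by rewrite /V /U; ring.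
rewrite [nm h * _]mulrC; apply: seg => t /andP[t0 t1].
have E : z0 + rc t * h - z0 = rc t * h by ring.
have nt : nm (rc t * h) <= nm h by rewrite nmM nm_rc ger0_norm // ler_piMl // ltW.
set w := z0 + rc t * h.
exists (cderiv U w - u z0 - (w - z0) * c2).
  have hw : cder U w (cderiv U w) by apply/cderivP/hU; rewrite E; lra.
  have hi := cderB (cder_id w) (cder_cst z0 w).
  have := cderB (cderB hw (cderM hi (cder_cst (u z0) w))) (cderM (cderM hi hi) (cder_cst (c2 / 2) w)).
  set X := (X in cder _ _ X -> _); suff -> : X = cderiv U w - u z0 - (w - z0) * c2 by [].
  by rewrite /X; field.
rewrite /w E; have := hd (rc t * h) ltac:(lra).
rewrite (cderivE U0) => k; apply: le_trans k _.
by rewrite ler_pM2l.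
Qed.

End CauchyConsequences.

(** * The discriminant of the curve a(x) d(y) = b(x) c(y) *)

Section Charts.
Variable F : comNzRingType.
Implicit Types (p q : {poly F}) (s : bool).

Definition rev_poly k p : {poly F} := \poly_(i < k.+1) p`_(k - i).

(* p, viewed as a form of degree k, in the coordinate x of P^1 or in 1 / x. *)
Definition chart_poly k s p : {poly F} := if s then rev_poly k p else p.

Lemma coef_rev k p i : (rev_poly k p)`_i = if (i <= k)%N then p`_(k - i) else 0.
Proof. by rewrite coef_poly ltnS. Qed.

Lemma size_rev k p : (size (rev_poly k p) <= k.+1)%N.
Proof. exact: size_poly. Qed.

Lemma size_chart k s p : (size p <= k.+1)%N -> (size (chart_poly k s p) <= k.+1)%N.
Proof. by case: s => //= _; exact: size_rev. Qed.

Lemma revK k p : (size p <= k.+1)%N -> rev_poly k (rev_poly k p) = p.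
Proof.
move=> sp; apply/polyP => i; rewrite !coef_rev.
case: leqP => ik; last by rewrite nth_default // (leq_trans sp).
by rewrite leq_subr subKn.
Qed.

Lemma chart_chart k s p : (size p <= k.+1)%N ->
  chart_poly k (~~ s) p = rev_poly k (chart_poly k s p).
Proof. by case: s => //= sp; rewrite revK. Qed.

Lemma rev_polyZ k (c : F) p : rev_poly k (c *: p) = c *: rev_poly k p.
Proof. by apply/polyP => i; rewrite coefZ !coef_rev coefZ; case: leqP; rewrite ?mulr0. Qed.

Lemma chart_polyZ k s (c : F) p : chart_poly k s (c *: p) = c *: chart_poly k s p.
Proof. by case: s => //=; exact: rev_polyZ. Qed.

Lemma rev_Xn_mul k a p : (size p <= k.+1)%N ->
  rev_poly (a + k) ('X^a * p) = rev_poly k p.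
Proof.
move=> sp; apply/polyP => i; rewrite !coef_rev coefXnM.
case: (leqP i k) => ik.
  rewrite (leq_trans ik (leq_addl _ _)) -addnBA // ltnNge leq_addr /=.
  by rewrite addnC addnK.
by case: (leqP i (a + k)) => iak //; rewrite ifT //; lia.
Qed.

Lemma rev_addl k b p : (size p <= k.+1)%N ->
  rev_poly (b + k) p = 'X^b * rev_poly k p.
Proof.
move=> sp; apply/polyP => i; rewrite coefXnM !coef_rev.
case: (ltnP i b) => ib.
  rewrite ifT; last by lia.
  by rewrite nth_default //; move: sp; move: (size p) => N; lia.
have -> : (i - b <= k)%N = (i <= b + k)%N by rewrite leq_subLR.
by case: leqP => // ?; congr (p`_ _); lia.
Qed.

(* For a form of degree k in (x : y) with dehomogenization p, the two partial derivatives
   are p^`() and polar k p. *)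
Definition polar k p : {poly F} := p *+ k - 'X * p^`().

Lemma coef_polar k p i : (polar k p)`_i = p`_i *+ k - p`_i *+ i.
Proof.
rewrite /polar coefB coefMn coefXM coef_deriv.
by case: i => [|i] /=; rewrite ?mulr0n.
Qed.

Lemma size_polar k p : (size p <= k.+2)%N -> (size (polar k.+1 p) <= k.+1)%N.
Proof.
move=> sp; apply/leq_sizeP => j; rewrite leq_eqVlt => /orP[/eqP <-|kj].
  by rewrite coef_polar subrr.
by rewrite coef_polar nth_default ?mul0rn ?subrr // (leq_trans sp).
Qed.

(** Reversal exchanges the two variables of the form, hence its two partial derivatives. *)
Lemma deriv_rev k p : (rev_poly k.+1 p)^`() = rev_poly k (polar k.+1 p).
Proof.
apply/polyP => i; rewrite coef_deriv !coef_rev coef_polar ltnS.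
case: leqP => ik; last by rewrite mul0rn.
have -> : (k.+1 - i.+1 = k - i)%N by lia.
by rewrite -mulrnBr; [congr (_ *+ _); lia | lia].
Qed.

Lemma polar_rev k p : (size p <= k.+2)%N -> polar k.+1 (rev_poly k.+1 p) = rev_poly k p^`().
Proof.
move=> sp; apply/polyP => i; rewrite coef_polar !coef_rev coef_deriv.
case: (leqP i k) => ik.
  rewrite (leq_trans ik) // subSn // -mulrnBr; last by lia.
  by congr (_ *+ _); lia.
case: leqP => ik1; last by rewrite !mul0rn subrr.
have -> : i = k.+1 by lia.
by rewrite subrr.
Qed.

End Charts.

Section Sylvester.
Variable F : comNzRingType.
Implicit Types (p q : {poly F}) (s : bool).

(** The Sylvester matrix of two forms of degree k, whatever the degrees of p and q, so that a common
    zero at infinity also makes it singular. The shifted polynomials are columns, which turns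
    evaluation at a point into multiplication by a row on the left. *)
Definition syl k p q : 'M[F]_(k + k) :=
  row_mx (\matrix_(i < k + k, j < k) ('X^j * p)`_i)
         (\matrix_(i < k + k, j < k) ('X^j * q)`_i).

(** The monomials of degree 2k - 1 at the point with coordinate x; the exponents are reversed in the
    chart at infinity. *)
Definition mono_vec k s (x : F) : 'rV[F]_(k + k) :=
  \row_i x ^+ (if s then ((k + k).-1 - i)%N else i).

Lemma mono_vec_shift k s (x : F) p (j : 'I_k) : (size p <= k.+1)%N ->
  \sum_(i < k + k) mono_vec k s x 0 i * ('X^j * p)`_i =
  x ^+ (if s then (k.-1 - j)%N else j) * (chart_poly k s p).[x].
Proof.
move=> sp; have jk := ltn_ord j.
have szj : (size ('X^j * p)%R <= k + k)%N.
  by apply: leq_trans (size_polyMleq _ _) _; rewrite size_polyXn; lia.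
case: s => /=.
  rewrite -(hornerXn x) -hornerM.
  have -> : 'X^(k.-1 - j)%N * rev_poly k p = rev_poly (k + k).-1 ('X^j * p).
    rewrite -(rev_Xn_mul j sp) -rev_addl; first by congr rev_poly; lia.
    by apply: leq_trans (size_polyMleq _ _) _; rewrite size_polyXn; lia.
  have kk : ((k + k).-1.+1 = k + k)%N by lia.
  rewrite (@horner_coef_wide _ (k + k)); last by rewrite -[X in (_ <= X)%N]kk size_rev.
  rewrite (reindex_inj rev_ord_inj) /=; apply: eq_bigr => i _.
  rewrite mxE /= coef_rev mulrC; have ik := ltn_ord i.
  by rewrite ifT; [congr (_`_ _ * x ^+ _); lia | lia].
rewrite -(hornerXn x) -hornerM (horner_coef_wide _ szj).
by apply: eq_bigr => i _; rewrite mxE mulrC.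
Qed.

Lemma mono_vec_syl k s (x : F) p q : (size p <= k.+1)%N -> (size q <= k.+1)%N ->
  mono_vec k s x *m syl k p q =
  \row_j match fintype.split j with
   | inl a => x ^+ (if s then (k.-1 - a)%N else a) * (chart_poly k s p).[x]
   | inr a => x ^+ (if s then (k.-1 - a)%N else a) * (chart_poly k s q).[x]
  end.
Proof.
move=> sp sq; apply/rowP => j; rewrite !mxE.
case: splitP => a ja; rewrite -mono_vec_shift //; apply: eq_bigr => i _; congr (_ * _).
  by rewrite mxE; case: splitP => b jb; [rewrite mxE; congr (('X^_ * _)`_i); lia | have := ltn_ord a; lia].
by rewrite mxE; case: splitP => b jb; [have := ltn_ord b; lia | rewrite mxE; congr (('X^_ * _)`_i); lia].
Qed.

(** Its determinant is, up to a constant, the discriminant of p as a form of degree k + 1. It is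
    linear in p, so a - t b gives a pencil, which is singular when t is a critical value of a /
    b. *)
Definition crit_syl k p := syl k p^`() (polar k.+1 p).

(* If the pencils crit_syl a - t crit_syl b and crit_syl c - t crit_syl d are singular for the
   same t, with left kernel vectors u and v, then u *t v is in the kernel of this matrix. *)
Definition disc_mx k l (a b c d : {poly F}) : 'M[F]_((k + k) * (l + l)) :=
  crit_syl k a *t crit_syl l d - crit_syl k b *t crit_syl l c.

End Sylvester.

Section SmoothCondition.
Variable F : fieldType.
Implicit Types (p q a b c d : {poly F}) (s t : bool).

(** [polar] takes the value K a - x a', so a relation satisfied by the values and by the derivatives
    passes to the other partial derivative. *)
Lemma polar_combination (K x a1 a b1 b c d : F) : a * d - b * c = 0 -> a1 * d - b1 * c = 0 ->
  (K * a - x * a1) * d - (K * b - x * b1) * c = 0.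
Proof.
move=> E0 E1.
have -> : (K * a - x * a1) * d - (K * b - x * b1) * c =
  K * (a * d - b * c) - x * (a1 * d - b1 * c) by ring.
by rewrite E0 E1 !mulr0 subr0.
Qed.

Lemma tens_row_mul k l k' l' (u : 'rV[F]_k) (v : 'rV[F]_l) (P : 'M[F]_(k, k')) (Q : 'M[F]_(l, l')) :
  (u *t v) *m (P *t Q) = (u *m P) *t (v *m Q).
Proof. exact: tensmx_mul. Qed.

Lemma mono_vec_1 k s (x : F) :
  mono_vec k.+1 s x 0 (if s then ord_max else ord0) = 1.
Proof. by rewrite mxE; case: s => /=; rewrite ?subnn expr0. Qed.

Lemma mono_vec_neq0 k s (x : F) : mono_vec k.+1 s x != 0.
Proof.
apply/eqP => /rowP /(_ (if s then ord_max else ord0)).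
by rewrite mono_vec_1 mxE => /eqP; rewrite oner_eq0.
Qed.

Lemma syl_common_zero k s (x : F) p q : (size p <= k.+2)%N -> (size q <= k.+2)%N ->
  \det (syl k.+1 p q) != 0 ->
  (chart_poly k.+1 s p).[x] = 0 -> (chart_poly k.+1 s q).[x] = 0 -> False.
Proof.
move=> sp sq dn0 px qx; move/negP: dn0; apply; apply/det0P.
exists (mono_vec k.+1 s x); first exact: mono_vec_neq0.
rewrite mono_vec_syl //; apply/rowP => j; rewrite !mxE.
by case: fintype.split => i; rewrite ?px ?qx mulr0.
Qed.

Lemma mono_vec_crit k s (x : F) p : (size p <= k.+2)%N ->
  let P := chart_poly k.+1 s p in
  mono_vec k s x *m crit_syl k p = \row_j
   match fintype.split j with
   | inl i => x ^+ (if s then (k.-1 - i)%N else i) * (if s then polar k.+1 P else P^`()).[x]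
   | inr i => x ^+ (if s then (k.-1 - i)%N else i) * (if s then P^`() else polar k.+1 P).[x]
   end.
Proof.
move=> sp P; rewrite mono_vec_syl ?size_polar //; last first.
  by apply/leq_sizeP => j kj; rewrite coef_deriv nth_default ?mul0rn // (leq_trans sp).
apply/rowP => j; rewrite !mxE /P {P}; case: s => //=.
by rewrite polar_rev // deriv_rev.
Qed.

(** The tensor product of the two monomial vectors evaluates each column at (x, y). At a singular
    point of the curve all these values vanish, which gives a nonzero left kernel vector. *)
Lemma disc_mx_singular k l s t (x y : F) a b c d : 
  (size a <= k.+3)%N -> (size b <= k.+3)%N -> (size c <= l.+3)%N -> (size d <= l.+3)%N ->
  let A := chart_poly k.+2 s a in let B := chart_poly k.+2 s b in
  let C := chart_poly l.+2 t c in let D := chart_poly l.+2 t d in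
  ~ (A.[x] = 0 /\ B.[x] = 0) -> ~ (C.[y] = 0 /\ D.[y] = 0) ->
  A.[x] * D.[y] - B.[x] * C.[y] = 0 ->
  A^`().[x] * D.[y] - B^`().[x] * C.[y] = 0 ->
  A.[x] * D^`().[y] - B.[x] * C^`().[y] = 0 ->
  \det (disc_mx k.+1 l.+1 a b c d) = 0.
Proof.
move=> sa sb sc sd A B C D AB CD E0 Ex Ey.
(* The pairs (A, B) and (C, D) are nonzero and parallel, (A', B') is parallel to (C, D), and (C',
   D') to (A, B); so (A', B') and (C', D') are parallel too. *)
have Exy : A^`().[x] * D^`().[y] - B^`().[x] * C^`().[y] = 0.
  have [A0|A0] := eqVneq A.[x] 0.
    have B0 : B.[x] != 0 by apply/eqP => B0; apply: AB.
    move: E0 Ey; rewrite A0 !mul0r !sub0r => /eqP; rewrite oppr_eq0 mulf_eq0 (negbTE B0) /= => /eqP C0.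
    move=> /eqP; rewrite oppr_eq0 mulf_eq0 (negbTE B0) /= => /eqP C1.
    have D0 : D.[y] != 0 by apply/eqP => D0; apply: CD.
    move: Ex; rewrite C0 mulr0 subr0 => /eqP; rewrite mulf_eq0 (negbTE D0) orbF => /eqP ->.
    by rewrite C1 mul0r mulr0 subrr.
  have [C0|C0] := eqVneq C.[y] 0.
    move: E0; rewrite C0 mulr0 subr0 => /eqP; rewrite mulf_eq0 (negbTE A0) /= => /eqP D0.
    by case: CD.
  apply: (mulfI (mulf_neq0 A0 C0)); rewrite mulr0.
  have -> : A.[x] * C.[y] * (A^`().[x] * D^`().[y] - B^`().[x] * C^`().[y]) =
     A^`().[x] * C.[y] * (A.[x] * D^`().[y] - B.[x] * C^`().[y])
     + C^`().[y] * A.[x] * (A^`().[x] * D.[y] - B^`().[x] * C.[y])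
     - A^`().[x] * C^`().[y] * (A.[x] * D.[y] - B.[x] * C.[y]).
    by ring.
  by rewrite E0 Ex Ey !mulr0 addr0 subr0.
apply/eqP/det0P; exists (mono_vec k.+1 s x *t mono_vec l.+1 t y).
  apply/eqP => /rowP.
  move=> /(_ (mxtens_index (if s then ord_max else ord0, if t then ord_max else ord0))).
  rewrite mxE mxtens_indexK /= !ord1 !mono_vec_1 mxE mulr1 => /eqP.
  by rewrite oner_eq0.
rewrite /disc_mx mulmxBr.
rewrite !tens_row_mul !mono_vec_crit //.
apply/matrixP => i j; rewrite !mxE -/A -/B -/C -/D.
(* The chart at infinity swaps the two partial derivatives in the column blocks; the boolean absorbs
   this, and [key] serves all four pairs of blocks. *)
pose sel k (e : bool) p : {poly F} := if e then polar k p else p^`().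
have selE k' e p z : (sel k' e p).[z] =
    if e then k'%:R * p.[z] - z * p^`().[z] else p^`().[z].
  by case: e; rewrite //= hornerD hornerN hornerMn hornerM hornerX mulr_natl.
have key (e e' : bool) (u v : F) :
    u * (sel k.+2 e A).[x] * (v * (sel l.+2 e' D).[y]) -
    u * (sel k.+2 e B).[x] * (v * (sel l.+2 e' C).[y]) = 0.
  have g1 : (sel k.+2 e A).[x] * D.[y] - (sel k.+2 e B).[x] * C.[y] = 0.
    by rewrite !selE; case: (e) => //; exact: polar_combination.
  have g2 : (sel k.+2 e A).[x] * D^`().[y] - (sel k.+2 e B).[x] * C^`().[y] = 0.
    by rewrite !selE; case: (e) => //; exact: polar_combination.
  have g3 : (sel k.+2 e A).[x] * (sel l.+2 e' D).[y] - (sel k.+2 e B).[x] * (sel l.+2 e' C).[y] = 0.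
    rewrite (selE _ _ D) (selE _ _ C); case: (e') => //.
    by rewrite ![(sel k.+2 _ _).[x] * _]mulrC; apply: polar_combination; rewrite ![_ * (sel _ _ _).[x]]mulrC.
  move: g3; move: (sel k.+2 e A).[x] (sel k.+2 e B).[x] (sel l.+2 e' D).[y] (sel l.+2 e' C).[y].
  by move=> PA PB PD PC g3; rewrite -!mulrA ![_ * (v * _)]mulrCA -!mulrBr g3 !mulr0.
case: (fintype.split (mxtens_unindex j).1) => i1; case: (fintype.split (mxtens_unindex j).2) => i2.
- exact: (key s t).
- have -> : (if t then D^`() else polar l.+2 D) = sel l.+2 (~~ t) D by rewrite /sel if_neg.
  have -> : (if t then C^`() else polar l.+2 C) = sel l.+2 (~~ t) C by rewrite /sel if_neg.
  exact: (key s (~~ t)).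
- have -> : (if s then A^`() else polar k.+2 A) = sel k.+2 (~~ s) A by rewrite /sel if_neg.
  have -> : (if s then B^`() else polar k.+2 B) = sel k.+2 (~~ s) B by rewrite /sel if_neg.
  exact: (key (~~ s) t).
- have -> : (if t then D^`() else polar l.+2 D) = sel l.+2 (~~ t) D by rewrite /sel if_neg.
  have -> : (if t then C^`() else polar l.+2 C) = sel l.+2 (~~ t) C by rewrite /sel if_neg.
  have -> : (if s then A^`() else polar k.+2 A) = sel k.+2 (~~ s) A by rewrite /sel if_neg.
  have -> : (if s then B^`() else polar k.+2 B) = sel k.+2 (~~ s) B by rewrite /sel if_neg.
  exact: (key (~~ s) (~~ t)).
Qed.

End SmoothCondition.

(** * Bihomogeneous polynomials in the coefficients *)

Section Bihomogeneity.
Variables (F : fieldType) (k l : nat).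
Local Notation poly_ring := (mpoly (k.+1 + l.+1) F).
Implicit Types (G H : poly_ring).

Definition bihom (d e : nat) G : Prop := forall mon, mon \in msupp G ->
    (\sum_(i < k.+1) mon (lshift l.+1 i))%N = d /\
    (\sum_(j < l.+1) mon (rshift k.+1 j))%N = e.

Lemma bihom_bihomogeneous d e G : bihom d e G -> bihomogeneous G.
Proof. by exists d, e. Qed.

Lemma bihom0 d e : bihom d e 0.
Proof. by move=> mon; rewrite msupp0. Qed.

Lemma bihom1 : bihom 0 0 1.
Proof.
move=> mon; rewrite msupp1 inE => /eqP ->.
by split; apply: big1 => i _; rewrite mnm0E.
Qed.

Lemma bihomD d e G H : bihom d e G -> bihom d e H -> bihom d e (G + H).
Proof. by move=> hG hH mon /msuppD_le; rewrite mem_cat => /orP[/hG|/hH]. Qed.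

Lemma bihomN d e G : bihom d e G -> bihom d e (- G).
Proof. by move=> hG mon; rewrite (perm_mem (msuppN G)); exact: hG. Qed.

Lemma bihomB d e G H : bihom d e G -> bihom d e H -> bihom d e (G - H).
Proof. by move=> hG hH; apply: bihomD => //; exact: bihomN. Qed.

Lemma bihomMn d e G i : bihom d e G -> bihom d e (G *+ i).
Proof.
by move=> hG; elim: i => [|i IH]; rewrite ?mulr0n ?mulrS; [exact: bihom0 | exact: bihomD].
Qed.

Lemma bihomM d e d' e' G H : bihom d e G -> bihom d' e' H ->
  bihom (d + d') (e + e') (G * H).
Proof.
move=> hG hH mon /msuppM_le /allpairsP [[m1 m2] /= [/hG[<- <-] /hH[<- <-] ->]].
by rewrite -!big_split; split; apply: eq_bigr => i _; rewrite mnmDE.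
Qed.

Lemma bihom_sum (I : Type) (r : seq I) (P : pred I) (f : I -> poly_ring) d e :
  (forall i, P i -> bihom d e (f i)) -> bihom d e (\sum_(i <- r | P i) f i).
Proof. by move=> h; apply: big_ind => //; [exact: bihom0 | move=> *; exact: bihomD]. Qed.

Lemma bihom_det N (M : 'M[poly_ring]_N) d e : (forall i j, bihom d e (M i j)) ->
  bihom (N * d) (N * e) (\det M).
Proof.
move=> hM; apply: bihom_sum => s _.
have hp : bihom (N * d) (N * e) (\prod_(i < N) M i (s i)).
  have -> : (N * d)%N = (\sum_(i < N) d)%N by rewrite sum_nat_const card_ord.
  have -> : (N * e)%N = (\sum_(i < N) e)%N by rewrite sum_nat_const card_ord.
  elim/big_rec3: _ => [|i x y z _ IH]; first exact: bihom1.
  exact: bihomM.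
by rewrite mulr_sign; case: ifP => _ //; exact: bihomN.
Qed.

Lemma bihomXl i : bihom 1 0 (mpolyX F (mnm1 (lshift l.+1 i))).
Proof.
move=> mon; rewrite msuppX inE => /eqP ->; split.
  rewrite (bigD1 i) //= mnm1E eqxx big1 // => j ji.
  by rewrite mnm1E (inj_eq (@lshift_inj _ _)) eq_sym (negbTE ji).
by apply: big1 => j _; rewrite mnm1E eq_lrshift.
Qed.

Lemma bihomXr i : bihom 0 1 (mpolyX F (mnm1 (rshift k.+1 i))).
Proof.
move=> mon; rewrite msuppX inE => /eqP ->; split; last first.
  rewrite (bigD1 i) //= mnm1E eqxx big1 // => j ji.
  by rewrite mnm1E (inj_eq (@rshift_inj _ _)) eq_sym (negbTE ji).
by apply: big1 => j _; rewrite mnm1E eq_rlshift.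
Qed.

Definition coef_bihom d e (p : {poly poly_ring}) := forall i, bihom d e p`_i.

Lemma coef_bihom_deriv d e p : coef_bihom d e p -> coef_bihom d e p^`().
Proof. by move=> h i; rewrite coef_deriv; exact: bihomMn. Qed.

Lemma coef_bihom_polar d e N p : coef_bihom d e p -> coef_bihom d e (polar N p).
Proof. by move=> h i; rewrite coef_polar; apply: bihomB; exact: bihomMn. Qed.

Lemma bihom_syl d e N p q i j : coef_bihom d e p -> coef_bihom d e q ->
  bihom d e (syl N p q i j).
Proof.
move=> hp hq; rewrite mxE; case: fintype.split => a; rewrite mxE coefXnM;
by case: ifP => _ //; exact: bihom0.
Qed.

End Bihomogeneity.

Section GenericPolynomial.
Variable F : fieldType.

(** Inverse to [coef_vector] together with [right_poly]; the ring is arbitrary so that the entries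
    can be scalars or the indeterminates themselves. *)
Definition left_poly (E : comNzRingType) n (v : 'I_(2 * n + 1).+1 -> E) : {poly E} :=
  \poly_(i < n.+1) v (inord (n - i)).
Definition right_poly (E : comNzRingType) n (v : 'I_(2 * n + 1).+1 -> E) : {poly E} :=
  \poly_(i < n.+1) v (inord (2 * n + 1 - i)).

Lemma left_poly_coef n (a b : {poly F}) (s : F) : (size a <= n.+1)%N ->
  left_poly (fun i => (s *: coef_vector n a b) 0 i) = s *: a.
Proof.
move=> sa; apply/polyP => i; rewrite coef_poly coefZ.
case: ltnP => i_n; last by rewrite nth_default ?mulr0 // (leq_trans sa).
rewrite !mxE inordK; last by lia.
by rewrite leq_subr subKn.
Qed.

Lemma right_poly_coef n (a b : {poly F}) (s : F) : (size b <= n.+1)%N ->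
  right_poly (fun i => (s *: coef_vector n a b) 0 i) = s *: b.
Proof.
move=> sb; apply/polyP => i; rewrite coef_poly coefZ.
case: ltnP => i_n; last by rewrite nth_default ?mulr0 // (leq_trans sb).
rewrite !mxE inordK; last by lia.
by rewrite ifF; [congr (_ * _`_ _); lia | lia].
Qed.

(* Nonzero only if a / b and c / d have degree k + 2 and l + 2 and no common critical value. *)
Definition gen_det (E : comNzRingType) k l (a b c d : {poly E}) : E :=
  \det (disc_mx k.+1 l.+1 a b c d) *
  (\det (syl k.+2 a b) * \det (syl l.+2 c d)).

Lemma map_syl (E E' : comNzRingType) (f : {rmorphism E -> E'}) k (p q : {poly E}) :
  map_mx f (syl k p q) = syl k (map_poly f p) (map_poly f q).
Proof.
apply/matrixP => i j; rewrite !mxE; case: fintype.split => a;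
by rewrite !mxE !coefXnM; case: ifP; rewrite ?rmorph0 ?coef_map.
Qed.

Lemma map_polar (E E' : comNzRingType) (f : {rmorphism E -> E'}) k (p : {poly E}) :
  map_poly f (polar k p) = polar k (map_poly f p).
Proof. by apply/polyP => i; rewrite coef_map !coef_polar raddfB /= !raddfMn /= coef_map. Qed.

Lemma map_gen_det (E E' : comNzRingType) (f : {rmorphism E -> E'}) k l (a b c d : {poly E}) :
  f (gen_det k l a b c d) =
  gen_det k l (map_poly f a) (map_poly f b) (map_poly f c) (map_poly f d).
Proof.
rewrite /gen_det /disc_mx !rmorphM /= -!det_map_mx map_mxB !map_mxT /crit_syl !map_syl.
by rewrite !map_polar -!deriv_map.
Qed.

End GenericPolynomial.

(** * An example with nonzero discriminant *)

Section Example.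
Variable F : numFieldType.

Lemma scalar_mx_0 N : 0%:M = 0 :> 'M[F]_N.
Proof. by apply/matrixP => i j; rewrite !mxE mul0rn. Qed.

Lemma syl_binomial M (a b c d : F) : (0 < M)%N ->
  syl M (a *: 'X^M + b%:P) (c *: 'X^M + d%:P) = block_mx b%:M d%:M a%:M c%:M.
Proof.
move=> M0.
have E (u v : F) (i : 'I_(M + M)) (j : 'I_M) : ('X^j * (u *: 'X^M + v%:P))`_i =
   col_mx (v%:M : 'M[F]_M) (u%:M : 'M[F]_M) i j.
  rewrite coefXnM coefD coefZ coefXn coefC mxE; have jM := ltn_ord j.
  case: splitP => i' ->; rewrite mxE; have iM := ltn_ord i'.
    case: ltnP => ij; first by rewrite -val_eqE /= ltn_eqF.
    rewrite [(_ - _ == M)%N]ltn_eqF ?mulr0 ?add0r; last by lia.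
    have -> : (i' - j == 0)%N = (i' == j) by rewrite -val_eqE /=; apply/eqP/eqP; lia.
    by case: eqP => _; rewrite ?mulr1n ?mulr0n.
  rewrite ifF; last by lia.
  have -> : (M + i' - j == 0)%N = false by apply/eqP; lia.
  have -> : (M + i' - j == M)%N = (i' == j) by rewrite -val_eqE /=; apply/eqP/eqP; lia.
  by rewrite addr0; case: eqP => _; rewrite ?mulr1 ?mulr0 ?mulr1n ?mulr0n.
rewrite block_mxEh /syl.
by congr row_mx; apply/matrixP => i j; rewrite mxE E.
Qed.

Lemma crit_syl_binomial M (a b : F) : (0 < M)%N ->
  crit_syl M (a *: 'X^(M.+1) + b%:P) = block_mx 0 (M.+1%:R * b)%:M (M.+1%:R * a)%:M 0.
Proof.
move=> M0; rewrite /crit_syl.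
have -> : deriv (a *: 'X^(M.+1) + b%:P : {poly F}) = (M.+1%:R * a) *: 'X^M + 0%:P.
  by rewrite derivD derivZ derivXn derivC polyC0 !addr0 /= -scalerMnr scalerMnl mulr_natl.
have -> : polar M.+1 (a *: 'X^(M.+1) + b%:P : {poly F}) = 0 *: 'X^M + (M.+1%:R * b)%:P.
  apply/polyP => i; rewrite coef_polar !(coefD, coefZ, coefXn, coefC) mul0r add0r.
  case: (eqVneq i M.+1) => [->|iM]; first by rewrite subrr.
  by case: eqP => [->|_]; rewrite mulr0 add0r ?mulr0n ?subr0 ?mulr_natl // !mul0rn subr0.
by rewrite syl_binomial // !scalar_mx_0.
Qed.

Lemma tensmxDl k1 k2 k3 k4 (A B : 'M[F]_(k1, k2)) (D : 'M[F]_(k3, k4)) :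
  (A + B) *t D = A *t D + B *t D.
Proof. by apply/matrixP => i j; rewrite !mxE mulrDl. Qed.

(** The critical values are 0 and infinity for the first map, -1 and 1 for the second. All the
    matrices have scalar blocks, so each factor is shown invertible by multiplication with an
    explicit block matrix. *)
Lemma gen_det_example k l :
  gen_det k l 'X^(k.+2) 1 ('X^(l.+2) - 1) ('X^(l.+2) + 1 : {poly F}) != 0.
Proof.
have n0 i : i.+1%:R != 0 :> F by rewrite pnatr_eq0.
have e1 : 'X^(k.+2) = 1 *: 'X^(k.+2) + 0%:P :> {poly F} by rewrite scale1r polyC0 addr0.
have e2 : 1 = 0 *: 'X^(k.+2) + 1%:P :> {poly F} by rewrite scale0r add0r.
have e3 : 'X^(l.+2) - 1 = 1 *: 'X^(l.+2) + (-1)%:P :> {poly F}.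
  by rewrite scale1r polyCN.
have e4 : 'X^(l.+2) + 1 = 1 *: 'X^(l.+2) + 1%:P :> {poly F} by rewrite scale1r.
have unit_det N (P Q : 'M[F]_N) : P *m Q \in unitmx -> \det P != 0.
  by rewrite unitmx_mul => /andP[+ _]; rewrite unitmxE unitfE.
have -> : gen_det k l 'X^(k.+2) 1 ('X^(l.+2) - 1) ('X^(l.+2) + 1 : {poly F}) =
   gen_det k l (1 *: 'X^(k.+2) + 0%:P) (0 *: 'X^(k.+2) + 1%:P)
     (1 *: 'X^(l.+2) + (-1)%:P) (1 *: 'X^(l.+2) + 1%:P).
  by rewrite -e1 -e2 -e3 -e4.
rewrite /gen_det !mulf_neq0 //.
- rewrite /disc_mx !crit_syl_binomial // !mulr0 !mulr1 !mulrN1 !scalar_mx_0.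
  set n := k.+2%:R; set m := l.+2%:R.
  (* A right inverse up to the factor k + 2: the cross terms vanish because they contain the square
     of a nilpotent block. *)
  apply: (unit_det _ _ (block_mx 0 1%:M 0 0 *t block_mx 0 m^-1%:M m^-1%:M 0 -
     block_mx 0 0 1%:M 0 *t block_mx 0 m^-1%:M (- m^-1)%:M 0)).
  rewrite mulmxBl !mulmxBr !tensmx_mul !mulmx_block.
  rewrite !(mul0mx, mulmx0, add0r, addr0, mulmx1) -!scalar_mxM.
  rewrite mulrNN !mulfV ?n0 // !block_mx0 !tens0mx subr0 sub0r opprK -tensmxDl.
  rewrite add_block_mx !addr0 add0r -!scalar_mx_block.
  apply: tensmx_unit; rewrite ?unitmx1 //.
  by rewrite unitmxE det_scalar unitfE expf_neq0 // n0.
- rewrite syl_binomial //; apply: (unit_det _ _ (block_mx 0 1%:M 1%:M 0)).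
  rewrite mulmx_block !(mulmx0, mulmx1, add0r, addr0, scalar_mx_0) -scalar_mx_block.
  exact: unitmx1.
rewrite syl_binomial //; apply: (unit_det _ _ (block_mx (-1)%:M 1%:M 1%:M 1%:M)).
rewrite mulmx_block -!scalar_mxM -!raddfD /= !(mulr1, mul1r, mulN1r, mulrN1, opprK, addNr, subrr, scalar_mx_0).
rewrite -scalar_mx_block unitmxE det_scalar unitfE expf_neq0 //.
Qed.

End Example.

(** * Smoothness outside the zero set of a polynomial *)

Section GenericSmoothness.
Variable F : numFieldType.
Implicit Types (a b c d : {poly F}) (s t : bool).

(** Quantifying over both charts also excludes a common zero at infinity, that is, both degrees
    dropping below k. *)
Definition no_common_zero k a b : Prop := forall s x,
  (chart_poly k s a).[x] = 0 -> (chart_poly k s b).[x] = 0 -> False.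

Definition curve_eq (a b c d : {poly F}) (x y : F) : F := a.[x] * d.[y] - b.[x] * c.[y].

(* The closure in P^1 x P^1 of the curve a(x) d(y) = b(x) c(y) is smooth. *)
Definition smooth_curve n m a b c d : Prop := forall s t x y,
  let A := chart_poly n s a in let B := chart_poly n s b in
  let C := chart_poly m t c in let D := chart_poly m t d in
  curve_eq A B C D x y = 0 -> curve_eq A^`() B^`() C D x y = 0 ->
  curve_eq A B C^`() D^`() x y = 0 -> False.

Definition generic_quad n m a b c d : Prop :=
  [/\ no_common_zero n a b, no_common_zero m c d & smooth_curve n m a b c d].

Lemma generic_quad_scale n m a b c d (u v : F) :
  generic_quad n m (u *: a) (u *: b) (v *: c) (v *: d) -> generic_quad n m a b c d.
Proof.
case=> h1 h2 h3; split.
- by move=> s x ax bx; apply: (h1 s x); rewrite chart_polyZ hornerZ ?ax ?bx mulr0.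
- by move=> s x ax bx; apply: (h2 s x); rewrite chart_polyZ hornerZ ?ax ?bx mulr0.
move=> s t x y A B C D E0 Ex Ey; apply: (h3 s t x y); rewrite /curve_eq !(chart_polyZ, derivZ, hornerZ).
- rewrite [LHS](_ : _ = u * v * curve_eq A B C D x y); first by rewrite E0 mulr0.
  by rewrite /curve_eq /A /B /C /D; ring.
- rewrite [LHS](_ : _ = u * v * curve_eq A^`() B^`() C D x y); first by rewrite Ex mulr0.
  by rewrite /curve_eq /A /B /C /D; ring.
rewrite [LHS](_ : _ = u * v * curve_eq A B C^`() D^`() x y); first by rewrite Ey mulr0.
by rewrite /curve_eq /A /B /C /D; ring.
Qed.

Lemma gen_det_generic k l a b c d :
  (size a <= k.+3)%N -> (size b <= k.+3)%N -> (size c <= l.+3)%N -> (size d <= l.+3)%N ->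
  gen_det k l a b c d != 0 -> generic_quad k.+2 l.+2 a b c d.
Proof.
move=> sa sb sc sd; rewrite /gen_det !mulf_eq0 !negb_or => /and3P[d1 d2 d3].
have ab : no_common_zero k.+2 a b by move=> s x; exact: syl_common_zero.
have cd : no_common_zero l.+2 c d by move=> s x; exact: syl_common_zero.
split=> // s t x y A B C D E0 Ex Ey; move/eqP: d1; apply.
apply: (@disc_mx_singular _ k l s t x y) => //; first by case; exact: ab.
by case; exact: cd.
Qed.

(** The scalars u and v allow any representatives of the projective points; the nonzero vectors of
    the second clause provide a point of the product outside the zero set. *)
Theorem generic_polynomial k l (n := k.+2) (m := l.+2) :
  exists G : mpoly ((2 * n + 1).+1 + (2 * m + 1).+1) F,
  [/\ bihomogeneous G,
      exists (v : 'rV[F]_(2 * n + 1).+1) (w : 'rV[F]_(2 * m + 1).+1), [/\ v != 0, w != 0 & meval (row_mx v w 0) G != 0] &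
      forall a b c d u v, (size a <= n.+1)%N -> (size b <= n.+1)%N ->
        (size c <= m.+1)%N -> (size d <= m.+1)%N ->
        meval (row_mx (u *: coef_vector n a b) (v *: coef_vector m c d) 0) G != 0 ->
        generic_quad n m a b c d].
Proof.
pose N := (2 * n + 1).+1; pose M := (2 * m + 1).+1.
pose XL (i : 'I_N) := mpolyX F (mnm1 (lshift M i)).
pose XR (i : 'I_M) := mpolyX F (mnm1 (rshift N i)).
pose A := left_poly (n := n) XL; pose B := right_poly (n := n) XL.
pose C := left_poly (n := m) XR; pose D := right_poly (n := m) XR.
have ev (v : 'rV[F]_N) (w : 'rV[F]_M) : meval (row_mx v w 0) (gen_det k l A B C D) =
  gen_det k l (left_poly (n := n) (v 0)) (right_poly (n := n) (v 0))
    (left_poly (n := m) (w 0)) (right_poly (n := m) (w 0)).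
  pose f : {rmorphism mpoly (N + M) F -> F} := meval (row_mx v w 0).
  have fA : map_poly f A = left_poly (n := n) (v 0).
    apply/polyP => i; rewrite coef_map !coef_poly; case: ltnP => _; last exact: raddf0.
    by rewrite -[LHS]/(meval _ _) mevalXU row_mxEl.
  have fB : map_poly f B = right_poly (n := n) (v 0).
    apply/polyP => i; rewrite coef_map !coef_poly; case: ltnP => _; last exact: raddf0.
    by rewrite -[LHS]/(meval _ _) mevalXU row_mxEl.
  have fC : map_poly f C = left_poly (n := m) (w 0).
    apply/polyP => i; rewrite coef_map !coef_poly; case: ltnP => _; last exact: raddf0.
    by rewrite -[LHS]/(meval _ _) mevalXU row_mxEr.
  have fD : map_poly f D = right_poly (n := m) (w 0).
    apply/polyP => i; rewrite coef_map !coef_poly; case: ltnP => _; last exact: raddf0.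
    by rewrite -[LHS]/(meval _ _) mevalXU row_mxEr.
  have := map_gen_det f k l A B C D; rewrite fA fB fC fD; exact.
have hA : coef_bihom 1 0 A by move=> i; rewrite coef_poly; case: ifP => _; [exact: bihomXl | exact: bihom0].
have hB : coef_bihom 1 0 B by move=> i; rewrite coef_poly; case: ifP => _; [exact: bihomXl | exact: bihom0].
have hC : coef_bihom 0 1 C by move=> i; rewrite coef_poly; case: ifP => _; [exact: bihomXr | exact: bihom0].
have hD : coef_bihom 0 1 D by move=> i; rewrite coef_poly; case: ifP => _; [exact: bihomXr | exact: bihom0].
exists (gen_det k l A B C D); split.
- apply: (@bihom_bihomogeneous F (2 * n + 1) (2 * m + 1)); apply: bihomM; last apply: bihomM.
  + apply: (bihom_det (d := 1) (e := 1)) => i j; rewrite /disc_mx mxE.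
    apply: bihomD; [|rewrite mxE; apply: bihomN]; rewrite mxE; apply: (bihomM (d := 1) (e := 0) (d' := 0) (e' := 1)); apply: bihom_syl;
      (exact: coef_bihom_deriv || exact: coef_bihom_polar).
  + by apply: (bihom_det (d := 1) (e := 0)) => i j; exact: bihom_syl.
  + by apply: (bihom_det (d := 0) (e := 1)) => i j; exact: bihom_syl.
- have s1 : (size ('X^n : {poly F}) <= n.+1)%N by rewrite size_polyXn.
  have s2 : (size (1%R : {poly F}) <= n.+1)%N by rewrite size_poly1.
  have s3 (e : F) : (size ('X^m + e%:P : {poly F})%R <= m.+1)%N.
    by rewrite size_polyDl ?size_polyXn // (leq_ltn_trans (size_polyC_leq1 _)).
  have ne : meval (row_mx (1 *: coef_vector n 'X^n 1) (1 *: coef_vector m ('X^m + (-1)%:P) ('X^m + 1%:P)) 0)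
      (gen_det k l A B C D) != 0.
    rewrite ev !left_poly_coef // !right_poly_coef // !scale1r polyCN.
    exact: gen_det_example.
  exists (1 *: coef_vector n 'X^n 1).
  exists (1 *: coef_vector m ('X^m + (-1)%:P) ('X^m + 1%:P)).
  have cv0 j a b : (size a <= j.+1)%N -> a != 0 -> 1 *: coef_vector j a b != 0.
    move=> sa a0; apply/eqP => E; have := left_poly_coef b 1 sa.
    rewrite E scale1r => Z; move/eqP: a0; apply; rewrite -Z.
    by apply/polyP => i; rewrite coef_poly coef0 mxE if_same.
  split=> //; apply: cv0 => //; rewrite -size_poly_eq0 ?size_polyXn //.
  by rewrite size_polyDl size_polyXn // (leq_ltn_trans (size_polyC_leq1 _)).
move=> a b c d u v sa sb sc sd.
rewrite ev !left_poly_coef // !right_poly_coef // => h.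
apply: (@generic_quad_scale n m a b c d u v); apply: gen_det_generic h;
  by apply: leq_trans (size_scale_leq _ _) _.
Qed.

End GenericSmoothness.

(** * Meromorphic solutions and holomorphic forms *)

Section MeromorphicCharts.
Variable R : realType.
Local Notation C := (Cplx R).
Implicit Types (f : C -> option C) (z w : C).

Lemma pos_rc (d : C) : 0 < d -> exists2 d' : R, 0 < d' & d = rc d'.
Proof.
move=> d0; have dr : d \is Num.real by apply: ger0_real; exact: ltW.
have E : rc (complex.Re d) = d by exact: RRe_real.
by exists (complex.Re d); [rewrite -rc_ltE E rc0 | rewrite E].
Qed.

Lemma near_disc (P : C -> Prop) z : (\forall w \near z, P w) ->
  exists2 r : R, 0 < r & forall w, nm (w - z) < r -> P w.
Proof.
move=> /nbhs_ballP [e /= /pos_rc [r r0 ->] he]; exists r => // w wr.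
by apply: he; rewrite /ball /= normrE rc_ltE nmB.
Qed.

Lemma near_punctured (P : C -> Prop) z : (\forall w \near z^', P w) ->
  exists2 r : R, 0 < r & forall w, w != z -> nm (w - z) < r -> P w.
Proof.
move=> /near_disc [r r0 hr]; exists r => // w wz /hr; exact.
Qed.

Lemma derivable_chol (h : C -> C) z : derivable h z 1 -> chol h z.
Proof.
move=> /derivableP /is_derive_eps hd; exists ('D_1 h z); apply/cderP => e e0.
have ce0 : 0 < rc e by rewrite -rc0 rc_ltE.
have [d /pos_rc [r r0 ->] hr] := hd _ ce0; exists r => // u ur.
by have := hr u; rewrite !normrE rc_ltE -rcM rc_leE; apply.
Qed.

(** The coordinate v or 1 / v on the projective line. Infinity has coordinate 0 in the chart [true];
    outside the chart, as defined by [in_chart], the value 0 is a dummy. *)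
Definition coord (s : bool) (o : option C) : C :=
  if o is Some v then if s then v^-1 else v else 0.

Definition in_chart (s : bool) (o : option C) : bool :=
  if o is Some v then s ==> (v != 0) else s.

Lemma coord_inv s o : in_chart s o -> in_chart (~~ s) o ->
  coord s o != 0 /\ coord (~~ s) o = (coord s o)^-1.
Proof.
by case: s o => [] [v|] //= v0 _; rewrite ?invr_eq0 ?invrK.
Qed.

Lemma in_chart_switch s o : in_chart s o -> coord s o != 0 -> in_chart (~~ s) o.
Proof. by case: s o => [] [v|] //=; rewrite eqxx. Qed.

Lemma coord_inj s (o o' : option C) : in_chart s o -> in_chart s o' -> coord s o = coord s o' -> o = o'.
Proof.
case: s o o' => [] [v|] [v'|] //= h h'; try by move=> ->.
- by move=> /invr_inj ->.
- by move=> /eqP; rewrite invr_eq0 (negbTE h).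
- by move=> /esym/eqP; rewrite invr_eq0 (negbTE h').
Qed.

Lemma ccont_neq0 (h : C -> C) z : ccont h z -> h z != 0 ->
  exists2 r : R, 0 < r & forall w, nm (w - z) < r -> h w != 0.
Proof.
move=> /ccontP ch h0.
have h2 : 0 < nm (h z) / 2 by rewrite divr_gt0 // nm_gt0.
have [r r0 hr] := ch _ h2; exists r => // w /hr hw; apply/eqP => E.
by move: hw; rewrite E sub0r nmN; lra.
Qed.

(** 1 / f is holomorphic where f is holomorphic and nonzero, hence on a punctured disc about a pole;
    at the pole itself the singularity is removable. *)
Lemma meromorphic_chart f z s : meromorphic f -> in_chart s (f z) ->
  exists2 r : R, 0 < r & forall w, nm (w - z) < r ->
    in_chart s (f w) /\ chol (fun w => coord s (f w)) w.
Proof.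
move=> mf vz.
have inv_chol h w (r : R) : 0 < r -> chol h w -> h w != 0 ->
    (forall u, nm (u - w) < r -> coord true (f u) = (h u)^-1) ->
    chol (fun u => coord true (f u)) w.
  move=> r0 [l hl] h0 E; eexists; apply: (@cder_ext _ (fun u => (h u)^-1) _ w _ r r0).
    by move=> u ur; rewrite E.
  exact: cderV h0 hl.
have fpE : (fun w => coord false (f w)) = fin_part f.
  by apply/funext => w; rewrite /fin_part; case: (f w).
case: (mf z) => [/near_disc [r r0 hr]|[fz /near_punctured [r1 r10 h1] hoo]].
  have hr' w : nm (w - z) < r -> f w <> None /\ chol (fin_part f) w.
    by move=> /hr [h1 /derivable_chol h2].
  case: s vz => vz; last first.
    exists r => // w /hr' [h1 h2]; rewrite fpE; split => //.
    by case: (f w) h1.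
  have zz : nm (z - z) < r by rewrite subrr nm0.
  have [fz [l hl]] := hr' _ zz.
  have f0 : fin_part f z != 0 by move: fz vz; rewrite /fin_part; case: (f z).
  have [r2 r20 h2] := ccont_neq0 (cder_cont hl) f0.
  have [r' [r'0 r'r r'r2]] := pos_min r0 r20.
  exists r' => // w wr; have [h3 h4] := hr' w (lt_le_trans wr r'r).
  have h5 := h2 w (lt_le_trans wr r'r2).
  split; first by move: h3 h5; rewrite /fin_part; case: (f w).
  apply: (inv_chol (fin_part f) w 1) => // u _.
  by rewrite /fin_part; case: (f u) => [v|] //=; rewrite invr0.
case: s vz => [_|]; last by rewrite fz.
have big (M : R) : 0 < M -> exists2 r : R, 0 < r & forall w, w != z -> nm (w - z) < r ->
    M < nm (fin_part f w).
  move=> M0; have Mr : rc M \is Num.real by apply: ger0_real; rewrite -rc0 rc_leE ltW.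
  have : \forall w \near z^', rc M < `|fin_part f w|.
    have hM : pinfty_nbhs C (fun y => rc M < y) by exists (rc M); split.
    exact: (hoo _ hM).
  move=> /near_punctured [r r0 hr]; exists r => // w wz /(hr _ wz).
  by rewrite normrE rc_ltE.
have [r2 r20 h2] := big _ ltr01.
have [r [r0 rr1 rr2]] := pos_min r10 r20.
have val w : nm (w - z) < r -> in_chart true (f w).
  have [->|wz] := eqVneq w z; first by rewrite fz.
  move=> wr; have [h3 _] := h1 w wz (lt_le_trans wr rr1).
  have := h2 w wz (lt_le_trans wr rr2); move: h3; rewrite /fin_part.
  by case: (f w) => [v|] //= _ v1; rewrite -nm_gt0 (lt_trans ltr01).
have hol w : w != z -> nm (w - z) < r -> chol (fun w => coord true (f w)) w.
  move=> wz wr; have [h3 /derivable_chol h4] := h1 w wz (lt_le_trans wr rr1).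
  apply: (inv_chol (fin_part f) w 1) => //.
    by rewrite -nm_gt0; apply: lt_trans ltr01 _; exact: h2 wz (lt_le_trans wr rr2).
  by move=> u _; rewrite /fin_part; case: (f u) => [v|] //=; rewrite invr0.
exists r => // w wr; split; first exact: val.
have [->|wz] := eqVneq w z; last exact: hol.
(* The coordinate at the pole is 0, and its continuity there is the divergence of the modulus of
   f. *)
apply: (removable r0) => [|u u0 ur]; last first.
  by apply: hol => //; rewrite -subr_eq0 -nm_gt0.
apply/ccontP => e e0; have [d d0 hd] := big e^-1 ltac:(by rewrite invr_gt0).
exists d => // u ud; rewrite fz /= subr0.
have [->|uz] := eqVneq u z; first by rewrite fz nm0 ltW.
have := hd u uz ud; rewrite /fin_part; case: (f u) => [v|] /=; last by rewrite nm0 ltW.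
rewrite nmV => ev; rewrite -[e]invrK lef_pV2 ?posrE ?invr_gt0 //; first exact: ltW.
by apply: lt_trans ev; rewrite invr_gt0.
Qed.

End MeromorphicCharts.

Lemma horner_rev (F : fieldType) k (p : {poly F}) (x : F) : x != 0 -> (size p <= k.+1)%N ->
  (rev_poly k p).[x^-1] = x ^- k * p.[x].
Proof.
move=> x0 sp; rewrite (horner_coef_wide _ sp) (horner_coef_wide _ (size_rev k p)).
rewrite mulr_sumr (reindex_inj rev_ord_inj) /=; apply: eq_bigr => i _.
have ik := ltn_ord i; rewrite coef_rev subSS leq_subr subKn //.
rewrite mulrCA; congr (_ * _); apply: (mulfI (expf_neq0 k x0)).
rewrite mulrA mulfV ?expf_neq0 // mul1r exprVn.
have -> : x ^+ k = x ^+ i * x ^+ (k - i) by rewrite -exprD subnKC.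
by rewrite mulfK ?expf_neq0.
Qed.

Section LocalForm.
Variable R : realType.
Local Notation C := (Cplx R).
Variables (n m : nat) (a b c d : {poly C}) (f g : C -> option C).
Implicit Types (s t : bool) (z w : C).

Definition sizes : Prop :=
  [/\ (size a <= n.+1)%N, (size b <= n.+1)%N, (size c <= m.+1)%N & (size d <= m.+1)%N].

(** The equation is imposed in every pair of charts, so that poles of f and g are ordinary
    points. *)
Definition solution : Prop :=
  [/\ generic_quad n m a b c d, sizes, meromorphic f, meromorphic g &
   forall z s t, in_chart s (f z) -> in_chart t (g z) ->
    curve_eq (chart_poly n s a) (chart_poly n s b) (chart_poly m t c) (chart_poly m t d)
      (coord s (f z)) (coord t (g z)) = 0].

Definition dF_x s t z : C :=
  curve_eq (chart_poly n s a)^`() (chart_poly n s b)^`() (chart_poly m t c) (chart_poly m t d)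
    (coord s (f z)) (coord t (g z)).
Definition dF_y s t z : C :=
  curve_eq (chart_poly n s a) (chart_poly n s b) (chart_poly m t c)^`() (chart_poly m t d)^`()
    (coord s (f z)) (coord t (g z)).

(* The pullback of the 1-form dx / F_y = - dy / F_x, divided by dz. *)
Definition form s t z : C :=
  if dF_y s t z != 0 then cderiv (fun w => coord s (f w)) z / dF_y s t z
  else - cderiv (fun w => coord t (g w)) z / dF_x s t z.

Hypothesis sol : solution.

Lemma dF_neq0 s t z : in_chart s (f z) -> in_chart t (g z) ->
  dF_y s t z = 0 -> dF_x s t z != 0.
Proof.
case: sol => -[_ _ sm] _ _ _ eq0 fs gt y0; apply/eqP => x0.
exact: (sm s t (coord s (f z)) (coord t (g z)) (eq0 z s t fs gt) x0 y0).
Qed.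

Lemma chart_disc s t z : in_chart s (f z) -> in_chart t (g z) ->
  exists2 r : R, 0 < r & forall w, nm (w - z) < r ->
  [/\ in_chart s (f w), in_chart t (g w), chol (fun w => coord s (f w)) w &
      chol (fun w => coord t (g w)) w].
Proof.
case: sol => _ _ mf mg _ fs gt.
have [r1 r10 h1] := meromorphic_chart mf fs.
have [r2 r20 h2] := meromorphic_chart mg gt.
have [r [r0 rr1 rr2]] := pos_min r10 r20.
exists r => // w wr.
have [h3 h4] := h1 w (lt_le_trans wr rr1).
by have [h5 h6] := h2 w (lt_le_trans wr rr2).
Qed.

(** Differentiating F(x, y) = 0 gives F_x x' + F_y y' = 0, and (F_x, F_y) is nonzero by smoothness;
    so (x', y') is a multiple of (F_y, - F_x), also where one partial derivative vanishes. *)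
Lemma form_der s t z : in_chart s (f z) -> in_chart t (g z) ->
  cder (fun w => coord s (f w)) z (form s t z * dF_y s t z) /\
  cder (fun w => coord t (g w)) z (- (form s t z * dF_x s t z)).
Proof.
move=> fs gt; have [r r0 hr] := chart_disc fs gt.
have zz : nm (z - z) < r by rewrite subrr nm0.
have [_ _ /cderivP hx /cderivP hy] := hr _ zz.
set x' := cderiv _ z in hx; set y' := cderiv _ z in hy.
have dif : dF_x s t z * x' + dF_y s t z * y' = 0.
  have h := cderB (cderM (cder_poly (chart_poly n s a) hx) (cder_poly (chart_poly m t d) hy))
     (cderM (cder_poly (chart_poly n s b) hx) (cder_poly (chart_poly m t c) hy)).
  have h0 : cder (fun=> 0) z (dF_x s t z * x' + dF_y s t z * y').
    rewrite [X in cder _ _ X](_ : _ =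
      (chart_poly n s a)^`().[coord s (f z)] * x' * (chart_poly m t d).[coord t (g z)] +
      (chart_poly n s a).[coord s (f z)] * ((chart_poly m t d)^`().[coord t (g z)] * y') -
     ((chart_poly n s b)^`().[coord s (f z)] * x' * (chart_poly m t c).[coord t (g z)] +
      (chart_poly n s b).[coord s (f z)] * ((chart_poly m t c)^`().[coord t (g z)] * y'))).
      apply: cder_ext r0 _ h => w wr; have [fw gw _ _] := hr _ wr.
      by case: sol => _ _ _ _ /(_ w s t fw gw).
    by rewrite /dF_x /dF_y /curve_eq; ring.
  exact: cder_uniq h0 (cder_cst 0 z).
rewrite /form; case: eqVneq => [y0|y0] /=.
  have x0 := dF_neq0 fs gt y0.
  rewrite y0 mulr0 divfK // opprK; split => //.
  move/eqP: dif; rewrite y0 mul0r addr0 mulf_eq0 (negbTE x0) /= => /eqP <-.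
  exact: hx.
rewrite divfK //; split => //.
have -> : - (x' / dF_y s t z * dF_x s t z) = y'.
  have -> : y' = (dF_x s t z * x' + dF_y s t z * y') / dF_y s t z - dF_x s t z * x' / dF_y s t z.
    by field.
  by rewrite dif mul0r sub0r; ring.
exact: hy.
Qed.

(** F_x or F_y is nonzero. A change of charts can therefore be checked on the derivatives of the two
    coordinates. *)
Lemma form_uniq s t z p : in_chart s (f z) -> in_chart t (g z) ->
  cder (fun w => coord s (f w)) z (p * dF_y s t z) ->
  cder (fun w => coord t (g w)) z (- (p * dF_x s t z)) -> form s t z = p.
Proof.
move=> fs gt h1 h2; have [k1 k2] := form_der fs gt.
have e1 := cder_uniq k1 h1; have /oppr_inj e2 := cder_uniq k2 h2.
have [y0|y0] := eqVneq (dF_y s t z) 0; last exact: mulIf y0 _ _ e1.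
exact: mulIf (dF_neq0 fs gt y0) _ _ e2.
Qed.

Lemma chol_curve_eq (p q p' q' : {poly C}) (x y : C -> C) z : chol x z -> chol y z ->
  chol (fun w => curve_eq p q p' q' (x w) (y w)) z.
Proof.
move=> [x' hx] [y' hy]; eexists.
exact: cderB (cderM (cder_poly p hx) (cder_poly q' hy)) (cderM (cder_poly q hx) (cder_poly p' hy)).
Qed.

Lemma chol_neq0 (h : C -> C) z : chol h z -> h z != 0 ->
  exists2 r : R, 0 < r & forall w, nm (w - z) < r -> h w != 0.
Proof. by move=> [l /cder_cont]; exact: ccont_neq0. Qed.

Lemma chol_quot (h k F : C -> C) z (r : R) : 0 < r -> chol h z -> chol k z -> k z != 0 ->
  (forall w, nm (w - z) < r -> F w = h w / k w) -> chol F z.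
Proof.
move=> r0 [l hl] [l' hl'] k0 E; eexists.
apply: (@cder_ext _ (fun w => h w * (k w)^-1) _ z _ r r0) => [w /E -> //|].
exact: cderM hl (cderV k0 hl').
Qed.

(** A partial derivative that is nonzero at z stays so nearby, and there [form_der] gives one
    quotient formula across both cases of [form]. *)
Lemma form_chol s t z : in_chart s (f z) -> in_chart t (g z) -> chol (form s t) z.
Proof.
move=> fs gt; have [r r0 hr] := chart_disc fs gt.
have zz : nm (z - z) < r by rewrite subrr nm0.
have [_ _ hx hy] := hr _ zz.
have hX : chol (dF_x s t) z by exact: chol_curve_eq.
have hY : chol (dF_y s t) z by exact: chol_curve_eq.
have [y0|y0] := eqVneq (dF_y s t z) 0.
  have x0 := dF_neq0 fs gt y0.
  have [r1 r10 h1] := chol_neq0 hX x0.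
  have [r2 [r20 r2r r2r1]] := pos_min r0 r10.
  have hy' : chol (fun w => -1 * cderiv (fun w => coord t (g w)) w) z.
    have [l hl] : chol (cderiv (fun w => coord t (g w))) z.
      by apply: (hol_deriv r0) => w /hr [].
    by exists (-1 * l); exact: cderZ.
  apply: (chol_quot r20 hy' hX x0) => w wr.
  have [fw gw _ _] := hr _ (lt_le_trans wr r2r).
  have [_ /cderivE ->] := form_der fw gw.
  by rewrite mulN1r opprK mulfK // h1 // (lt_le_trans wr).
have [r1 r10 h1] := chol_neq0 hY y0.
have [r2 [r20 r2r r2r1]] := pos_min r0 r10.
have hx' : chol (cderiv (fun w => coord s (f w))) z.
  by apply: (hol_deriv r0) => w /hr [].
apply: (chol_quot r20 hx' hY y0) => w wr.
have [fw gw _ _] := hr _ (lt_le_trans wr r2r).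
have [/cderivE -> _] := form_der fw gw.
by rewrite mulfK // h1 // (lt_le_trans wr).
Qed.

End LocalForm.

(** * Changes of charts and the entire forms *)

Section Transition.
Variable R : realType.
Local Notation C := (Cplx R).
Implicit Types (a b c d : {poly C}) (f g : C -> option C) (s t : bool) (z w : C).

Lemma generic_quad_swap n m a b c d : generic_quad n m a b c d -> generic_quad m n c d a b.
Proof.
case=> h1 h2 h3; split => // s t x y A B Cp D E0 Ex Ey.
apply: (h3 t s y x); rewrite -[LHS]opprK -[RHS]oppr0; congr (- _);
  [rewrite -{}E0 | rewrite -{}Ey | rewrite -{}Ex]; rewrite /curve_eq /A /B /Cp /D; ring.
Qed.

Lemma solution_swap n m a b c d f g : solution n m a b c d f g -> solution m n c d a b g f.
Proof.
case=> h1 [sa sb sc sd] mf mg E; split => //; first exact: generic_quad_swap.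
move=> z s t gs ft; rewrite -[LHS]opprK -[RHS]oppr0; congr (- _).
by rewrite -{}(E z t s ft gs) /curve_eq; ring.
Qed.

Lemma form_swap n m a b c d f g s t z : solution n m a b c d f g ->
  in_chart s (f z) -> in_chart t (g z) ->
  form m n c d a b g f t s z = form n m a b c d f g s t z.
Proof.
move=> sol fs gt; have [h1 h2] := form_der sol fs gt.
apply: form_uniq => //; first exact: solution_swap.
  set p := form _ _ _ _ _ _ _ _ _ _ _ in h2 *.
  by rewrite [X in cder _ _ X](_ : _ = - (p * dF_x n m a b c d f g s t z)) // /dF_x /dF_y /curve_eq; ring.
set p := form _ _ _ _ _ _ _ _ _ _ _ in h1 *.
by rewrite [X in cder _ _ X](_ : _ = p * dF_y n m a b c d f g s t z) // /dF_x /dF_y /curve_eq; ring.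
Qed.

(** When x is replaced by 1 / x, dx becomes - dx / x^2 and F becomes F / x^(k + 2), whence the
    factor - x^k. *)
Lemma form_transition_x k m a b c d f g s t z : solution k.+2 m a b c d f g ->
  in_chart s (f z) -> in_chart (~~ s) (f z) -> in_chart t (g z) ->
  form k.+2 m a b c d f g (~~ s) t z =
  - (coord s (f z)) ^+ k * form k.+2 m a b c d f g s t z.
Proof.
move=> sol fs fs' gt; have [h1 h2] := form_der sol fs gt.
have [_ [sa sb sc sd] mf mg E] := sol.
have [x0 xV] := coord_inv fs fs'.
have [r1 r10 k1] := meromorphic_chart mf fs.
have [r2 r20 k2] := meromorphic_chart mf fs'.
have [r [r0 rr1 rr2]] := pos_min r10 r20.
have E0 := E z s t fs gt.
set phi := form k.+2 m a b c d f g s t z in h1 h2 *.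
set x := coord s (f z) in x0 xV E0 *.
have X0 : x ^+ k != 0 by rewrite expf_neq0.
have xk2 : x ^+ k.+2 = x ^+ k * (x * x) by rewrite !exprSr mulrA.
have xk1 : x ^+ k.+1 = x ^+ k * x by rewrite exprSr.
have sA := size_chart s sa; have sB := size_chart s sb.
apply: form_uniq => //.
  have hV := cderV x0 h1.
  have -> : - x ^+ k * phi * dF_y k.+2 m a b c d f g (~~ s) t z =
     - (phi * dF_y k.+2 m a b c d f g s t z) / x ^+ 2.
    rewrite /dF_y xV !chart_chart // /curve_eq !horner_rev // xk2 -/x.
    move: (x ^+ k) X0 => X X0; field.
    by rewrite x0 X0.
  apply: cder_ext r0 _ hV => w wr.
  have [fw _] := k1 w (lt_le_trans wr rr1); have [fw' _] := k2 w (lt_le_trans wr rr2).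
  by have [_ ->] := coord_inv fw fw'.
(* By Euler's relation the new F_x is a multiple of (k + 2) F - x F_x, and F = 0 on the curve. *)
suff -> : - x ^+ k * phi * dF_x k.+2 m a b c d f g (~~ s) t z = phi * dF_x k.+2 m a b c d f g s t z.
  exact: h2.
have polE (p : {poly C}) : (polar k.+2 p).[x] = k.+2%:R * p.[x] - x * p^`().[x].
  by rewrite hornerD hornerN hornerMn hornerM hornerX mulr_natl.
rewrite /dF_x xV !chart_chart // !deriv_rev /curve_eq !horner_rev ?size_polar // !polE xk1 -/x.
move: E0; rewrite /curve_eq.
move: (x ^+ k) X0 => X X0.
move: (k.+2%:R) => K.
move: (chart_poly k.+2 s a).[x] (chart_poly k.+2 s a)^`().[x] (chart_poly k.+2 s b).[x]
  (chart_poly k.+2 s b)^`().[x] (chart_poly m t c).[coord t (g z)]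
  (chart_poly m t d).[coord t (g z)] => A0 A1 B0 B1 C0 D0 E0.
have -> : - X * phi * ((X * x)^-1 * (K * A0 - x * A1) * D0 - (X * x)^-1 * (K * B0 - x * B1) * C0) =
  - phi / x * (K * (A0 * D0 - B0 * C0) - x * (A1 * D0 - B1 * C0)).
  by field; rewrite x0 X0.
by rewrite E0; field.
Qed.

(** By [form_transition_x], x^i times the form becomes - (1 / x)^(k - i) times the form in the
    coordinate 1 / x; [chart_form] absorbs the sign. *)
Definition chart_exp k s i : nat := if s then (k - i)%N else i.

(* The pullback of x^i y^j dx / F_y, up to sign, computed in the charts s and t. *)
Definition chart_form k l a b c d f g s t (i j : nat) z : C :=
  (-1) ^+ s * (-1) ^+ t * coord s (f z) ^+ chart_exp k s i * coord t (g z) ^+ chart_exp l t j *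
  form k.+2 l.+2 a b c d f g s t z.

Lemma chart_form_x k l a b c d f g s t i j z : solution k.+2 l.+2 a b c d f g -> (i <= k)%N ->
  in_chart s (f z) -> in_chart (~~ s) (f z) -> in_chart t (g z) ->
  chart_form k l a b c d f g (~~ s) t i j z = chart_form k l a b c d f g s t i j z.
Proof.
move=> sol ik fs fs' gt; rewrite /chart_form (form_transition_x sol fs fs' gt).
have [x0 ->] := coord_inv fs fs'.
move: (coord s (f z)) x0 => x x0; move: (form _ _ _ _ _ _ _ _ _ _ _) (_ ^+ chart_exp l t j) => p y.
rewrite exprVn.
have -> : x ^+ k = x ^+ chart_exp k s i * x ^+ chart_exp k (~~ s) i.
  by rewrite -exprD; congr (_ ^+ _); case: s {fs fs'} => /=; rewrite ?subnK ?subnKC.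
have : x ^+ chart_exp k (~~ s) i != 0 by rewrite expf_neq0.
move: (x ^+ chart_exp k (~~ s) i) (x ^+ chart_exp k s i) ((-1) ^+ t) => u v w u0.
by case: s {fs fs'}; rewrite /= ?expr0 ?expr1; field.
Qed.

Lemma chart_form_swap k l a b c d f g s t i j z : solution k.+2 l.+2 a b c d f g ->
  in_chart s (f z) -> in_chart t (g z) ->
  chart_form l k c d a b g f t s j i z = chart_form k l a b c d f g s t i j z.
Proof. by move=> sol fs gt; rewrite /chart_form (form_swap sol fs gt); ring. Qed.

Lemma chart_form_indep k l a b c d f g s t s' t' i j z : solution k.+2 l.+2 a b c d f g ->
  (i <= k)%N -> (j <= l)%N ->
  in_chart s (f z) -> in_chart s' (f z) -> in_chart t (g z) -> in_chart t' (g z) ->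
  chart_form k l a b c d f g s t i j z = chart_form k l a b c d f g s' t' i j z.
Proof.
move=> sol ik jl fs fs' gt gt'; transitivity (chart_form k l a b c d f g s' t i j z).
  by case: (eqVneq s s') fs' => [-> //|ss' fs']; rewrite -(chart_form_x j sol ik fs' _ gt);
   [congr chart_form | ]; move: fs ss'; case: s s' {fs'} => [] [].
have sol' := solution_swap sol.
rewrite -!(chart_form_swap i j sol) //.
by case: (eqVneq t t') gt' => [-> //|tt' gt']; rewrite -(chart_form_x i sol' jl gt' _ fs');
  [congr chart_form | ]; move: gt tt'; case: t t' {gt'} => [] [].
Qed.

Definition entire_form k l a b c d f g (i j : nat) z : C :=
  chart_form k l a b c d f g (~~ isSome (f z)) (~~ isSome (g z)) i j z.

Lemma in_chart_isSome (o : option C) : in_chart (~~ isSome o) o.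
Proof. by case: o. Qed.

Lemma entire_formE k l a b c d f g s t i j z : solution k.+2 l.+2 a b c d f g ->
  (i <= k)%N -> (j <= l)%N -> in_chart s (f z) -> in_chart t (g z) ->
  entire_form k l a b c d f g i j z = chart_form k l a b c d f g s t i j z.
Proof.
by move=> sol ik jl fs gt; apply: chart_form_indep => //; exact: in_chart_isSome.
Qed.

Lemma chol_exp (h : C -> C) z i : chol h z -> chol (fun w => h w ^+ i) z.
Proof.
move=> [l hl]; exists (('X^i)^`().[h z] * l); apply: cder_ext ltr01 _ (cder_poly 'X^i hl) => w _.
by rewrite hornerXn.
Qed.

Lemma entire_form_chol k l a b c d f g i j z : solution k.+2 l.+2 a b c d f g ->
  (i <= k)%N -> (j <= l)%N -> chol (entire_form k l a b c d f g i j) z.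
Proof.
move=> sol ik jl; set s := ~~ isSome (f z); set t := ~~ isSome (g z).
have fs : in_chart s (f z) := in_chart_isSome _.
have gt : in_chart t (g z) := in_chart_isSome _.
have [r r0 hr] := chart_disc sol fs gt.
have [|_ _ /(chol_exp (chart_exp k s i))[x' hx] /(chol_exp (chart_exp l t j))[y' hy]] := hr z.
  by rewrite subrr nm0.
have [p' hp] := form_chol sol fs gt.
eexists; apply: cder_ext r0 _ (cderM (cderM (cderZ ((-1) ^+ s * (-1) ^+ t) hx) hy) hp).
by move=> w /hr [fw gw _ _]; rewrite (entire_formE sol ik jl fw gw).
Qed.

End Transition.

(** * Rescaling and the norm of the forms *)

Section Brody.
Variable R : realType.
Local Notation C := (Cplx R).
Implicit Types (z w : C).

Definition real_cont (N : C -> R) z : Prop := forall e, 0 < e -> exists2 d : R, 0 < d &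
  forall w, nm (w - z) < d -> `|N w - N z| <= e.

Lemma real_contD N1 N2 z : real_cont N1 z -> real_cont N2 z ->
  real_cont (fun w => N1 w + N2 w) z.
Proof.
move=> h1 h2 e e0; have e2 : 0 < e / 2 by lra.
have [d1 d10 k1] := h1 _ e2; have [d2 d20 k2] := h2 _ e2.
have [d [d0 dd1 dd2]] := pos_min d10 d20.
exists d => // w wd; rewrite opprD addrACA.
have := k1 w (lt_le_trans wd dd1); have := k2 w (lt_le_trans wd dd2).
by have := ler_normD (N1 w - N1 z) (N2 w - N2 z); lra.
Qed.

Lemma nm_dist z w : `|nm z - nm w| <= nm (z - w).
Proof.
rewrite ler_norml; have h1 := nmD (z - w) w; have h2 := nmD (w - z) z.
rewrite subrK in h1; rewrite subrK nmB in h2; apply/andP; split; lra.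
Qed.

Lemma real_cont_nm (h : C -> C) z : ccont h z -> real_cont (fun w => nm (h w)) z.
Proof.
move=> /ccontP ch e /ch [d d0 hd]; exists d => // w /hd.
by apply: le_trans; exact: nm_dist.
Qed.

Lemma real_cont_sum (I : Type) (r : seq I) (F : I -> C -> R) z :
  (forall i, real_cont (F i) z) -> real_cont (fun w => \sum_(i <- r) F i w) z.
Proof.
move=> hF; elim: r => [|i r IH].
  by move=> e e0; exists 1 => // w _; rewrite !big_nil subrr normr0 ltW.
have -> : (fun w => \sum_(j <- i :: r) F j w) = (fun w => F i w + \sum_(j <- r) F j w).
  by apply/funext => w; rewrite big_cons.
exact: real_contD.
Qed.

(** The maximum is taken over the square of half-side T, a compact product of segments that contains
    the disc. *)
Lemma square_max (F : C -> R) (z0 : C) (T : R) : 0 <= T -> (forall z, real_cont F z) ->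
  exists z1, forall z, nm (z - z0) <= T -> F z <= F z1.
Proof.
move=> T0 cF.
pose pt (p : R * R) : C := z0 + (rc p.1 + ii R * rc p.2).
pose A := `[- T, T] `*` `[- T, T] : set (R * R).
have cA : compact A by apply: compact_setX; exact: segment_compact.
have A0 : A !=set0 by exists (0, 0); split; rewrite /= in_itv /= oppr_le0 T0.
have cFp : continuous (F \o pt).
  move=> p; apply/cvgrPdist_le => e e0; have [d d0 hd] := cF (pt p) _ e0.
  have d2 : 0 < d / 2 by lra.
  apply: filterS (nbhsx_ballx p (d / 2) d2) => q [] /=; rewrite /ball /= => q1 q2.
  rewrite distrC; apply: hd.
  have -> : pt q - pt p = rc (q.1 - p.1) + ii R * rc (q.2 - p.2).
    by rewrite /pt !rcB; ring.
  apply: le_lt_trans (nmD _ _) _; rewrite nmM nm_ii mul1r !nm_rc.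
  by rewrite distrC in q1; rewrite distrC in q2; lra.
have [p _ hp] := compact_EVT_max A0 cA (continuous_subspaceT cFp).
exists (pt p) => z zT.
have -> : F z = (F \o pt) (complex.Re (z - z0), complex.Im (z - z0)).
  by rewrite /= /pt /= -ReImE addrC subrK.
apply: hp; rewrite inE; split; rewrite /= in_itv /= -ler_norml.
  exact: le_trans (nm_re _) zT.
exact: le_trans (nm_im _) zT.
Qed.

(* z1 maximizes N z (T - |z - z0|) on a large disc. *)
Lemma brody (N : C -> R) (z0 : C) (K : R) : (forall z, 0 <= N z) ->
  (forall z, real_cont N z) -> 0 < N z0 -> 0 < K ->
  exists z1 (rho : R), [/\ 0 < rho, 0 < N z1, K <= rho * N z1 &
    forall w, nm (w - z1) < rho -> N w <= 2 * N z1].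
Proof.
move=> N0 cN Nz0 K0.
(* Chosen so that F z0 below is [2 * K], twice the bound wanted for [rho * N z1]. *)
pose T := 2 * K / N z0.
have T0 : 0 < T by rewrite divr_gt0 // mulr_gt0.
(* Truncation makes F continuous everywhere and 0 outside the disc, so the maximizer found on the
   square lies in the disc. *)
pose F w := N w * Num.max 0 (T - nm (w - z0)).
have cmax z e : 0 < e -> forall w, nm (w - z) <= e ->
    `|Num.max 0 (T - nm (w - z0)) - Num.max 0 (T - nm (z - z0))| <= e.
  move=> e0 w we; have := nm_dist (w - z0) (z - z0).
  have -> : w - z0 - (z - z0) = w - z by ring.
  move: (nm (w - z0)) (nm (z - z0)) => u v; rewrite ler_norml => /andP[k1 k2].
  by rewrite ler_norml; case: (leP 0 (T - u)) => ?; case: (leP 0 (T - v)) => ?; lra.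
have cF z : real_cont F z.
  move=> e e0; pose Q := N z + T + 1.
  have Nz := N0 z.
  have Q0 : 0 < Q by rewrite /Q; lra.
  have [e1 [e10 e11]] := pos_min ltr01 (divr_gt0 e0 Q0).
  rewrite ler_pdivlMr // => e1Q.
  have [d d0 hd] := cN z _ e10.
  have [d' [d'0 d'd d'e]] := pos_min d0 e10.
  exists d' => // w wd; have h1 := hd w (lt_le_trans wd d'd).
  have h2 := cmax z _ e10 w (ltW (lt_le_trans wd d'e)).
  rewrite /F; have Mw : `|Num.max 0 (T - nm (w - z0))| <= T.
    rewrite ger0_norm; last by rewrite le_max lexx.
    by rewrite ge_max (ltW T0) /=; have := nm_ge0 (w - z0); lra.
  move: (Num.max 0 (T - nm (w - z0))) (Num.max 0 (T - nm (z - z0))) h2 Mw => u v h2 Mw.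
  have -> : N w * u - N z * v = (N w - N z) * u + N z * (u - v) by ring.
  apply: le_trans (ler_normD _ _) _; rewrite !normrM (ger0_norm Nz).
  have k1 : `|N w - N z| * `|u| <= e1 * T by apply: ler_pM.
  have k2 : N z * `|u - v| <= N z * e1 by rewrite ler_wpM2l.
  by apply: le_trans e1Q; rewrite /Q; lra.
have [z1 hz1] := square_max z0 (ltW T0) cF.
have Fz0 : F z0 = N z0 * T.
  by rewrite /F subrr nm0 subr0; congr (_ * _); apply/max_idPr; exact: ltW.
have F0 : 0 < F z0 by rewrite Fz0 mulr_gt0.
have Fz1 : F z0 <= F z1 by apply: hz1; rewrite subrr nm0 ltW.
have pos : 0 < T - nm (z1 - z0).
  rewrite ltNge; apply/negP => h; have : F z1 = 0.
    by rewrite /F (_ : Num.max 0 _ = 0) ?mulr0 //; apply/max_idPl.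
  lra.
have Fz1E : F z1 = N z1 * (T - nm (z1 - z0)).
  by rewrite /F; congr (_ * _); apply/max_idPr; exact: ltW.
(* On the disc of radius rho about z1 the weight is still at least rho, half its value at z1; hence
   the factor 2. *)
pose rho := (T - nm (z1 - z0)) / 2.
have rho0 : 0 < rho by rewrite divr_gt0.
have Fr : F z1 = 2 * rho * N z1 by rewrite Fz1E /rho; field.
have NT : N z0 * T = 2 * K by rewrite /T mulrC divfK // lt0r_neq0.
have K1 : K <= rho * N z1 by lra.
exists z1, rho; split => //.
  by have := lt_le_trans K0 K1; rewrite pmulr_rgt0.
move=> w wr.
have wz : nm (w - z0) <= nm (w - z1) + nm (z1 - z0).
  by apply: le_trans (nmD _ _); rewrite addrA subrK.
have h1 : rho <= T - nm (w - z0) by rewrite /rho in wr *; lra.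
have Fw : F w <= F z1 by apply: hz1; lra.
have h2 : N w * rho <= F w.
  by rewrite /F ler_wpM2l // le_max h1 orbT.
rewrite -(ler_pM2r rho0); lra.
Qed.

Lemma locally_constant (T : Type) (f : C -> T) :
  (forall z, exists2 r : R, 0 < r & forall w, nm (w - z) < r -> f w = f z) ->
  forall z w, f w = f z.
Proof.
move=> loc z w; pose gam (t : R) := z + rc t * (w - z).
have gamB t u : nm (gam u - gam t) = `|u - t| * nm (w - z).
  have -> : gam u - gam t = rc (u - t) * (w - z) by rewrite /gam rcB; ring.
  by rewrite nmM nm_rc.
pose K := nm (w - z) + 1; have K0 : 0 < K by rewrite /K; have := nm_ge0 (w - z); lra.
have near t : exists2 d : R, 0 < d & forall u, `|u - t| < d -> f (gam u) = f (gam t).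
  have [r r0 hr] := loc (gam t); exists (r / K); first by rewrite divr_gt0.
  move=> u; rewrite ltr_pdivlMr // => ud; apply: hr; rewrite gamB.
  by apply: le_lt_trans ud; rewrite ler_wpM2l // /K lerDl.
suff : f (gam 1) = f (gam 0) by rewrite /gam rc1 rc0 mul1r mul0r addr0 addrC subrK.
apply: (@real_ind R 0 1 (fun t => f (gam t) = f (gam 0))) => //.
- move=> t /andP[t0 t1] /(_ t) ht; have [d d0 hd] := near t; exists d => // u /andP[tu ud] _.
  by rewrite hd ?gtr0_norm ?subr_gt0 //; [apply: ht; rewrite t0 lexx | lra].
- move=> t /andP[t0 t1] ht; have [d d0 hd] := near t.
  pose u := Num.max 0 (t - d / 2).
  have ua : 0 <= u by rewrite le_max lexx.
  have ut : u < t by rewrite gt_max t0 /=; lra.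
  have ud : t - d / 2 <= u by rewrite le_max lexx orbT.
  rewrite -(hd u); last by rewrite ltr0_norm; lra.
  by apply: ht; rewrite ua.
- by rewrite ler01 lexx.
Qed.

Section FormNorm.
Variables (k l : nat) (a b c d : {poly C}) (f g : C -> option C).
Hypothesis sol : solution k.+2 l.+2 a b c d f g.
Local Notation Phi := (entire_form k l a b c d f g).

(** A chart-independent size of the derivative of (f, g), in the place of the metric in Brody's
    lemma. *)
Definition form_norm z : R := \sum_(i < k.+1) \sum_(j < l.+1) nm (Phi i j z).

Lemma form_norm_ge0 z : 0 <= form_norm z.
Proof. by apply: sumr_ge0 => i _; apply: sumr_ge0 => j _; exact: nm_ge0. Qed.

Lemma form_norm_cont z : real_cont form_norm z.
Proof.
apply: real_cont_sum => i; apply: real_cont_sum => j; apply: real_cont_nm.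
have [p hp] := @entire_form_chol R k l a b c d f g i j z sol (ltn_ord i) (ltn_ord j).
exact: cder_cont hp.
Qed.

Lemma entire_form_le i j z : (i <= k)%N -> (j <= l)%N -> nm (Phi i j z) <= form_norm z.
Proof.
move=> ik jl; rewrite /form_norm (bigD1 (Ordinal (ik : (i < k.+1)%N))) //=.
rewrite (bigD1 (Ordinal (jl : (j < l.+1)%N))) //= -addrA lerDl addr_ge0 ?sumr_ge0 // => j' _.
  exact: nm_ge0.
by apply: sumr_ge0 => *; exact: nm_ge0.
Qed.

Lemma chart_exp_corner q s : (chart_exp q s (if s then q else 0) = 0)%N.
Proof. by case: s => //=; rewrite subnn. Qed.

Lemma nm_sign (s : bool) : nm ((-1) ^+ s : C) = 1.
Proof. by case: s; rewrite ?expr0 ?expr1 ?nmN nm1. Qed.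

Lemma nm_chart_form s t i j z :
  nm (chart_form k l a b c d f g s t i j z) =
  nm (coord s (f z)) ^+ chart_exp k s i * nm (coord t (g z)) ^+ chart_exp l t j *
  nm (form k.+2 l.+2 a b c d f g s t z).
Proof. by rewrite /chart_form !nmM !nm_sign !nmX !mul1r. Qed.

(** For an extremal choice of i and j the chart exponents are 0, so one entire form is, up to sign,
    the form itself. *)
Lemma form_le s t z : in_chart s (f z) -> in_chart t (g z) ->
  nm (form k.+2 l.+2 a b c d f g s t z) <= form_norm z.
Proof.
move=> fs gt.
have i0 : ((if s then k else 0) <= k)%N by case: s {fs}.
have j0 : ((if t then l else 0) <= l)%N by case: t {gt}.
have := entire_form_le z i0 j0; rewrite (entire_formE sol i0 j0 fs gt) nm_chart_form.
by rewrite !chart_exp_corner !expr0 !mul1r.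
Qed.

(** Each of the (k + 1)(l + 1) monomials has modulus at most 1 when both coordinates do. *)
Lemma form_ge s t z : in_chart s (f z) -> in_chart t (g z) ->
  nm (coord s (f z)) <= 1 -> nm (coord t (g z)) <= 1 ->
  form_norm z <= (k.+1 * l.+1)%N%:R * nm (form k.+2 l.+2 a b c d f g s t z).
Proof.
move=> fs gt x1 y1; rewrite /form_norm.
apply: (@le_trans _ _ (\sum_(i < k.+1) \sum_(j < l.+1) nm (form k.+2 l.+2 a b c d f g s t z))).
  apply: ler_sum => i _; apply: ler_sum => j _.
  rewrite (@entire_formE _ k l a b c d f g s t i j z sol (ltn_ord i) (ltn_ord j) fs gt).
  rewrite nm_chart_form ler_piMl ?nm_ge0 // mulr_ile1 ?exprn_ge0 ?exprn_ile1 ?nm_ge0 //.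
by rewrite !sumr_const !card_ord -mulrnA -[_ *+ _]mulr_natl (mulnC l.+1) lexx.
Qed.

(** If all the entire forms vanish, the coordinate of f has zero derivative in every chart by
    [form_der], and f is locally constant. *)
Lemma form_norm_neq0 : nonconstant f -> exists z, 0 < form_norm z.
Proof.
move=> nf; apply: contrapT => N; apply: nf; exists (f 0).
have N0 z : form_norm z = 0.
  by apply/eqP; rewrite eq_le form_norm_ge0 andbT leNgt; apply/negP => h; apply: N; exists z.
move=> z; apply: (@locally_constant _ f) => {}z.
set s := ~~ isSome (f z); set t := ~~ isSome (g z).
have fs : in_chart s (f z) := in_chart_isSome _.
have gt : in_chart t (g z) := in_chart_isSome _.
have [r r0 hr] := chart_disc sol fs gt; exists r => // w wr.
have zz : nm (z - z) < r by rewrite subrr nm0.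
have [fw _ _ _] := hr w wr.
apply: (coord_inj fw fs); apply/eqP; rewrite -subr_eq0; apply/eqP/nm_eq0/eqP.
rewrite eq_le nm_ge0 andbT.
have := @segment_bound R (fun w => coord s (f w)) z w 0; rewrite mul0r; apply => u u01.
have [fu gu _ _] := hr _ (segment_in u01 zz wr).
have [h1 _] := form_der sol fu gu; eexists; first exact: h1.
have := form_le fu gu; rewrite N0 => h.
by rewrite nmM; have := nm_ge0 (dF_y k.+2 l.+2 a b c d f g s t (z + rc u * (w - z))); nra.
Qed.

End FormNorm.
End Brody.

(** * Sequences of germs along an ultrafilter *)

Section Sequences.
Variable R : realType.
Local Notation C := (Cplx R).
Variable U : set_system nat.
Hypothesis UU : UltraFilter U.
Implicit Types (u v : nat -> C -> C).


(** The limit is the supremum of the y that lie below [x k] for U-many k; the ultrafilter decides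
    each comparison, which replaces the extraction of a subsequence. *)
Lemma ultra_limR (x : nat -> R) (M : R) : U [set k | `|x k| <= M] ->
  exists l, forall e, 0 < e -> U [set k | `|x k - l| <= e].
Proof.
move=> hM; pose S := [set y | U [set k | y <= x k]].
have nonempty (P : set nat) : U P -> exists k, P k.
  by move=> /filter_ex.
have hS : has_sup S.
  split.
    by exists (- M); apply: filterS hM => k /=; rewrite ler_norml => /andP[].
  exists M => y Sy; have [k [/= k1 k2]] := nonempty _ (filterI Sy hM).
  by apply: le_trans k1 _; move: k2; rewrite ler_norml => /andP[].
exists (sup S) => e e0.
have [y Sy ye] := sup_adherent e0 hS.
have N : U [set k | x k < sup S + e].
  have [h|h] := in_ultra_setVsetC [set k | x k < sup S + e] UU; first exact: h.
  have : S (sup S + e).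
    by apply: filterS h => k /= /negP; rewrite -leNgt.
  by move=> /(ub_le_sup hS.2); lra.
apply: filterS (filterI Sy N) => k [/= k1 k2].
by rewrite ler_norml; apply/andP; split; lra.
Qed.

Lemma ultra_lim (x : nat -> C) (M : R) : U [set k | nm (x k) <= M] ->
  exists l, forall e, 0 < e -> U [set k | nm (x k - l) <= e].
Proof.
move=> hM.
have [a ha] : exists a, forall e, 0 < e -> U [set k | `|complex.Re (x k) - a| <= e].
  by apply: (@ultra_limR _ M); apply: filterS hM => k /=; apply: le_trans; exact: nm_re.
have [b hb] : exists b, forall e, 0 < e -> U [set k | `|complex.Im (x k) - b| <= e].
  by apply: (@ultra_limR _ M); apply: filterS hM => k /=; apply: le_trans; exact: nm_im.
exists (rc a + ii R * rc b) => e e0; have e2 : 0 < e / 2 by lra.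
apply: filterS (filterI (ha _ e2) (hb _ e2)) => k [/= k1 k2].
rewrite [x k]ReImE.
have -> : rc (complex.Re (x k)) + ii R * rc (complex.Im (x k)) - (rc a + ii R * rc b) =
  rc (complex.Re (x k) - a) + ii R * rc (complex.Im (x k) - b) by rewrite !rcB; ring.
by apply: le_trans (nmD _ _) _; rewrite nmM nm_ii mul1r !nm_rc; lra.
Qed.

Definition hol_le (r M : R) (h : C -> C) : Prop :=
  forall z, nm z < r -> chol h z /\ nm (h z) <= M.

(* Bounds and convergence are along U, on a disc that does not depend on the index. *)
Definition bounded_germs u : Prop :=
  exists r M : R, [/\ 0 < r, 0 <= M & U [set k | hol_le r M (u k)]].
Definition small_germs u : Prop :=
  exists2 r : R, 0 < r & forall e, 0 < e -> U [set k | hol_le r e (u k)].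
Definition eq_germs u v : Prop :=
  exists2 r : R, 0 < r & U [set k | forall z, nm z < r -> u k z = v k z].

Lemma hol_le_sub r r' M M' h : r' <= r -> M <= M' -> hol_le r M h -> hol_le r' M' h.
Proof.
move=> rr MM hh z zr; have [h1 h2] := hh z (lt_le_trans zr rr).
by split=> //; exact: le_trans MM.
Qed.

Lemma hol_leM r M1 M2 h1 h2 : 0 <= M1 -> 0 <= M2 -> hol_le r M1 h1 -> hol_le r M2 h2 ->
  hol_le r (M1 * M2) (fun z => h1 z * h2 z).
Proof.
move=> M10 M20 k1 k2 z zr; have [[l1 a1] b1] := k1 z zr; have [[l2 a2] b2] := k2 z zr.
split; first by eexists; exact: cderM a1 a2.
by rewrite nmM ler_pM // nm_ge0.
Qed.

Lemma hol_leD r M1 M2 h1 h2 : hol_le r M1 h1 -> hol_le r M2 h2 ->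
  hol_le r (M1 + M2) (fun z => h1 z + h2 z).
Proof.
move=> k1 k2 z zr; have [[l1 a1] b1] := k1 z zr; have [[l2 a2] b2] := k2 z zr.
split; first by eexists; exact: cderD a1 a2.
by apply: le_trans (nmD _ _) _; exact: lerD.
Qed.

Lemma hol_le_ext r M h1 h2 : (forall z, nm z < r -> h1 z = h2 z) ->
  hol_le r M h1 -> hol_le r M h2.
Proof.
move=> E hh z zr; have [[l a] b] := hh z zr; rewrite -E //; split => //.
exists l; apply: (cder_ext (d := r - nm z)) a; first by rewrite subr_gt0.
move=> w wz; apply: E; have := nmD (w - z) z; rewrite subrK => k; lra.
Qed.

(** Cauchy's estimate on circles of radius r / 4 about the points of modulus below r / 2. *)
Lemma hol_le_deriv r M h : 0 < r -> hol_le r M h -> hol_le (r / 2) (8 * M / r) (cderiv h).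
Proof.
move=> r0 hh z zr.
have sub w : nm (w - z) < r / 2 -> nm w < r.
  by move=> wz; have := nmD (w - z) z; rewrite subrK => k; lra.
have r2 : 0 < r / 2 by lra.
split; first by apply: (hol_deriv r2) => w /sub /hh [].
have zr' : nm z < r by lra.
have -> : 8 * M / r = 2 * M / (r / 4) by field; rewrite lt0r_neq0.
apply: (@cauchy_est R h z (cderiv h z) (r / 4) (r / 2)); try lra.
  by apply: cderivP; exact: (hh z zr').1.
by move=> w /sub /hh.
Qed.

Lemma bounded_cst c : bounded_germs (fun _ _ => c).
Proof.
exists 1, (nm c); split => //; first exact: nm_ge0.
by apply: filterS filterT => k _ z _; split => //; exists 0; exact: cder_cst.
Qed.

Lemma bounded_ext u v : eq_germs u v -> bounded_germs u -> bounded_germs v.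
Proof.
move=> [r r0 E] [r' [M [r'0 M0 h]]]; have [s [s0 sr sr']] := pos_min r0 r'0.
exists s, M; split => //; apply: filterS (filterI E h) => k [/= k1 k2].
apply: hol_le_ext (hol_le_sub sr' (lexx _) k2) => z zs.
by apply: k1; exact: lt_le_trans sr.
Qed.

Lemma small_ext u v : eq_germs u v -> small_germs u -> small_germs v.
Proof.
move=> [r r0 E] [r' r'0 h]; have [s [s0 sr sr']] := pos_min r0 r'0.
exists s => // e e0; apply: filterS (filterI E (h _ e0)) => k [/= k1 k2].
apply: hol_le_ext (hol_le_sub sr' (lexx _) k2) => z zs.
by apply: k1; exact: lt_le_trans sr.
Qed.

Lemma boundedM u v : bounded_germs u -> bounded_germs v ->
  bounded_germs (fun k z => u k z * v k z).
Proof.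
move=> [r [M [r0 M0 h]]] [r' [M' [r'0 M'0 h']]]; have [s [s0 sr sr']] := pos_min r0 r'0.
exists s, (M * M'); split => //; first exact: mulr_ge0.
apply: filterS (filterI h h') => k [/= k1 k2].
by apply: hol_leM => //; [exact: hol_le_sub k1 | exact: hol_le_sub k2].
Qed.

Lemma boundedD u v : bounded_germs u -> bounded_germs v ->
  bounded_germs (fun k z => u k z + v k z).
Proof.
move=> [r [M [r0 M0 h]]] [r' [M' [r'0 M'0 h']]]; have [s [s0 sr sr']] := pos_min r0 r'0.
exists s, (M + M'); split => //; first exact: addr_ge0.
apply: filterS (filterI h h') => k [/= k1 k2].
by apply: hol_leD => //; [exact: hol_le_sub k1 | exact: hol_le_sub k2].
Qed.

Lemma boundedN u : bounded_germs u -> bounded_germs (fun k z => - u k z).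
Proof.
move=> h; apply: bounded_ext (boundedM (bounded_cst (-1)) h).
by exists 1 => //; apply: filterS filterT => k _ z _; rewrite mulN1r.
Qed.

Lemma bounded_poly (p : {poly C}) u : bounded_germs u -> bounded_germs (fun k z => p.[u k z]).
Proof.
move=> hu; elim/poly_ind: p => [|p c IH].
  by apply: bounded_ext (bounded_cst 0); exists 1 => //; apply: filterS filterT => k _ z _; rewrite horner0.
apply: bounded_ext (boundedD (boundedM IH hu) (bounded_cst c)).
by exists 1 => //; apply: filterS filterT => k _ z _; rewrite hornerMXaddC.
Qed.

Lemma bounded_curve_eq (p q p' q' : {poly C}) u v : bounded_germs u -> bounded_germs v ->
  bounded_germs (fun k z => curve_eq p q p' q' (u k z) (v k z)).
Proof.
move=> hu hv; apply: boundedD; first by apply: boundedM; exact: bounded_poly.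
by apply: boundedN; apply: boundedM; exact: bounded_poly.
Qed.

Lemma smallM u v : small_germs u -> bounded_germs v -> small_germs (fun k z => u k z * v k z).
Proof.
move=> [r r0 h] [r' [M [r'0 M0 h']]]; have [s [s0 sr sr']] := pos_min r0 r'0.
exists s => // e e0; have M1 : 0 < M + 1 by lra.
apply: filterS (filterI (h _ (divr_gt0 e0 M1)) h') => k [/= k1 k2].
apply: (@hol_le_sub s s (e / (M + 1) * M)) => //.
  by rewrite mulrAC ler_pdivrMr // ler_pM2l //; lra.
apply: hol_leM => //; [by rewrite divr_ge0 // ltW | exact: hol_le_sub k1 | exact: hol_le_sub k2].
Qed.

Lemma smallD u v : small_germs u -> small_germs v -> small_germs (fun k z => u k z + v k z).
Proof.
move=> [r r0 h] [r' r'0 h']; have [s [s0 sr sr']] := pos_min r0 r'0.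
exists s => // e e0; have e2 : 0 < e / 2 by lra.
apply: filterS (filterI (h _ e2) (h' _ e2)) => k [/= k1 k2].
rewrite (_ : e = e / 2 + e / 2); last by field.
by apply: hol_leD; [exact: hol_le_sub k1 | exact: hol_le_sub k2].
Qed.

Lemma smallMl u v : bounded_germs u -> small_germs v -> small_germs (fun k z => u k z * v k z).
Proof.
move=> hu hv; apply: small_ext (smallM hv hu).
by exists 1 => //; apply: filterS filterT => k _ z _; rewrite mulrC.
Qed.

Lemma smallB u v : small_germs u -> small_germs v -> small_germs (fun k z => u k z - v k z).
Proof.
move=> hu hv; apply: small_ext (smallD hu (smallMl (bounded_cst (-1)) hv)).
by exists 1 => //; apply: filterS filterT => k _ z _; rewrite mulN1r.
Qed.

Lemma bounded_deriv u : bounded_germs u -> bounded_germs (fun k => cderiv (u k)).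
Proof.
move=> [r [M [r0 M0 h]]]; exists (r / 2), (8 * M / r); split; first by lra.
  by rewrite divr_ge0 ?mulr_ge0 // ltW.
by apply: filterS h => k /= ?; exact: hol_le_deriv.
Qed.

Lemma small_deriv u : small_germs u -> small_germs (fun k => cderiv (u k)).
Proof.
move=> [r r0 h]; exists (r / 2); first by lra.
move=> e e0; have er : 0 < e * r / 8 by rewrite divr_gt0 // mulr_gt0.
apply: filterS (h _ er) => k /= hk.
have -> : e = 8 * (e * r / 8) / r by field; rewrite lt0r_neq0.
exact: hol_le_deriv.
Qed.

(** As the derivative is bounded, a lower bound at 0 persists, halved, on a disc whose radius
    depends only on the bounds. *)
Lemma bounded_inv u (c : R) : 0 < c -> bounded_germs u -> U [set k | c <= nm (u k 0)] ->
  bounded_germs (fun k z => (u k z)^-1) /\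
  exists2 r : R, 0 < r & U [set k | forall z, nm z < r -> u k z != 0].
Proof.
move=> c0 hu huc; have [r [M [r0 M0 h]]] := hu.
have [r' [M' [r'0 M'0 h']]] := bounded_deriv hu.
have M1 : 0 < 2 * M' + 1 by lra.
have [s1 [s10 s1r s1r']] := pos_min r0 r'0.
have [s [s0 ss1 sc]] := pos_min s10 (divr_gt0 c0 M1).
rewrite ler_pdivlMr // in sc.
have low : U [set k | forall z, nm z < s -> chol (u k) z /\ c / 2 <= nm (u k z)].
  apply: filterS (filterI huc (filterI h h')) => k [/= k1 [k2 k3]] z zs.
  have zr : nm z < r by lra.
  split; first by have [] := k2 z zr.
  have : nm (u k z - u k 0) <= M' * nm (z - 0).
    apply: segment_bound => t t01.
    have zt : nm (0 + rc t * (z - 0)) < s.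
      have := @segment_in R 0 z 0 s t t01; rewrite !subr0 nm0; apply => //.
    exists (cderiv (u k) (0 + rc t * (z - 0))).
      by apply: cderivP; have [] := k2 _ (lt_le_trans zt (le_trans ss1 s1r)).
    by have [] := k3 _ (lt_le_trans zt (le_trans ss1 s1r')).
  rewrite subr0 nmB => k4.
  have := nmD (u k 0 - u k z) (u k z); rewrite subrK => k5.
  have : M' * nm z <= M' * s by rewrite ler_wpM2l // ltW.
  lra.
split.
  exists s, (2 / c); split => //; first by rewrite divr_ge0 // ltW.
  apply: filterS low => k /= hk z /hk [[l hl] k1].
  have z0 : u k z != 0 by rewrite -nm_gt0; apply: lt_le_trans k1; lra.
  split; first by eexists; exact: cderV z0 hl.
  rewrite nmV -[2 / c]invrK lef_pV2 ?posrE ?nm_gt0 ?invr_gt0 ?divr_gt0 //.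
  by rewrite invf_div.
exists s => //; apply: filterS low => k /= hk z /hk [_ k1].
by rewrite -nm_gt0; apply: lt_le_trans k1; lra.
Qed.

(** The inverse of u is a bounded germ by [bounded_inv]. This is the division step behind each
    conclusion of [almost_constant]. *)
Lemma small_cancel u v (c : R) : 0 < c -> bounded_germs u -> U [set k | c <= nm (u k 0)] ->
  small_germs (fun k z => u k z * v k z) -> small_germs v.
Proof.
move=> c0 hu huc huv; have [hi [r r0 hr]] := bounded_inv c0 hu huc.
apply: small_ext (smallMl hi huv); exists r => //.
by apply: filterS hr => k /= hk z /hk z0; rewrite mulrA mulVf // mul1r.
Qed.

Lemma small_at0 u e : small_germs u -> 0 < e -> U [set k | nm (u k 0) <= e].
Proof.
move=> [r r0 h] e0; apply: filterS (h _ e0) => k /= /(_ 0); rewrite nm0.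
by move=> /(_ r0) [].
Qed.

End Sequences.

(** * Hyperbolicity *)

Section AlmostConstant.
Variable R : realType.
Local Notation C := (Cplx R).
Variable U : set_system nat.
Hypothesis UU : UltraFilter U.

Lemma derivn_eq0_poly (p : {poly C}) (y : C) : (forall j, p^`(j).[y] = 0) -> p = 0.
Proof.
move=> h; apply: contrapT => /eqP p0.
have sp : size p = (size p).-1.+1 by rewrite prednK // size_poly_gt0.
have := h (size p).-1.
have s1 : (size p^`((size p).-1) <= 1)%N.
  apply/leq_sizeP => j j0; rewrite coef_derivn nth_default ?mul0rn //.
  by rewrite sp -[X in (X < _)%N]addn0 -addnS leq_add2l.
rewrite [p^`(_)]size1_polyC // hornerC coef_derivn addn0 => /eqP.
by rewrite ffactnn -mulr_natr mulf_eq0 lead_coef_eq0 (negbTE p0) pnatr_eq0 eqn0Ngt fact_gt0.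
Qed.

Lemma curve_eq_line (A B P Q : {poly C}) (x y : C) j :
  (A.[x] *: Q - B.[x] *: P)^`(j).[y] = curve_eq A B P^`(j) Q^`(j) x y.
Proof. by rewrite derivnB !derivnZ hornerD hornerN !hornerZ. Qed.

Lemma curve_eq_cvg (A B P Q : {poly C}) (x y : nat -> C) (x0 y0 : C) (e : R) : 0 < e ->
  (forall e, 0 < e -> U [set k | nm (x k - x0) <= e]) ->
  (forall e, 0 < e -> U [set k | nm (y k - y0) <= e]) ->
  U [set k | nm (curve_eq A B P Q (x k) (y k) - curve_eq A B P Q x0 y0) <= e].
Proof.
move=> e0 hx hy.
have cp (p : {poly C}) (u : nat -> C) (u0 : C) :
    (forall e, 0 < e -> U [set k | nm (u k - u0) <= e]) ->
    forall e, 0 < e -> U [set k | nm (p.[u k] - p.[u0]) <= e].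
  move=> hu {}e {}e0.
  have /ccontP/(_ _ e0)[d d0 hd] := cder_cont (cder_poly p (cder_id u0)).
  have d2 : 0 < d / 2 by lra.
  by apply: filterS (hu _ d2) => k /= k1; apply: hd; lra.
have cM (u v : nat -> C) (u0 v0 : C) :
    (forall e, 0 < e -> U [set k | nm (u k - u0) <= e]) ->
    (forall e, 0 < e -> U [set k | nm (v k - v0) <= e]) ->
    forall e, 0 < e -> U [set k | nm (u k * v k - u0 * v0) <= e].
  move=> hu hv {}e {}e0.
  have n1 := nm_ge0 u0; have n2 := nm_ge0 v0.
  have K0 : 0 < 1 + nm u0 + nm v0 by lra.
  have [e1 [e10 e11 e1K]] := pos_min ltr01 (divr_gt0 e0 K0).
  rewrite ler_pdivlMr // in e1K.
  apply: filterS (filterI (hu _ e10) (hv _ e10)) => k [/= k1 k2].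
  have -> : u k * v k - u0 * v0 = (u k - u0) * (v k - v0) + (u k - u0) * v0 + u0 * (v k - v0) by ring.
  apply: le_trans (nmD _ _) _; apply: le_trans (lerD (nmD _ _) (lexx _)) _.
  rewrite !nmM; apply: le_trans e1K.
  have m1 := nm_ge0 (u k - u0); have m2 := nm_ge0 (v k - v0).
  have : nm (u k - u0) * nm (v k - v0) <= e1 * 1.
    by apply: ler_pM => //; apply: le_trans e11.
  have : nm (u k - u0) * nm v0 <= e1 * nm v0 by rewrite ler_wpM2r.
  have : nm u0 * nm (v k - v0) <= nm u0 * e1 by rewrite ler_wpM2l.
  nra.
have e2 : 0 < e / 2 by lra.
apply: filterS (filterI (cM _ _ _ _ (cp A _ _ hx) (cp Q _ _ hy) _ e2)
  (cM _ _ _ _ (cp B _ _ hx) (cp P _ _ hy) _ e2)) => k [/= k1 k2].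
rewrite /curve_eq opprD addrACA; apply: le_trans (nmD _ _) _.
by rewrite -opprD nmN; lra.
Qed.

Variables (A B P Q : {poly C}) (X Y phi psi : nat -> C -> C) (c : R).
Let Fx k z := curve_eq A^`() B^`() P Q (X k z) (Y k z).
Let Fy j k z := curve_eq A B P^`(j) Q^`(j) (X k z) (Y k z).

(* Along a sequence of solutions of the Hamiltonian system x' = phi F_y, y' = - phi F_x for
   which phi and x phi become constant, x becomes constant, so that F_y and then, as
   F_x does not vanish with F_y, all the derivatives of F in y tend to 0. *)
Lemma almost_constant :
  (forall x y, curve_eq A B P Q x y = 0 -> curve_eq A^`() B^`() P Q x y = 0 ->
     curve_eq A B P^`() Q^`() x y = 0 -> False) ->
  (forall x, A.[x] *: Q - B.[x] *: P != 0) ->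
  0 < c -> bounded_germs U X -> bounded_germs U Y -> bounded_germs U phi ->
  small_germs U (fun k => cderiv (phi k)) -> small_germs U (fun k => cderiv (psi k)) ->
  U [set k | c <= nm (phi k 0)] ->
  (exists2 r : R, 0 < r & U [set k | forall z, nm z < r ->
     [/\ cder (X k) z (phi k z * Fy 1 k z), cder (Y k) z (- (phi k z * Fx k z)),
         Fy 0 k z = 0 & psi k z = X k z * phi k z]]) -> False.
Proof.
move=> smooth line c0 bX bY bphi sphi spsi phic [r0 r00 hr0].
have [r1 [Mphi [r10 _ hphi]]] := bphi.
have [r [r_gt0 rr0 rr1]] := pos_min r00 r10.
have hr : U [set k | forall z, nm z < r ->
     [/\ cder (X k) z (phi k z * Fy 1 k z), cder (Y k) z (- (phi k z * Fx k z)),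
         Fy 0 k z = 0, psi k z = X k z * phi k z & cder (phi k) z (cderiv (phi k) z)]].
  apply: filterS (filterI hr0 hphi) => k [/= h1 h2] z zr.
  have [? ? ? ?] := h1 z (lt_le_trans zr rr0); have [? _] := h2 z (lt_le_trans zr rr1).
  by split => //; exact: cderivP.
have bF p q p' q' : bounded_germs U (fun k z => curve_eq p q p' q' (X k z) (Y k z)).
  exact: (bounded_curve_eq UU).
(* psi' = X' phi + X phi', where psi' and phi' are small, so X' phi is small; then phi is
   cancelled. *)
have sX : small_germs U (fun k => cderiv (X k)).
  apply: (small_cancel UU c0 bphi phic).
  apply: (small_ext UU) (smallB UU spsi (smallMl UU bX sphi)); exists r => //.
  apply: filterS hr => k /= h z zr; have [h1 _ _ _ h2] := h z zr.
  have -> : cderiv (psi k) z = cderiv (X k) z * phi k z + X k z * cderiv (phi k) z.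
    apply: cderivE; rewrite (cderivE h1).
    apply: (@cder_ext _ (fun w => X k w * phi k w) _ z _ (r - nm z)); last exact: cderM.
      by rewrite subr_gt0.
    move=> w wz; have [|_ _ _ -> _] // := h w.
    by have := nmD (w - z) z; rewrite subrK; lra.
  by rewrite addrK mulrC.
(* X' = phi F_y by the Hamiltonian system. *)
have sFy : small_germs U (Fy 1).
  apply: (small_cancel UU c0 bphi phic); apply: (small_ext UU) sX; exists r => //.
  by apply: filterS hr => k /= h z /h [h1 _ _ _ _]; exact: cderivE.
have at0 (u : nat -> C -> C) : bounded_germs U u -> exists M, U [set k | nm (u k 0) <= M].
  move=> [r' [M [r'0 M0 h]]]; exists M; apply: filterS h => k /= /(_ 0); rewrite nm0.
  by move=> /(_ r'0) [].
(* The limit (x, y) of the centres lies on the curve and F_y vanishes there, so F_x does not, by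
   smoothness. *)
have [MX hMX] := at0 _ bX; have [MY hMY] := at0 _ bY.
have [x hx] := ultra_lim UU hMX; have [y hy] := ultra_lim UU hMY.
have lim0 p q p' q' (l : R) : 0 < l ->
    (forall e, 0 < e -> U [set k | nm (curve_eq p q p' q' (X k 0) (Y k 0)) <= e]) ->
    curve_eq p q p' q' x y = 0.
  move=> l0 h; apply: nm_eq0; apply/eqP; rewrite eq_le nm_ge0 andbT.
  apply/ler_addgt0Pr => e e0; rewrite add0r; have e2 : 0 < e / 2 by lra.
  have [k [/= k1 k2]] := filter_ex (filterI (h _ e2) (curve_eq_cvg p q p' q' e2 hx hy)).
  have := nmD (curve_eq p q p' q' (X k 0) (Y k 0))
    (- (curve_eq p q p' q' (X k 0) (Y k 0) - curve_eq p q p' q' x y)).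
  rewrite nmN opprB addrC subrK; lra.
have F0 : curve_eq A B P Q x y = 0.
  apply: (lim0 _ _ _ _ 1) => // e e0; apply: filterS hr => k /= /(_ 0); rewrite nm0.
  by move=> /(_ r_gt0) [_ _ E _ _]; rewrite [curve_eq _ _ _ _ _ _]E nm0 ltW.
have F1 : curve_eq A B P^`() Q^`() x y = 0.
  by apply: (lim0 _ _ _ _ 1) => // e e0; exact: (small_at0 UU sFy e0).
have Fx0 : curve_eq A^`() B^`() P Q x y != 0.
  by apply/eqP => E; exact: smooth F0 E F1.
pose d := nm (curve_eq A^`() B^`() P Q x y) / 2.
have d0 : 0 < d by rewrite divr_gt0 // nm_gt0.
have Fxd : U [set k | d <= nm (Fx k 0)].
  apply: filterS (curve_eq_cvg A^`() B^`() P Q d0 hx hy) => k /=.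
  rewrite nmB -/(Fx k 0); have := nmD (curve_eq A^`() B^`() P Q x y - Fx k 0) (Fx k 0).
  by rewrite subrK /d; lra.
(* The (j+1)-st y-derivative of F has, along the solution, a derivative equal to a bounded multiple
   of X' minus phi F_x times the next y-derivative. By induction the last product is small; phi and
   F_x are cancelled. *)
have sF j : small_germs U (Fy j.+1).
  elim: j => [//|j IH].
  apply: (small_cancel UU c0 bphi phic).
  apply: (small_cancel UU d0 (bF _ _ _ _) Fxd).
  apply: (small_ext UU) (smallB UU (smallMl UU (bF A^`() B^`() P^`(j.+1) Q^`(j.+1)) sX) (small_deriv UU IH)).
  exists r => //; apply: filterS hr => k /= h z zr; have [h1 h2 _ _ _] := h z zr.
  have -> : cderiv (Fy j.+1 k) z =
     curve_eq A^`() B^`() P^`(j.+1) Q^`(j.+1) (X k z) (Y k z) * cderiv (X k) z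
     + Fy j.+2 k z * (- (phi k z * Fx k z)).
    apply: cderivE; rewrite (cderivE h1).
    have := cderB (cderM (cder_poly A h1) (cder_poly Q^`(j.+1) h2))
       (cderM (cder_poly B h1) (cder_poly P^`(j.+1) h2)).
    set E := (E in cder _ _ E -> _).
    rewrite [E in _ -> cder _ _ E](_ : _ = E) //.
    by rewrite /E /Fy /curve_eq !derivnS; ring.
  by rewrite /Fx; ring.
(* All the y-derivatives of F vanish at (x, y), so F vanishes on the vertical line through x. *)
apply/negP: (line x); apply/negPn/eqP.
apply: (@derivn_eq0_poly _ y) => -[|j]; rewrite curve_eq_line ?derivn0 //.
by apply: (lim0 _ _ _ _ 1) => // e e0; exact: (small_at0 UU (sF j) e0).
Qed.

End AlmostConstant.

(** * Staying in a fixed chart on a disc of controlled size *)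

Section Landau.
Variable R : realType.
Local Notation C := (Cplx R).
Implicit Types (z w p : C) (s t : bool).

Lemma chart_near f s p : meromorphic f -> in_chart s (f p) -> forall e : R, 0 < e ->
  exists2 d : R, 0 < d & forall w, nm (w - p) < d ->
    in_chart s (f w) /\ nm (coord s (f w) - coord s (f p)) <= e.
Proof.
move=> mf fp e e0; have [r r0 hr] := meromorphic_chart mf fp.
have [|_ [l /cder_cont/ccontP/(_ _ e0)[d d0 hd]]] := hr p; first by rewrite subrr nm0.
have [d' [d'0 d'r d'd]] := pos_min r0 d0; exists d' => // w wd; split.
  by have [] := hr w (lt_le_trans wd d'r).
exact: hd (lt_le_trans wd d'd).
Qed.

(** If [f p] were outside the chart, its other coordinate would be 0, and the coordinates of nearby
    points in the chart [s] would be arbitrarily large. *)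
Lemma chart_limit f s p (M : R) : meromorphic f -> 0 <= M ->
  (forall d : R, 0 < d -> exists w, [/\ nm (w - p) < d, in_chart s (f w) & nm (coord s (f w)) <= M]) ->
  in_chart s (f p) /\ nm (coord s (f p)) <= M.
Proof.
move=> mf M0 h.
have fp : in_chart s (f p).
  apply: contrapT => nfp.
  have fp' : in_chart (~~ s) (f p) by move: nfp; case: s {h} => /=; case: (f p) => [v|] //=; case: eqP.
  have x0 : coord (~~ s) (f p) = 0.
    apply/eqP/negPn/negP => x0; apply: nfp.
    by have := in_chart_switch fp' x0; rewrite negbK.
  have e0 : 0 < (M + 1)^-1 by rewrite invr_gt0; lra.
  have [d d0 hd] := chart_near mf fp' e0; have [w [wd fw xw]] := h d d0.
  have [fw' ] := hd w wd; rewrite x0 subr0.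
  have [y0 ->] := coord_inv fw fw'.
  rewrite nmV lef_pV2 ?posrE ?nm_gt0 //; last by lra.
  lra.
split=> //; apply/ler_addgt0Pr => e e0.
have [d d0 hd] := chart_near mf fp e0; have [w [wd fw xw]] := h d d0.
have [_] := hd w wd; rewrite nmB => k1.
have := nmD (coord s (f p) - coord s (f w)) (coord s (f w)); rewrite subrK; lra.
Qed.

Lemma poly_bound (q : {poly C}) : exists2 M : R, 0 <= M & forall x, nm x <= 2 -> nm q.[x] <= M.
Proof.
elim/poly_ind: q => [|q e [M M0 IH]]; first by exists 0 => // x _; rewrite horner0 nm0.
exists (M * 2 + nm e); first by rewrite addr_ge0 ?mulr_ge0 ?nm_ge0.
move=> x x2; rewrite hornerMXaddC; apply: le_trans (nmD _ _) _.
by rewrite lerD2r nmM ler_pM ?nm_ge0 // IH.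
Qed.

Lemma curve_eq_bound (A B P Q : {poly C}) : exists2 M : R, 0 < M &
  forall x y, nm x <= 2 -> nm y <= 2 -> nm (curve_eq A B P Q x y) <= M.
Proof.
have [MA MA0 hA] := poly_bound A; have [MB MB0 hB] := poly_bound B.
have [MP MP0 hP] := poly_bound P; have [MQ MQ0 hQ] := poly_bound Q.
exists (MA * MQ + MB * MP + 1).
  by have := mulr_ge0 MA0 MQ0; have := mulr_ge0 MB0 MP0; lra.
move=> x y x2 y2; apply: le_trans (nmD _ _) _; rewrite nmN !nmM.
have : nm A.[x] * nm Q.[y] <= MA * MQ by rewrite ler_pM ?nm_ge0 ?hA ?hQ.
have : nm B.[x] * nm P.[y] <= MB * MP by rewrite ler_pM ?nm_ge0 ?hB ?hP.
lra.
Qed.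

Section Exit.
Variables (n m : nat) (a b c d : {poly C}) (f g : C -> option C).
Hypothesis sol : solution n m a b c d f g.

(** As long as both coordinates stay in the disc of radius 2 their derivatives are bounded, and this
    improves the bound 2 to 3 / 2. Real induction along the segment from p to w then shows that the
    coordinates do not escape. *)
Lemma chart_uniform s t (K lam delta : R) p : 0 < K -> 0 < lam -> 4 * K * lam * delta <= 1 ->
  (forall x y, nm x <= 2 -> nm y <= 2 ->
    nm (curve_eq (chart_poly n s a)^`() (chart_poly n s b)^`() (chart_poly m t c) (chart_poly m t d) x y) <= K
    /\ nm (curve_eq (chart_poly n s a) (chart_poly n s b) (chart_poly m t c)^`() (chart_poly m t d)^`() x y) <= K) ->
  in_chart s (f p) -> in_chart t (g p) ->
  nm (coord s (f p)) <= 1 -> nm (coord t (g p)) <= 1 ->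
  (forall w, nm (w - p) < delta -> in_chart s (f w) -> in_chart t (g w) ->
     nm (form n m a b c d f g s t w) <= 2 * lam) ->
  forall w, nm (w - p) < delta ->
  [/\ in_chart s (f w), in_chart t (g w), nm (coord s (f w)) <= 2 & nm (coord t (g w)) <= 2].
Proof.
move=> K0 lam0 Kd hK fp gp xp yp hform w wd.
have [_ _ mf mg _] := sol.
pose gam (u : R) := p + rc u * (w - p).
have gamB u v : nm (gam u - gam v) = `|u - v| * nm (w - p).
  have -> : gam u - gam v = rc (u - v) * (w - p) by rewrite /gam rcB; ring.
  by rewrite nmM nm_rc.
have gam0 : gam 0 = p by rewrite /gam rc0 mul0r addr0.
have gam1 : gam 1 = w by rewrite /gam rc1 mul1r addrC subrK.
have n0 := nm_ge0 (w - p).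
pose good (M : R) u := [/\ in_chart s (f (gam u)), in_chart t (g (gam u)),
   nm (coord s (f (gam u))) <= M & nm (coord t (g (gam u))) <= M].
(* The derivatives are at most [2 * lam * K] and the distance at most [delta], so the coordinates
   move by at most 1 / 2 from modulus at most 1. *)
have improve u : 0 <= u <= 1 -> (forall v, 0 <= v <= u -> good 2 v) -> good (3 / 2) u.
  move=> /andP[u0 u1] hv.
  have uu : 0 <= u <= u by rewrite u0 lexx.
  have [fu gu xu yu] := hv u uu.
  have seg (v : R) : 0 <= v <= 1 -> p + rc v * (gam u - p) = gam (v * u) /\ 0 <= v * u <= u.
    move=> /andP[v0 v1]; split; first by rewrite /gam rcM; ring.
    by rewrite mulr_ge0 //= ler_piMl.
  have du : nm (gam u - p) <= delta.
    by rewrite -gam0 gamB subr0 ger0_norm //; nra.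
  have delta0 : 0 <= delta by lra.
  have small : 2 * lam * K * nm (gam u - p) <= 1 / 2.
    have : 2 * lam * K * nm (gam u - p) <= 2 * lam * K * delta.
      by rewrite ler_wpM2l // !mulr_ge0 // ltW.
    lra.
  have bnd (v : R) : 0 <= v <= 1 -> exists l1 l2,
     [/\ cder (fun w => coord s (f w)) (p + rc v * (gam u - p)) l1,
         cder (fun w => coord t (g w)) (p + rc v * (gam u - p)) l2,
         nm l1 <= 2 * lam * K & nm l2 <= 2 * lam * K].
    move=> v01; have [-> vu] := seg v v01; have [fv gv xv yv] := hv _ vu.
    have [h1 h2] := form_der sol fv gv.
    exists (form n m a b c d f g s t (gam (v * u)) * dF_y n m a b c d f g s t (gam (v * u))),
      (- (form n m a b c d f g s t (gam (v * u)) * dF_x n m a b c d f g s t (gam (v * u)))).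
    have hf : nm (form n m a b c d f g s t (gam (v * u))) <= 2 * lam.
      apply: hform => //; rewrite -gam0 gamB subr0.
      case/andP: vu => vu0 vu1; rewrite ger0_norm //; nra.
    have [k1 k2] := hK _ _ xv yv.
    by split => //; rewrite ?nmN nmM ler_pM ?nm_ge0.
  have hx : nm (coord s (f (gam u)) - coord s (f p)) <= 2 * lam * K * nm (gam u - p).
    by apply: (@segment_bound _ (fun w => coord s (f w))) => v /bnd [l1 [l2 [? ? ? ?]]]; exists l1.
  have hy : nm (coord t (g (gam u)) - coord t (g p)) <= 2 * lam * K * nm (gam u - p).
    by apply: (@segment_bound _ (fun w => coord t (g w))) => v /bnd [l1 [l2 [? ? ? ?]]]; exists l2.
  split => //.
    have := nmD (coord s (f (gam u)) - coord s (f p)) (coord s (f p)); rewrite subrK; lra.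
  have := nmD (coord t (g (gam u)) - coord t (g p)) (coord t (g p)); rewrite subrK; lra.
have weaken u : good (3 / 2) u -> good 2 u by case=> ? ? ? ?; split => //; lra.
have near (u e : R) : 0 < e -> exists2 d' : R, 0 < d' & forall v, `|v - u| < d' -> nm (gam v - gam u) < e.
  move=> e0; exists (e / (nm (w - p) + 1)); first by rewrite divr_gt0 //; lra.
  move=> v; rewrite ltr_pdivlMr; last by lra.
  by move=> h; rewrite gamB; have := normr_ge0 (v - u); nra.
suff : good (3 / 2) 1 by move=> /weaken; rewrite /good gam1.
apply: (@real_ind R 0 1 (good (3 / 2))) => //.
- by rewrite /good gam0; split => //; lra.
- move=> u /andP[u0 u1] hu.
  have [fu gu xu yu] : good (3 / 2) u by apply: hu; rewrite u0 lexx.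
  have h2 : 0 < (1 / 2 : R) by lra.
  have [d1 d10 k1] := chart_near mf fu h2; have [d2 d20 k2] := chart_near mg gu h2.
  have [d3 [d30 d31 d32]] := pos_min d10 d20; have [d4 d40 k4] := near u _ d30.
  exists d4 => // v /andP[uv vd] v1; apply: improve; first by rewrite v1 andbT; lra.
  move=> v' /andP[v'0 v'v]; have [v'u|uv'] := lerP v' u.
    by apply/weaken/hu; rewrite v'0.
  have v'd : `|v' - u| < d4 by rewrite gtr0_norm; lra.
  have [f1 x1] := k1 _ (lt_le_trans (k4 _ v'd) d31).
  have [g1 y1] := k2 _ (lt_le_trans (k4 _ v'd) d32).
  split => //.
    have := nmD (coord s (f (gam v')) - coord s (f (gam u))) (coord s (f (gam u))); rewrite subrK; lra.
  have := nmD (coord t (g (gam v')) - coord t (g (gam u))) (coord t (g (gam u))); rewrite subrK; lra.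
- move=> u /andP[u0 u1] hu.
  have app (e : R) : 0 < e -> exists2 v, 0 <= v < u & nm (gam v - gam u) < e.
    move=> e0; have [d' d'0 hd'] := near u e e0.
    exists (Num.max 0 (u - d' / 2)); first by rewrite le_max lexx gt_max u0 /=; lra.
    have m1 : u - d' / 2 <= Num.max 0 (u - d' / 2) by rewrite le_max lexx orbT.
    have m2 : Num.max 0 (u - d' / 2) < u by rewrite gt_max u0 /=; lra.
    by apply: hd'; rewrite ltr0_norm; lra.
  have h32 : 0 <= (3 / 2 : R) by lra.
  have [|f1 x1] := @chart_limit f s (gam u) (3 / 2) mf h32.
    by move=> e /app [v vu ve]; exists (gam v); have [] := hu v vu.
  have [|g1 y1] := @chart_limit g t (gam u) (3 / 2) mg h32.
    by move=> e /app [v vu ve]; exists (gam v); have [] := hu v vu.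
  by split.
- by rewrite ler01 lexx.
Qed.

End Exit.

(** Since a and b do not vanish together at x, the vanishing of this polynomial would make c and d
    proportional, and they would have a common zero. *)
Lemma no_line n m a b c d s t (x : C) : (0 < m)%N ->
  no_common_zero n a b -> no_common_zero m c d -> (size c <= m.+1)%N -> (size d <= m.+1)%N ->
  (chart_poly n s a).[x] *: chart_poly m t d - (chart_poly n s b).[x] *: chart_poly m t c != 0.
Proof.
move=> m0 ab cd sc sd; apply/negP => /eqP E.
set P := chart_poly m t c in E; set Q := chart_poly m t d in E.
(* A root of S is a common zero; if S is a nonzero constant, the common zero is at infinity because
   m is positive. *)
have common (S : {poly C}) (u v : C) : P = u *: S -> Q = v *: S -> False.
  move=> PE QE; have [S1|/closed_rootP [y]] := eqVneq (size S) 1%N; last first.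
    move=> /eqP Sy; apply: (cd t y); rewrite -/P -/Q ?PE ?QE hornerZ Sy mulr0 //.
  apply: (cd (~~ t) 0); rewrite chart_chart // -/P -/Q ?PE ?QE rev_polyZ hornerZ horner_coef0 coef_rev subn0.
    by rewrite nth_default ?mulr0 // S1.
  by rewrite nth_default ?mulr0 // S1.
have [a0|a0] := eqVneq (chart_poly n s a).[x] 0.
  have [b0|b0] := eqVneq (chart_poly n s b).[x] 0; first exact: ab a0 b0.
  apply: (common Q 0 1); last by rewrite scale1r.
  move: E; rewrite a0 !scale0r sub0r => /eqP; rewrite oppr_eq0 scaler_eq0 (negbTE b0) /=.
  by move=> /eqP.
apply: (common P 1 ((chart_poly n s a).[x]^-1 * (chart_poly n s b).[x])); first by rewrite scale1r.
move: E => /eqP; rewrite subr_eq0 => /eqP E.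
by rewrite -scalerA -E scalerA mulVf // scale1r.
Qed.

End Landau.

(** * Nonexistence of solutions on a smooth curve *)

Section NoSolution.
Variable R : realType.
Local Notation C := (Cplx R).

Lemma cder_affine (h : C -> C) (p u z l : C) : cder h (p + u * z) l ->
  cder (fun w => h (p + u * w)) z (u * l).
Proof.
move=> hl; rewrite mulrC; apply: (@cder_comp _ h (fun w => p + u * w)) => //.
by have := cderD (cder_cst p z) (cderZ u (cder_id z)); rewrite add0r mulr1.
Qed.

Theorem no_solution_x k l (a b c d : {poly C}) f g :
  solution k.+3 l.+2 a b c d f g -> nonconstant f -> False.
Proof.
move=> sol nf; have [[ab cd sm] [sa sb sc sd] mf mg eq0] := sol.
pose N := form_norm k.+1 l a b c d f g.
have [z0 Nz0] : exists z, 0 < N z by exact: form_norm_neq0.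
have brodyk (i : nat) : exists p : C * R, [/\ 0 < p.2, 0 < N p.1, i.+1%:R <= p.2 * N p.1 &
    forall w, nm (w - p.1) < p.2 -> N w <= 2 * N p.1].
  have [|||z1 [rho h]] := @brody R N z0 i.+1%:R _ _ Nz0.
  - by move=> z; exact: form_norm_ge0.
  - by move=> z; exact: form_norm_cont.
  - by rewrite ltr0n.
  by exists (z1, rho).
have [pr hpr] := choice brodyk.
pose zc i := (pr i).1; pose rho i := (pr i).2; pose lam i := N (zc i).
(* A free ultrafilter: it contains every tail of the integers. *)
have [U [UU Uoo]] := ultraFilterLemma (@eventually_filter).
have Ularge (M : nat) : U [set i | (M <= i)%N] by apply: Uoo; exists M.
pose chart_of (o : option C) : bool := if o is Some v then ~~ (nm v <= 1) else true.
have chart_ofP o : in_chart (chart_of o) o /\ nm (coord (chart_of o) o) <= 1.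
  case: o => [v|] /=; last by rewrite nm0 ler01.
  case: leP => v1 //=; split; first by rewrite -nm_gt0 (lt_trans ltr01).
  by rewrite nmV invf_le1 ?(ltW v1) // (lt_trans ltr01).
(* The ultrafilter contains one of two complementary sets, so the centres use the same chart for
   U-many indices. *)
have [s Us] : exists s, U [set i | chart_of (f (zc i)) = s].
  have [h|h] := in_ultra_setVsetC [set i | chart_of (f (zc i)) = true] UU.
    by exists true.
  by exists false; apply: filterS h => i /= /negP; case: (chart_of (f (zc i))).
have [t Ut] : exists t, U [set i | chart_of (g (zc i)) = t].
  have [h|h] := in_ultra_setVsetC [set i | chart_of (g (zc i)) = true] UU.
    by exists true.
  by exists false; apply: filterS h => i /= /negP; case: (chart_of (g (zc i))).
pose A := chart_poly k.+3 s a; pose B := chart_poly k.+3 s b.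
pose P := chart_poly l.+2 t c; pose Q := chart_poly l.+2 t d.
(* In the chart s the exponents i0 and i1 give the monomials 1 and x. The second is available
   because the x-degree is at least 3. *)
pose i0 := if s then k.+1 else 0%N; pose i1 := if s then k else 1%N.
pose j0 := if t then l else 0%N.
have i0k : (i0 <= k.+1)%N by rewrite /i0; case: (s).
have i1k : (i1 <= k.+1)%N by rewrite /i1; case: (s).
have j0l : (j0 <= l)%N by rewrite /j0; case: (t).
pose sgn : C := (-1) ^+ s * (-1) ^+ t.
have sgn1 : nm sgn = 1 by rewrite nmM !nm_sign mulr1.
have sgn2 : sgn * sgn = 1.
  by rewrite /sgn; case: (s); case: (t); rewrite ?expr0 ?expr1; ring.
pose E i z := sgn * entire_form k.+1 l a b c d f g i j0 z.
have EE0 z : in_chart s (f z) -> in_chart t (g z) ->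
    E i0 z = form k.+3 l.+2 a b c d f g s t z.
  move=> fs gt; rewrite /E (entire_formE sol i0k j0l fs gt) /chart_form.
  by rewrite !chart_exp_corner !expr0 !mulr1 mulrA -/sgn sgn2 mul1r.
have EE1 z : in_chart s (f z) -> in_chart t (g z) ->
    E i1 z = coord s (f z) * form k.+3 l.+2 a b c d f g s t z.
  move=> fs gt; rewrite /E (entire_formE sol i1k j0l fs gt) /chart_form.
  have -> : chart_exp k.+1 s i1 = 1%N by rewrite /i1; case: (s) => //=; rewrite subSnn.
  by rewrite chart_exp_corner expr0 expr1 mulr1 -/sgn -[sgn * _ * _]mulrA mulrA sgn2 mul1r.
have Ehol i z : (i <= k.+1)%N -> chol (E i) z /\ nm (E i z) <= N z.
  move=> ik; split; last by rewrite nmM sgn1 mul1r; exact: entire_form_le.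
  by have [p hp] := entire_form_chol z sol ik j0l; exists (sgn * p); exact: cderZ.
have lam0 i : 0 < lam i by have [] := hpr i.
(* Rescaling by 1 / lam gives the forms total size 1 at the centre, and turns the disc of radius rho
   into one of radius at least i + 1. *)
pose sc_ i : C := rc (lam i)^-1.
pose pt i z := zc i + sc_ i * z.
have nm_sc i z : nm (sc_ i * z) = nm z / lam i.
  by rewrite nmM nm_rc gtr0_norm ?invr_gt0 // mulrC.
pose X i z := coord s (f (pt i z)); pose Y i z := coord t (g (pt i z)).
pose phi i z := sc_ i * E i0 (pt i z); pose psi i z := sc_ i * E i1 (pt i z).
have pt0 i : pt i 0 = zc i by rewrite /pt mulr0 addr0.
have scaled_hol j i : (j <= k.+1)%N -> hol_le i.+1%:R 2 (fun z => sc_ i * E j (pt i z)).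
  move=> jk z zi; have [h1 h2 h3 h4] := hpr i.
  have wr : nm (pt i z - zc i) < rho i.
    rewrite /pt addrAC subrr add0r nm_sc ltr_pdivrMr //.
    exact: lt_le_trans h3.
  have [[p hp] hN] := Ehol j (pt i z) jk; split.
    by exists (sc_ i * (sc_ i * p)); apply: cderZ; exact: cder_affine.
  rewrite nm_sc ler_pdivrMr //; apply: le_trans hN _; exact: h4.
have bounded_E j : (j <= k.+1)%N -> bounded_germs U (fun i z => sc_ i * E j (pt i z)).
  move=> jk; exists 1, 2; split => //; apply: filterS filterT => i _.
  by apply: hol_le_sub (scaled_hol j i jk) => //; rewrite ler1n.
(* Cauchy's estimate for a function bounded by 2 on the disc of radius i + 1 gives 16 / (i + 1). *)
have small_E j : (j <= k.+1)%N -> small_germs U (fun i => cderiv (fun z => sc_ i * E j (pt i z))).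
  move=> jk; exists (1 / 2); first by lra.
  move=> e e0; apply: filterS (Ularge (Num.truncn (16 / e)).+1) => i /= Mi.
  have i0_ : 0 < i.+1%:R :> R by rewrite ltr0n.
  have ie : 16 / e < i.+1%:R.
    by apply: lt_trans (truncnS_gt _) _; rewrite ltr_nat ltnS.
  apply: (@hol_le_sub _ (i.+1%:R / 2) (1 / 2) (8 * 2 / i.+1%:R)).
  - by rewrite ler_pM2r ?invr_gt0 // ler1n.
  - rewrite ler_pdivrMr //; rewrite ltr_pdivrMr // in ie; lra.
  - by apply: hol_le_deriv => //; exact: scaled_hol.
have [Kx Kx0 hKx] := curve_eq_bound A^`() B^`() P Q.
have [Ky Ky0 hKy] := curve_eq_bound A B P^`() Q^`().
pose K := Kx + Ky; have K0 : 0 < K by rewrite /K; lra.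
have K4 : 0 < (4 * K)^-1 by rewrite invr_gt0; lra.
(* Ensures [4 * K * r <= 1], which is the condition of [chart_uniform] after rescaling, for every
   index at once. *)
have [r [r0 r1 rK]] := pos_min ltr01 K4.
have Ugood : U [set i | forall z, nm z < r ->
    [/\ in_chart s (f (pt i z)), in_chart t (g (pt i z)), nm (X i z) <= 2 & nm (Y i z) <= 2]].
  apply: filterS (filterI Us Ut) => i [/= si ti] z zr.
  have [h1 h2 h3 h4] := hpr i.
  have [fs xs] := chart_ofP (f (zc i)); have [gt yt] := chart_ofP (g (zc i)).
  rewrite si in fs xs; rewrite ti in gt yt.
  apply: (@chart_uniform _ k.+3 l.+2 a b c d f g sol s t K (lam i) (r / lam i) (zc i)) => //.
  - have -> : 4 * K * lam i * (r / lam i) = 4 * K * r by field; rewrite lt0r_neq0.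
    by rewrite mulrC -ler_pdivlMr ?div1r //; lra.
  - move=> x y x2 y2; have := hKx x y x2 y2; have := hKy x y x2 y2; rewrite /K.
    by split; lra.
  - move=> w wd fw gw; apply: le_trans (h4 w _); first exact: form_le.
    apply: lt_le_trans wd _; rewrite ler_pdivrMr //; apply: le_trans h3.
    by apply: le_trans r1 _; rewrite ler1n.
  - by rewrite /pt addrAC subrr add0r nm_sc ltr_pM2r // invr_gt0.
have dX : U [set i | forall z, nm z < r ->
     [/\ cder (X i) z (phi i z * curve_eq A B P^`(1) Q^`(1) (X i z) (Y i z)),
         cder (Y i) z (- (phi i z * curve_eq A^`() B^`() P Q (X i z) (Y i z))),
         curve_eq A B P^`(0) Q^`(0) (X i z) (Y i z) = 0 & psi i z = X i z * phi i z]].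
  apply: filterS Ugood => i /= h z /h [fs gt _ _].
  have [h1 h2] := form_der sol fs gt.
  split.
  - by rewrite /phi EE0 // -mulrA; exact: (cder_affine h1).
  - by rewrite /phi EE0 // -mulrA -mulrN; exact: (cder_affine h2).
  - exact: eq0.
  - by rewrite /psi /phi EE0 // EE1 // /X mulrCA.
have bounded_chart (h : nat -> C -> C) :
    U [set i | forall z, nm z < r -> chol (h i) z /\ nm (h i z) <= 2] -> bounded_germs U h.
  by move=> hh; exists r, 2; split.
have cK0 : 0 < (k.+2 * l.+1)%N%:R :> R by rewrite ltr0n.
apply: (@almost_constant R U UU A B P Q X Y phi psi ((k.+2 * l.+1)%N%:R^-1)).
- by move=> x y; exact: sm.
- by move=> x; exact: no_line.
- by rewrite invr_gt0.
- apply: bounded_chart; apply: filterS (filterI Ugood dX) => i [/= h1 h2] z zr.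
  by have [_ _ ? _] := h1 z zr; have [? _ _ _] := h2 z zr; split => //; eexists; eassumption.
- apply: bounded_chart; apply: filterS (filterI Ugood dX) => i [/= h1 h2] z zr.
  by have [_ _ _ ?] := h1 z zr; have [_ ? _ _] := h2 z zr; split => //; eexists; eassumption.
- exact: bounded_E.
- exact: small_E.
- exact: small_E.
(* At the centre both coordinates have modulus at most 1, so [form_ge] bounds the single form below
   in terms of the whole norm. *)
- apply: filterS (filterI Us Ut) => i [/= si ti].
  have [fs xs] := chart_ofP (f (zc i)); have [gt yt] := chart_ofP (g (zc i)).
  rewrite si in fs xs; rewrite ti in gt yt.
  have := form_ge sol fs gt xs yt; rewrite -/(N _) -/(lam i) => h.
  rewrite /phi nm_sc pt0 EE0 // ler_pdivlMr // ler_pdivrMl //.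
- by exists r.
Qed.

(** One degree is at least 3. If n = 2 it is m, and the two sides are exchanged, with g in the role
    of f. *)
Theorem no_solution n m (a b c d : {poly C}) f g : (1 < n)%N -> (1 < m)%N -> (4 < n + m)%N ->
  solution n m a b c d f g -> nonconstant f -> nonconstant g -> False.
Proof.
case: n m => [|[|n]] [|[|m]] // _ _ nm5 sol nf ng.
case: n nm5 sol => [|n] nm5 sol; last exact: no_solution_x sol nf.
case: m nm5 sol => [|m] // nm5 sol.
exact: no_solution_x (solution_swap sol) ng.
Qed.

End NoSolution.

(** * From rational maps to the equation of the curve *)

Section RationalMaps.
Variable F : numClosedFieldType.
Implicit Types (a b c d : {poly F}) (o : option F).

Definition proj_quotient (u v : F) : option F := if v == 0 then None else Some (u / v).

Lemma proj_quotientZ (w u v : F) : w != 0 ->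
  proj_quotient (w * u) (w * v) = proj_quotient u v.
Proof.
move=> w0; rewrite /proj_quotient mulf_eq0 (negbTE w0) /=.
by case: eqP => // _; rewrite -mulf_div divff // mul1r.
Qed.

Lemma proj_quotient_eq (u v u' v' : F) : proj_quotient u v = proj_quotient u' v' ->
  u * v' - v * u' = 0.
Proof.
rewrite /proj_quotient; case: eqVneq => [->|v0]; case: eqVneq => [->|v'0] //.
  by rewrite mulr0 mul0r subrr.
case=> E; have -> : u = u / v * v by rewrite divfK.
by rewrite E; field.
Qed.

Lemma no_common_zero_coprime n a b : no_common_zero n a b -> coprimep a b.
Proof.
move=> ab; apply/Pdiv.ClosedField.coprimepP => x /eqP ax; apply/negP => /eqP bx.
exact: (ab false x ax bx).
Qed.

(** Reduction to lowest terms in [ratfun] thus multiplies numerator and denominator by the same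
    constant. *)
Lemma gcd_const n a b : no_common_zero n a b ->
  exists2 e : F, e != 0 & (forall p, p %/ gcdp a b = e *: p).
Proof.
move=> /no_common_zero_coprime; rewrite /coprimep => /size_poly1P [e e0 E].
by exists e^-1; [rewrite invr_eq0 | move=> p; rewrite E -alg_polyC divpZr // divp1].
Qed.

End RationalMaps.

Section RationalMapsC.
Variable R : realType.
Local Notation C := (Cplx R).
Implicit Types (a b c d : {poly C}) (o : option C).

Lemma ratfun_chart n a b s o : no_common_zero n a b ->
  (size a <= n.+1)%N -> (size b <= n.+1)%N -> in_chart s o ->
  ratfun a b o = proj_quotient (chart_poly n s a).[coord s o] (chart_poly n s b).[coord s o].
Proof.
move=> ab sa sb os; have [e e0 gE] := gcd_const ab.
rewrite /ratfun !gE -/(proj_quotient _ _).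
case: o os => [z|] /=.
  case: s => [z0|_]; last by rewrite !hornerZ -/(proj_quotient _ _) proj_quotientZ.
  rewrite !hornerZ -/(proj_quotient _ _) proj_quotientZ // !horner_rev // proj_quotientZ //.
  by rewrite invr_eq0 expf_neq0.
case: s => // _; rewrite !size_scale //.
(* Without a common zero at infinity one of a, b has degree n, so at infinity [ratfun] reads off the
   coefficients of degree n. *)
have -> : maxn (size a) (size b) = n.+1.
  apply/eqP; rewrite eqn_leq geq_max sa sb /= leqNgt; apply/negP; rewrite ltnS geq_max => /andP[sa' sb'].
  by apply: (ab true 0); rewrite horner_coef0 coef_rev subn0 nth_default.
by rewrite /= !coefZ !horner_coef0 !coef_rev !subn0 -/(proj_quotient _ _) proj_quotientZ.
Qed.

Lemma ratfun_solution n m a b c d f g : generic_quad n m a b c d ->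
  (size a <= n.+1)%N -> (size b <= n.+1)%N -> (size c <= m.+1)%N -> (size d <= m.+1)%N ->
  meromorphic f -> meromorphic g -> (forall z, ratfun a b (f z) = ratfun c d (g z)) ->
  solution n m a b c d f g.
Proof.
move=> gq sa sb sc sd mf mg E; split=> // z s t fs gt; have [ab cd _] := gq.
move: (E z); rewrite (ratfun_chart ab sa sb fs) (ratfun_chart cd sc sd gt).
exact: proj_quotient_eq.
Qed.

End RationalMapsC.

Theorem theorem1p2 (R : realType) (n m : nat)
  (hnm : 2 <= (m%:Z - 1) * (n%:Z - 1)) :
  exists Sigma : set (projective_space (Cplx R) (2 * n + 1) *
                      projective_space (Cplx R) (2 * m + 1)),
    proper_algebraic_subset Sigma /\
    forall a b c d : {poly (Cplx R)},
      (size a <= n.+1)%N -> (size b <= n.+1)%N -> b != 0 ->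
      (size c <= m.+1)%N -> (size d <= m.+1)%N -> d != 0 ->
      forall (p : projective_space (Cplx R) (2 * n + 1))
             (q : projective_space (Cplx R) (2 * m + 1)),
        homogeneous_coord p (coef_vector n a b) ->
        homogeneous_coord q (coef_vector m c d) ->
        ~ Sigma (p, q) ->
        ~ exists f g : Cplx R -> option (Cplx R),
            [/\ meromorphic f, meromorphic g, nonconstant f, nonconstant g &
                forall z, ratfun a b (f z) = ratfun c d (g z)].
Proof.
(* The factor i - 1 is then -1 or 0 and j - 1 is at least -1, so the product is at most 1, even with
   both factors negative. *)
have degree_lt2 (i j : nat) : (i < 2)%N -> (2 <= (i%:Z - 1) * (j%:Z - 1)) = false.
  case: i => [|[|]] // _; rewrite ?subrr ?mul0r // sub0r mulN1r opprB.
  by apply/negbTE; rewrite -ltNge; have : 0 <= j%:Z by []; lra.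
have m2 : (1 < m)%N.
  by rewrite ltnNge; apply/negP => h; move: hnm; rewrite degree_lt2.
have n2 : (1 < n)%N.
  by rewrite ltnNge; apply/negP => h; move: hnm; rewrite mulrC degree_lt2.
case: n m n2 m2 hnm => [|[|k]] [|[|l]] // _ _ hnm.
(* Degrees 2 and 2 would give the product 1. *)
have nm5 : (4 < k.+2 + l.+2)%N by case: k l hnm => [|k] [|l] // _; lia.
have [G [hG [v [w [v0 w0 vw]]] Gsmooth]] := generic_polynomial (Cplx R) k l.
exists [set x | forall H, [set G] H -> vanishes_at H x]; split.
  split; first by exists [set G]; split => // H ->.
  have dv : \dim <[v]>%VS == 1%N by rewrite dim_vline v0.
  have dw : \dim <[w]>%VS == 1%N by rewrite dim_vline w0.
  pose p0 : projective_space (Cplx R) (2 * k.+2 + 1) := exist _ <[v]>%VS dv.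
  pose q0 : projective_space (Cplx R) (2 * l.+2 + 1) := exist _ <[w]>%VS dw.
  move=> /seteqP [_ /(_ (p0, q0) I G erefl v w erefl erefl) E].
  by rewrite E eqxx in vw.
move=> a b c d sa sb _ sc sd _ p q hp hq NG [f [g [mf mg nf ng E]]].
(* G does not vanish at some representatives of p and q; they are multiples of the coefficient
   vectors, the case covered by [Gsmooth]. *)
have [v1 [w1 [hv1 hw1 Gvw]]] : exists v1 w1, [/\ homogeneous_coord p v1,
    homogeneous_coord q w1 & meval (row_mx v1 w1 0) G <> 0].
  apply: contrapT => N; apply: NG => H -> v1 w1 hv1 hw1.
  by apply: contrapT => N'; apply: N; exists v1, w1.
have /vlineP [x v1E] : v1 \in <[coef_vector k.+2 a b]>%VS.
  by rewrite -(hp : sval p = _) (hv1 : sval p = _) memv_line.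
have /vlineP [y w1E] : w1 \in <[coef_vector l.+2 c d]>%VS.
  by rewrite -(hq : sval q = _) (hw1 : sval q = _) memv_line.
have quad : generic_quad k.+2 l.+2 a b c d.
  by apply: (Gsmooth a b c d x y) => //; rewrite -v1E -w1E; apply/eqP.
apply: (no_solution _ _ nm5 (ratfun_solution quad sa sb sc sd mf mg E) nf ng) => //.
Qed.
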